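(* Let $N\in\mathbb{N}$, $h>0$ and $0<\alpha<1$. Then, for $n\in\mathbb{N}$ and $x\in\mathbb{R}^N\setminus\{0\}$, $$\mathcal{G}^{\alpha}_{n,h}(x)=\frac{1}{\Gamma(n)\,\pi^{N/2}|x|^N}\;H^{30}_{13}\left[\frac{|x|^2}{4h^\alpha}\;\middle|\;\begin{array}{c}(1,\alpha)\\ (n,\alpha),\ (\tfrac N2,1),\ (1,1)\end{array}\right],$$ where $H^{30}_{13}$ denotes the Fox H-function.
   Context: Here $\mathbb{N}=\{1,2,\dots\}$ and $\mathbb{N}_0=\{0,1,2,\dots\}$. Discrete scaled Wright function: for $0<\alpha<1$, $\beta\ge0$, $h>0$, $n,j\in\mathbb{N}_0$, $$\varphi^h_{\alpha,\beta}(n,j)=\frac{1}{2\pi i}\int_{\Upsilon}\frac{1}{z^{n+1}}\frac{\left(1-h(\frac{1-z}{h})^{\alpha}\right)^{j}}{(\frac{1-z}{h})^{\beta}}\,dz,$$ where $\Upsilon$ is the positively oriented circle centred at $0$ of radius $r\in(0,1)$ (principal powers). Gaussian kernel: $G_t(x)=(4\pi t)^{-N/2}e^{-|x|^2/(4t)}$, $t>0$, $x\in\mathbb{R}^N$. Discrete Gaussian kernel: $\mathcal{G}_{n,h}(x)=\frac{1}{h^n\Gamma(n)}\int_0^\infty e^{-t/h}t^{n-1}G_t(x)\,dt$, $n\in\mathbb{N}$. Fundamental solution: $$\mathcal{G}^{\alpha}_{n,h}(x)=\sum_{j=1}^{\infty}\varphi^h_{\alpha,1-\alpha}(n-1,j-1)\,\mathcal{G}_{j,h}(x),\quad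 n\in\mathbb{N}.$$ Fox H-function: for integers $0\le m\le q$, $0\le n\le p$, $a_i,b_j\in\mathbb{C}$, $\alpha_i,\beta_j>0$, $$H^{mn}_{pq}\left[z\;\middle|\;\begin{array}{c}(a_1,\alpha_1),\dots,(a_p,\alpha_p)\\(b_1,\beta_1),\dots,(b_q,\beta_q)\end{array}\right]=\frac{1}{2\pi i}\int_\gamma\frac{\prod_{j=1}^m\Gamma(b_j+\beta_js)\prod_{i=1}^n\Gamma(1-a_i-\alpha_is)}{\prod_{i=n+1}^p\Gamma(a_i+\alpha_is)\prod_{j=m+1}^q\Gamma(1-b_j-\beta_js)}\,z^{-s}\,ds,$$ where $\gamma$ is an infinite contour with the poles of the $\Gamma(b_j+\beta_js)$, $1\le j\le m$, on its left and the poles of the $\Gamma(1-a_i-\alpha_is)$, $1\le i\le n$, on its right. (For the $H^{30}_{13}$ in the claim the integrand is $\frac{\Gamma(n+\alpha s)\Gamma(N/2+s)\Gamma(1+s)}{\Gamma(1+\alpha s)}z^{-s}$, and $\gamma$ can be taken to be an upward vertical line to the right of all poles of the numerator.)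
   Formalization: The series defining the fundamental solution diverges when h^(1-α) > 2, so the identity is proved whenever that series converges; convergence is proved for h^(1-α) < 2, and the H-function is shown to exist for all h > 0. *)

(* Defs.v *)
From mathcomp Require Import all_boot all_order all_algebra.
From mathcomp Require Import complex.
From mathcomp Require Import all_classical all_reals all_analysis.

Set Implicit Arguments.
Unset Strict Implicit.
Unset Printing Implicit Defensive.

Import Order.TTheory GRing.Theory Num.Theory.
Import numFieldNormedType.Exports.

Local Open Scope classical_set_scope.
Local Open Scope ring_scope.
Local Open Scope complex_scope.

(* The library norm on 'rV[R]_N is the sup norm, hence this definition. *)
Definition enorm (R : realType) (N : nat) (x : 'rV[R]_N) : R :=
  Num.sqrt (\sum_(i < N) x 0 i ^+ 2).

Definition cexp (R : realType) (z : R[i]) : R[i] :=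
  (expR (complex.Re z) * cos (complex.Im z)) +i*
  (expR (complex.Re z) * sin (complex.Im z)).

Definition cabs (R : realType) (z : R[i]) : R :=
  Num.sqrt (complex.Re z ^+ 2 + complex.Im z ^+ 2).

(* Principal argument, with values in ]-pi, pi] (for z != 0). *)
Definition carg (R : realType) (z : R[i]) : R :=
  if 0 <= complex.Im z then acos (complex.Re z / cabs z)
  else - acos (complex.Re z / cabs z).

Definition clog (R : realType) (z : R[i]) : R[i] := ln (cabs z) +i* carg z.

(* Principal power; only meaningful for z != 0. *)
Definition cpow (R : realType) (z w : R[i]) : R[i] := cexp (w * clog z).

Definition cintegrable (R : realType) (D : set R) (f : R -> R[i]) : Prop :=
  (@lebesgue_measure R).-integrable D (fun t => (complex.Re (f t))%:E) /\
  (@lebesgue_measure R).-integrable D (fun t => (complex.Im (f t))%:E).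

Definition cintegral (R : realType) (D : set R) (f : R -> R[i]) : R[i] :=
  (\int[@lebesgue_measure R]_(t in D) complex.Re (f t)) +i*
  (\int[@lebesgue_measure R]_(t in D) complex.Im (f t)).

(* Integral over the positively oriented circle z = rho e^(i theta),
   0 <= theta <= 2 pi. *)
Definition circle_integral (R : realType) (rho : R) (f : R[i] -> R[i]) : R[i] :=
  cintegral `[0, pi *+ 2] (fun theta : R =>
    f (rho%:C * cexp (0 +i* theta)) * ('i * (rho%:C * cexp (0 +i* theta)))).

Definition euler_Gamma (R : realType) (s : R[i]) : R[i] :=
  cintegral `]0, +oo[ (fun t : R => cpow t%:C (s - 1) * (expR (- t))%:C).

(* Meromorphic continuation of Euler's integral by means of
   Gamma (s + k) = s (s + 1) ... (s + k - 1) Gamma s: here k is the least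
   natural number such that 0 < Re s + k.  At the poles 0, -1, -2, ... one
   factor of the product vanishes, so that the value is 0 and (Gamma s)^-1 = 0,
   as it should be for the entire function 1 / Gamma. *)
Definition Gamma (R : realType) (s : R[i]) : R[i] :=
  let k := Num.truncn (1 - complex.Re s) in
  euler_Gamma (s + k%:R) / \prod_(i < k) (s + i%:R).

(* Gamma is real on the real line. *)
Definition rGamma (R : realType) (x : R) : R := complex.Re (Gamma x%:C).

(* rho is the radius of the circle of integration, 0 < rho < 1. *)
Definition wright (R : realType) (rho h alpha beta : R) (n j : nat) : R[i] :=
  ((pi *+ 2)%:C * 'i)^-1 *
  circle_integral rho (fun z =>
    (z ^+ n.+1)^-1 *
    ((1 - h%:C * cpow ((1 - z) / h%:C) alpha%:C) ^+ j /
     cpow ((1 - z) / h%:C) beta%:C)).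

Definition gauss_kernel (R : realType) (N : nat) (t : R) (x : 'rV[R]_N) : R :=
  (4 * pi * t) `^ (- (N%:R / 2)) * expR (- (enorm x ^+ 2 / (4 * t))).

(* For n >= 1. *)
Definition discrete_gauss_kernel (R : realType) (N n : nat) (h : R)
    (x : 'rV[R]_N) : R :=
  (h ^+ n * rGamma n%:R)^-1 *
  \int[@lebesgue_measure R]_(t in `]0, +oo[)
    (expR (- (t / h)) * t ^+ n.-1 * gauss_kernel t x).

(* For n >= 1: partial sums (terms j = 1, ..., M) of the fundamental solution.
   R[i]^o is R[i] with the topology of its absolute value. *)
Definition fundamental_partial_sum (R : realType) (N : nat) (rho alpha : R)
    (n : nat) (h : R) (x : 'rV[R]_N) (M : nat) : R[i]^o :=
  \sum_(1 <= j < M.+1)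
    wright rho h alpha (1 - alpha) n.-1 j.-1 * (discrete_gauss_kernel j h x)%:C.

(* The value is only meaningful when the series converges. *)
Definition fundamental_solution (R : realType) (N : nat) (rho alpha : R)
    (n : nat) (h : R) (x : 'rV[R]_N) : R[i] :=
  limn (fundamental_partial_sum rho alpha n h x).

(* The lists a and b contain the pairs (a_i, alpha_i), 1 <= i <= p = size a,
   and (b_j, beta_j), 1 <= j <= q = size b. *)
Definition foxH_integrand (R : realType) (m n : nat) (a b : seq (R[i] * R))
    (z s : R[i]) : R[i] :=
  (\prod_(u <- take m b) Gamma (u.1 + u.2%:C * s)) *
  (\prod_(u <- take n a) Gamma (1 - u.1 - u.2%:C * s)) /
  ((\prod_(u <- drop n a) Gamma (u.1 + u.2%:C * s)) *
   (\prod_(u <- drop m b) Gamma (1 - u.1 - u.2%:C * s))) *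
  cpow z (- s).

(* The vertical line Re s = c has the poles - (b_j + k) / beta_j of the
   Gamma (b_j + beta_j s), j <= m, on its left and the poles
   (1 - a_i + k) / alpha_i of the Gamma (1 - a_i - alpha_i s), i <= n, on its
   right. *)
Definition foxH_separating (R : realType) (m n : nat) (a b : seq (R[i] * R))
    (c : R) : Prop :=
  (forall u, u \in take m b -> forall k : nat,
     complex.Re (- (u.1 + k%:R) / u.2%:C) < c) /\
  (forall u, u \in take n a -> forall k : nat,
     c < complex.Re ((1 - u.1 + k%:R) / u.2%:C)).

(* v is the value at z of the Fox H-function H^{mn}_{pq}, the contour being an
   upward vertical line s = c + i y separating the two families of poles: such
   a line exists, and for each of them the integral converges absolutely, its
   value being v. *)
Definition is_foxH (R : realType) (m n : nat) (a b : seq (R[i] * R))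
    (z v : R[i]) : Prop :=
  [/\ (m <= size b)%N /\ (n <= size a)%N,
      (forall u, u \in a ++ b -> 0 < u.2),
      (exists c, foxH_separating m n a b c) &
      forall c, foxH_separating m n a b c ->
        cintegrable setT (fun y => foxH_integrand m n a b z (c +i* y)) /\
        v = ((pi *+ 2)%:C * 'i)^-1 *
            cintegral setT (fun y => foxH_integrand m n a b z (c +i* y) * 'i)].

(* Main.v *)
Require Import Defs.
From mathcomp Require Import all_boot all_order all_algebra.
From mathcomp Require Import complex ring lra.
From mathcomp Require Import all_classical all_reals all_analysis measurable_realfun.

(** Both sides are evaluated as the same real integral. Put m = n - 1,
    eta = h^(1-alpha), z = |x|^2 / (4 h^alpha), and let Q = wright_poly be the
    polynomial with

      exp (- y) Q(y) = [t^m] exp (- y (1 - t)^alpha) (1 - t)^(alpha-1),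

    whose coefficients come from the expansion (newton_expand) of
    (1 - alpha (w+1)) ... (m - alpha (w+1)) / m! in falling factorials of w.

    The Fox side. The integrand is Gamma (N/2 + s) z^(-s) times
    Gamma (1+s) (1 + alpha s) ... (m + alpha s), since Gamma (1 + alpha s) does
    not vanish for Re s > -1 (Gamma_neq0). The second factor is m! times the
    Mellin transform of exp (- t) Q(t) (mellin_wright_weight), and the inverse
    Mellin transform of Gamma is an exponential (Cahen_Mellin). Parseval's
    formula (mellin_parseval) then gives, for every admissible line,

      H = m! * integral over t > 0 of exp (- t) Q(t) (z/t)^(N/2) exp (- z/t).

    Cahen-Mellin follows from an inversion theorem for Mellin transforms
    (mellin_inversion), proved by damping with exp (- e |y|), which turns the
    inner integral into a Poisson kernel. Absolute convergence on vertical lines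
    needs only |Gamma| = O (1 / (1 + y^2)), from the functional equation.

    The series side. The Taylor coefficients of (1 - z)^g are found by
    integrating the derivative of z^(-m) (1 - z)^g over a circle, which lowers m
    and g together, down to the mean value property (fourier_coef0). Expanding
    the j-th power by the binomial theorem yields the Wright function in closed
    form (wrightE):

      eta * sum over l of q_l eta^l j(j-1)...(j-l+1) (1 - eta)^(j-l),

    q_l being the coefficients of Q. The discrete Gaussian kernel is
    the mean of the heat kernel G_(hu)(x) against u^j exp (- u) / j!, so
    the exponential series sums the integrands to
    eta exp (- eta u) Q(eta u) G_(hu)(x), and t = eta u gives the Fox integral
    (abel_density_fox).

    Summation and integration commute by domination when |1 - eta| < 1, that
    is, when eta < 2 (poisson_series_cvg). For eta = 2 the same holds after
    inserting r^j with r < 1, and Abel's theorem (abel_limit) identifies the sum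
    of the series if it converges. For eta > 2 the series diverges
    (not_summable): the Gaussian kernels decay more slowly than any geometric
    sequence of ratio below 1, whereas the Wright function is (1 - eta)^j times
    a nonzero polynomial in j. *)

Import Order.TTheory GRing.Theory Num.Theory.
Import numFieldNormedType.Exports.
Local Open Scope classical_set_scope.
Local Open Scope ring_scope.

Set Implicit Arguments.
Unset Strict Implicit.
Unset Printing Implicit Defensive.

Notation leb R := (@lebesgue_measure R).
Notation Rpos R := (`]0, +oo[%classic : set R).

(** * Differentiation and continuity of real expressions *)

Lemma derD (R : realType) (f g : R -> R) (x a b : R) :
  is_derive x 1 f a -> is_derive x 1 g b ->
  is_derive x 1 (fun t => f t + g t) (a + b).
Proof. exact: is_deriveD. Qed.

Lemma derN (R : realType) (f : R -> R) (x a : R) :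
  is_derive x 1 f a -> is_derive x 1 (fun t => - f t) (- a).
Proof. exact: is_deriveN. Qed.

Lemma derM (R : realType) (f g : R -> R) (x a b : R) :
  is_derive x 1 f a -> is_derive x 1 g b ->
  is_derive x 1 (fun t => f t * g t) (f x * b + g x * a).
Proof. by move=> fa gb; have := is_deriveM fa gb. Qed.

Lemma derV (R : realType) (f : R -> R) (x a : R) : f x != 0 ->
  is_derive x 1 f a -> is_derive x 1 (fun t => (f t)^-1) (- (f x ^- 2) * a).
Proof. by move=> fx fa; have := is_deriveV fx fa. Qed.

Lemma der_expR (R : realType) (f : R -> R) (x a : R) :
  is_derive x 1 f a -> is_derive x 1 (fun t => expR (f t)) (expR (f x) * a).
Proof. by move=> fa; apply: (@is_derive1_comp _ expR f). Qed.

Lemma der_cos (R : realType) (f : R -> R) (x a : R) :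
  is_derive x 1 f a -> is_derive x 1 (fun t => cos (f t)) (- sin (f x) * a).
Proof. by move=> fa; apply: (@is_derive1_comp _ cos f). Qed.

Lemma der_sin (R : realType) (f : R -> R) (x a : R) :
  is_derive x 1 f a -> is_derive x 1 (fun t => sin (f t)) (cos (f x) * a).
Proof. by move=> fa; apply: (@is_derive1_comp _ sin f). Qed.

Lemma der_atan (R : realType) (f : R -> R) (x a : R) :
  is_derive x 1 f a ->
  is_derive x 1 (fun t => atan (f t)) ((1 + f x ^+ 2)^-1 * a).
Proof. by move=> fa; apply: (@is_derive1_comp _ atan f). Qed.

Lemma der_ln (R : realType) (f : R -> R) (x a : R) : 0 < f x ->
  is_derive x 1 f a -> is_derive x 1 (fun t => ln (f t)) ((f x)^-1 * a).
Proof.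
by move=> fx fa; apply: (@is_derive1_comp _ (@ln R) f _ _ _ (is_derive1_ln fx)).
Qed.

Lemma der_id (R : realType) (x : R) : is_derive x 1 (fun t : R => t) 1.
Proof. exact: is_derive_id. Qed.

Lemma der_cst (R : realType) (x c : R) : is_derive x 1 (fun t : R => c) 0.
Proof. exact: is_derive_cst. Qed.

(** Differentiates along the syntax tree, leaving the derivative as a raw sum;
    the callers reshape it with is_derive_eq. *)
Ltac der := repeat first
  [ exact: der_cst | exact: der_id | assumption
  | apply: derN | apply: der_expR | apply: der_cos | apply: der_sin
  | apply: der_atan
  | apply: derD | apply: derM | apply: derV | apply: der_ln ].

Lemma der_continuous (R : realType) (f : R -> R) (x a : R) :
  is_derive x 1 f a -> {for x, continuous f}.
Proof.
by move=> fa; apply/differentiable_continuous/derivable1_diffP; exact: ex_derive.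
Qed.

Lemma cont_expR (R : realType) (f : R -> R) (x : R) :
  {for x, continuous f} -> {for x, continuous (fun t => expR (f t))}.
Proof. by move=> cf; apply: (continuous_comp cf); exact: continuous_expR. Qed.

Lemma cont_cos (R : realType) (f : R -> R) (x : R) :
  {for x, continuous f} -> {for x, continuous (fun t => cos (f t))}.
Proof. by move=> cf; apply: (continuous_comp cf); exact: continuous_cos. Qed.

Lemma cont_norm (R : realType) (f : R -> R) (x : R) :
  {for x, continuous f} -> {for x, continuous (fun t => `|f t|)}.
Proof. by move=> cf; apply: (continuous_comp cf); exact: norm_continuous. Qed.

Lemma cont_comp (R : realType) (f g : R -> R) (x : R) :
  {for x, continuous f} -> {for f x, continuous g} ->
  {for x, continuous (fun t => g (f t))}.
Proof. by move=> cf cg; apply: (continuous_comp cf). Qed.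

Lemma contD (R : realType) (f g : R -> R) (x : R) :
  {for x, continuous f} -> {for x, continuous g} ->
  {for x, continuous (fun t => f t + g t)}.
Proof. by move=> cf cg; apply: (@cvgD _ R^o). Qed.

Lemma contM (R : realType) (f g : R -> R) (x : R) :
  {for x, continuous f} -> {for x, continuous g} ->
  {for x, continuous (fun t => f t * g t)}.
Proof. by move=> cf cg; apply: cvgM. Qed.

Lemma contN (R : realType) (f : R -> R) (x : R) :
  {for x, continuous f} -> {for x, continuous (fun t => - f t)}.
Proof. by move=> cf; apply: (@cvgN _ R^o). Qed.

Lemma contV (R : realType) (f : R -> R) (x : R) : f x != 0 ->
  {for x, continuous f} -> {for x, continuous (fun t => (f t)^-1)}.
Proof. by move=> fx cf; apply: cvgV. Qed.

(** * Dominated convergence and improper integrals of real functions *)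

Lemma integrable_le (R : realType) (D : set R) (f g : R -> R) :
  measurable D -> measurable_fun D f ->
  (forall x, D x -> `|f x| <= g x) ->
  (leb R).-integrable D (EFin \o g) -> (leb R).-integrable D (EFin \o f).
Proof.
move=> mD mf fg ig; apply: le_integrable ig => //.
  exact/measurable_EFinP.
by move=> x Dx; rewrite /= !lee_fin (le_trans (fg _ Dx))// ler_norm.
Qed.

Lemma Rintegral_dominated (R : realType) (D : set R) (f_ : nat -> R -> R)
    (f g : R -> R) :
  measurable D -> (forall n, measurable_fun D (f_ n)) ->
  (forall x, D x -> f_ n x @[n --> \oo] --> f x) ->
  (leb R).-integrable D (EFin \o g) ->
  (forall n x, D x -> `|f_ n x| <= g x) ->
  (leb R).-integrable D (EFin \o f) /\
  (\int[leb R]_(x in D) f_ n x) @[n --> \oo] --> \int[leb R]_(x in D) f x.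
Proof.
move=> mD mf_ f_f ig f_g.
have mf : measurable_fun D f by exact: measurable_fun_cvg mf_ f_f.
have [|||||intf _ cvf] := @dominated_convergence _ _ _ (leb R) D mD
  (fun n => EFin \o f_ n) (EFin \o f) (EFin \o g).
- by move=> n; apply/measurable_EFinP; exact: mf_.
- by apply/measurable_EFinP.
- by apply: aeW => x Dx; apply: cvg_EFin; [exact: nearW|exact: f_f].
- exact: ig.
- by apply: aeW => x n Dx; rewrite /= lee_fin f_g.
split=> //; apply: fine_cvg => /=.
rewrite fineK//; exact: integrable_fin_num.
Qed.

(** The intervals [exp (-k), exp k] exhaust the positive half-line; with these
   end points powers of t become plain exponentials of k. *)
Lemma exhaust_itv0y (R : realType) (x : R) : 0 < x ->
  \forall k \near \oo, expR (- k%:R) <= x <= expR k%:R.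
Proof.
move=> x0; near=> k; rewrite -{1 2}(lnK x0) !ler_expR.
have : `|ln x| <= k%:R.
  by near: k; exact: nbhs_infty_ger.
by rewrite ler_norml => /andP[-> ->].
Unshelve. all: by end_near. Qed.

Lemma Rintegral_exhaust (R : realType) (f : R -> R) :
  (leb R).-integrable `]0, +oo[ (EFin \o f) ->
  \int[leb R]_(x in `[expR (- k%:R), expR k%:R]) f x @[k --> \oo] -->
  \int[leb R]_(x in `]0, +oo[) f x.
Proof.
move=> intf; have mf : measurable_fun (Rpos R) f.
  by apply/measurable_EFinP; exact: measurable_int intf.
have sub k : (`[expR (- k%:R), expR k%:R]%classic : set R) `<=` Rpos R.
  by move=> x /=; rewrite !in_itv/= andbT => /andP[+ _]; apply: lt_le_trans;
    exact: expR_gt0.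
pose f_ (k : nat) := f \_ (`[expR (- k%:R), expR k%:R]%classic : set R).
have -> : (fun k : nat => \int[leb R]_(x in `[expR (- k%:R), expR k%:R]) f x) =
          (fun k => \int[leb R]_(x in `]0, +oo[) f_ k x).
  apply/funext => k; rewrite -Rintegral_mkcondr.
  by rewrite setIidr.
apply: (@Rintegral_dominated R _ f_ f (fun x => `|f x|) _ _ _ _ _).2 => //.
- move=> k; apply/measurable_restrict => //.
  by rewrite setIidr//; exact: measurable_funS mf.
- move=> x; rewrite /= in_itv/= andbT => x0; apply: cvg_near_cst.
  apply: filterS (exhaust_itv0y x0) => k xk.
  by rewrite /f_ patchE mem_set.
- exact: integrable_norm.
- by move=> k x _; rewrite /f_ patchE; case: ifP => //; rewrite normr0.
Qed.

Lemma FTC_segment (R : realType) (F f : R -> R) (a b : R) : a < b ->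
  (forall x, a <= x <= b -> is_derive x 1 F (f x)) ->
  (forall x, a <= x <= b -> {for x, continuous f}) ->
  (\int[leb R]_(x in `[a, b]) (f x)%:E = (F b - F a)%:E)%E.
Proof.
move=> ab dF cf.
have cF x : a <= x <= b -> {for x, continuous F}.
  by move=> /dF; exact: der_continuous.
rewrite (@continuous_FTC2 _ f F)//.
- apply/(continuous_within_itvP _ ab); split.
  + by move=> x; rewrite in_itv/= => /andP[/ltW ax /ltW xb]; apply: cf; rewrite ax.
  + by apply: cvg_at_right_filter; apply: cf; rewrite lexx ltW.
  + by apply: cvg_at_left_filter; apply: cf; rewrite lexx ltW.
- split.
  + move=> x; rewrite in_itv/= => /andP[/ltW ax /ltW xb].
    by have ? := dF x; apply: (@ex_derive _ _ _ _ _ _ _ (dF x _)); rewrite ax.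
  + by apply: cvg_at_right_filter; apply: cF; rewrite lexx ltW.
  + by apply: cvg_at_left_filter; apply: cF; rewrite lexx ltW.
- move=> x; rewrite in_itv/= => /andP[/ltW ax /ltW xb].
  by rewrite derive1E; apply: (@derive_val _ _ _ _ _ _ _ (dF x _)); rewrite ax.
Qed.

Lemma exp_lt (R : realType) (k : nat) : expR (- k.+1%:R) < expR k.+1%:R :> R.
Proof. by rewrite ltr_expR -subr_gt0 opprK addr_gt0. Qed.

Lemma pos_seg (R : realType) (P : R -> Prop) (a b : R) :
  (forall x, 0 < x -> P x) -> forall x, expR a <= x <= b -> P x.
Proof.
by move=> Px x /andP[ax _]; apply/Px/(lt_le_trans _ ax); exact: expR_gt0.
Qed.

(** The boundary values enter as limits along exp (- k) and exp k, the end points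
    of the exhausting intervals. *)
Lemma FTC_itv0y (R : realType) (F f : R -> R) (l0 l : R) :
  (forall x : R, 0 < x -> is_derive x 1 F (f x)) ->
  (forall x : R, 0 < x -> {for x, continuous f}) ->
  (leb R).-integrable `]0, +oo[ (EFin \o f) ->
  F (expR (- k%:R)) @[k --> \oo] --> l0 ->
  F (expR k%:R) @[k --> \oo] --> l ->
  \int[leb R]_(x in `]0, +oo[) f x = l - l0.
Proof.
move=> dF cf intf Fl0 Fl.
pose v (k : nat) := \int[leb R]_(x in `[expR (- k%:R), expR k%:R]) f x.
have hv : v k @[k --> \oo] --> \int[leb R]_(x in `]0, +oo[) f x.
  exact: Rintegral_exhaust intf.
have vE k : v k.+1 = F (expR k.+1%:R) - F (expR (- k.+1%:R)).
  by rewrite /v /Rintegral (FTC_segment (exp_lt R k) (pos_seg dF) (pos_seg cf)).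
move: v hv vE => v hv vE.
have h2 : v k @[k --> \oo] --> l - l0.
  rewrite -(cvg_shiftS v) /= (funext vE).
  pose w k := F (expR k%:R) - F (expR (- k%:R)).
  have : w k @[k --> \oo] --> l - l0 by apply: (@cvgB _ R^o).
  by rewrite -(cvg_shiftS w).
exact: (@cvg_unique _ (@Rhausdorff R) _ _ _ _ hv h2).
Qed.

Lemma open_cont_measurable (R : realType) (f : R -> R) :
  (forall x : R, 0 < x -> {for x, continuous f}) -> measurable_fun (Rpos R) f.
Proof.
move=> cf; apply: open_continuous_measurable_fun => // x.
by rewrite inE/= in_itv/= andbT; exact: cf.
Qed.

(** Monotone convergence along the exhaustion. *)
Lemma integral_exhaust_ge0 (R : realType) (f : R -> R) :
  (forall x : R, 0 < x -> {for x, continuous f}) ->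
  (forall x : R, 0 < x -> 0 <= f x) ->
  (\int[leb R]_(x in `[expR (- k%:R), expR k%:R]) (f x)%:E @[k --> \oo] -->
   \int[leb R]_(x in `]0%R, +oo[) (f x)%:E)%E.
Proof.
move=> cf f0.
have U : `]0, +oo[%classic =
    \bigcup_k (`[expR (- k%:R), expR k%:R]%classic : set R).
  apply/seteqP; split=> x.
    rewrite /= in_itv/= andbT => x0.
    have [k _ /(_ k (leqnn k)) xk] := exhaust_itv0y x0.
    by exists k => //=; rewrite in_itv.
  move=> [k _] /=; rewrite !in_itv/= andbT => /andP[+ _].
  by apply: lt_le_trans; exact: expR_gt0.
rewrite U; apply: ge0_nondecreasing_set_cvg_integral.
- apply/nondecreasing_seqP => n; rewrite subsetEset => x /=.
  rewrite !in_itv/= => /andP[nx xn]; apply/andP; split.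
    by apply: le_trans nx; rewrite ler_expR lerN2 ler_nat.
  by apply: (le_trans xn); rewrite ler_expR ler_nat.
- by move=> i.
- move=> i; apply/measurable_EFinP.
  apply: measurable_funS (open_cont_measurable cf) => // x /=.
  rewrite !in_itv/= andbT => /andP[+ _].
  by apply: lt_le_trans; exact: expR_gt0.
- move=> i x /=; rewrite in_itv/= => /andP[+ _] => h.
  by rewrite lee_fin f0// (lt_le_trans _ h)// expR_gt0.
Qed.

(** Monotone convergence along the exhausting intervals, on each of which the
    integral is at most 2 M. *)
Lemma integrable_of_primitive (R : realType) (F f : R -> R) (M : R) :
  (forall x : R, 0 < x -> is_derive x 1 F (f x)) ->
  (forall x : R, 0 < x -> {for x, continuous f}) ->
  (forall x : R, 0 < x -> 0 <= f x) ->
  (forall x : R, 0 < x -> `|F x| <= M) ->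
  (leb R).-integrable `]0, +oo[ (EFin \o f).
Proof.
move=> dF cf f0 FM; apply/integrableP; split.
  by apply/measurable_EFinP; exact: open_cont_measurable.
have -> : (\int[leb R]_(x in `]0%R, +oo[) `|(EFin \o f) x| =
    \int[leb R]_(x in `]0%R, +oo[) (f x)%:E)%E.
  apply: eq_integral => x; rewrite inE/= in_itv/= andbT => x0.
  by rewrite ger0_norm// f0.
apply: (@le_lt_trans _ _ (2 * M)%:E); last by rewrite ltry.
have cv := integral_exhaust_ge0 cf f0.
rewrite -(cvg_lim _ cv)//; apply: lime_le; first by apply/cvg_ex; eexists; exact: cv.
exists 1%N => // -[//|k] _ /=.
rewrite (FTC_segment (exp_lt R k) (pos_seg dF) (pos_seg cf)) lee_fin.
rewrite mulr_natl mulr2n lerD//.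
  by rewrite (le_trans (ler_norm _))// FM// expR_gt0.
by rewrite (le_trans (ler_norm _))// normrN FM// expR_gt0.
Qed.

(** * Changes of variables *)

Notation symseg R k := (`[- k%:R, k%:R]%classic : set R).

Lemma normD_ge0 (R : realType) (x : R) : 0 <= `|x| + x.
Proof. by rewrite -lerBlDr sub0r -normrN ler_norm. Qed.

Lemma cont_reflect (R : realType) (f : R -> R) :
  continuous f -> continuous (fun x => f (- x)).
Proof.
move=> cf x; apply: (@cont_comp _ (fun x : R => - x) f); last exact: cf.
by apply: contN; exact: cvg_id.
Qed.

Lemma integrableD_EFin (R : realType) (D : set R) (f g : R -> R) :
  measurable D -> (leb R).-integrable D (EFin \o f) ->
  (leb R).-integrable D (EFin \o g) ->
  (leb R).-integrable D (fun x => (f x + g x)%:E).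
Proof.
move=> mD intf intg.
rewrite (_ : (fun x => _) = (EFin \o f) \+ (EFin \o g))%E//.
exact: integrableD.
Qed.

Lemma integrable_scaled (R : realType) (D : set R) (k : R) (g : R -> R) :
  measurable D -> (leb R).-integrable D (EFin \o g) ->
  (leb R).-integrable D (EFin \o (fun t => k * g t)).
Proof.
move=> mD ig; rewrite (_ : _ \o _ = (fun t => k%:E * (EFin \o g) t)%E)//.
exact: integrableZl.
Qed.

Lemma integrableB_EFin (R : realType) (D : set R) (f g : R -> R) : measurable D ->
  (leb R).-integrable D (EFin \o f) -> (leb R).-integrable D (EFin \o g) ->
  (leb R).-integrable D (EFin \o (fun x => f x - g x)).
Proof.
move=> mD hf hg; rewrite (_ : (fun x => _) = (fun x => f x + (-1) * g x)).
  by apply: integrableD_EFin => //; exact: integrable_scaled.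
by apply/funext => x; rewrite mulN1r.
Qed.

Lemma RintD (R : realType) (D : set R) (f g : R -> R) : measurable D ->
  (leb R).-integrable D (EFin \o f) -> (leb R).-integrable D (EFin \o g) ->
  \int[leb R]_(x in D) (f x + g x) =
  \int[leb R]_(x in D) f x + \int[leb R]_(x in D) g x.
Proof. by move=> mD hf hg; rewrite RintegralD. Qed.

Lemma RintZ (R : realType) (D : set R) (k : R) (f : R -> R) : measurable D ->
  (leb R).-integrable D (EFin \o f) ->
  \int[leb R]_(x in D) (k * f x) = k * \int[leb R]_(x in D) f x.
Proof. by move=> mD h; exact: RintegralZl. Qed.

Lemma exhaustT (R : realType) :
  [set: R] = \bigcup_k (`[- k%:R, k%:R]%classic : set R).
Proof.
apply/seteqP; split=> // x _; have [k _ /(_ k (leqnn k)) xk] :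
    \forall k \near \oo, `|x| <= k%:R by exact: nbhs_infty_ger.
by exists k => //=; rewrite in_itv/= -ler_norml.
Qed.

Lemma integral_exhaustT_ge0 (R : realType) (f : R -> R) :
  continuous f -> (forall x, 0 <= f x) ->
  (\int[leb R]_(x in symseg R k) (f x)%:E @[k --> \oo] -->
   \int[leb R]_x (f x)%:E)%E.
Proof.
move=> cf f0; rewrite exhaustT; apply: ge0_nondecreasing_set_cvg_integral.
- apply/nondecreasing_seqP => n; rewrite subsetEset => x /=.
  rewrite !in_itv/= => /andP[nx xn]; apply/andP; split.
    by apply: le_trans nx; rewrite lerN2 ler_nat.
  by apply: (le_trans xn); rewrite ler_nat.
- by move=> i.
- move=> i; apply/measurable_EFinP; apply: measurable_funTS.
  exact: continuous_measurable_fun.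
- by move=> i x _; rewrite lee_fin.
Qed.

Lemma derive1_expR (R : realType) : derive1 (@expR R) = @expR R.
Proof. apply/funext => x; rewrite derive1E.
exact: (@derive_val _ _ _ _ _ _ _ (is_derive_expR x)). Qed.

Lemma integral_expR_subst (R : realType) (f : R -> R) :
  (forall x : R, 0 < x -> {for x, continuous f}) ->
  (forall x : R, 0 < x -> 0 <= f x) ->
  (\int[leb R]_(x in `]0%R, +oo[) (f x)%:E =
   \int[leb R]_v (f (expR v) * expR v)%:E)%E.
Proof.
move=> cf f0.
have h1 := integral_exhaust_ge0 cf f0.
have h2 : (\int[leb R]_(v in symseg R k) (f (expR v) * expR v)%:E
    @[k --> \oo] --> \int[leb R]_v (f (expR v) * expR v)%:E)%E.
  apply: integral_exhaustT_ge0 => [x|x].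
    apply: contM; last exact: continuous_expR.
    by apply: cont_comp; [exact: continuous_expR|apply/cf; exact: expR_gt0].
  by rewrite mulr_ge0 ?expR_ge0// f0// expR_gt0.
have E : (fun k : nat => \int[leb R]_(x in `[expR (- k%:R), expR k%:R]) (f x)%:E)%E =
    (fun k : nat => \int[leb R]_(v in symseg R k) (f (expR v) * expR v)%:E)%E.
  apply/funext => k.
  rewrite (@integration_by_substitution_increasing R expR f (- k%:R) k%:R).
  - by apply: eq_integral => v _; rewrite !fctE derive1_expR.
  - by rewrite -subr_ge0 opprK addr_ge0.
  - by move=> x y _ _; rewrite ltr_expR.
  - by rewrite derive1_expR => x _; exact: continuous_expR.
  - rewrite derive1_expR; apply/cvg_ex; eexists; apply: cvg_at_right_filter.
    exact: continuous_expR.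
  - rewrite derive1_expR; apply/cvg_ex; eexists; apply: cvg_at_left_filter.
    exact: continuous_expR.
  - split.
    + by move=> x _; exact: derivable_expR.
    + by apply: cvg_at_right_filter; exact: continuous_expR.
    + by apply: cvg_at_left_filter; exact: continuous_expR.
  - apply: continuous_in_subspaceT => x; rewrite inE/= in_itv/= => /andP[h _].
    by apply: cf; apply: lt_le_trans h; exact: expR_gt0.
by rewrite E in h1; exact: (@cvg_unique _ (@ereal_hausdorff R) _ _ _ _ h1 h2).
Qed.

Lemma integral_affine (R : realType) (G : R -> R) (a b : R) : 0 < a ->
  continuous G -> (forall x, 0 <= G x) ->
  (\int[leb R]_v (G v)%:E = \int[leb R]_v (G (a * v + b) * a)%:E)%E.
Proof.
move=> a0 cG G0; pose F (v : R) := a * v + b.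
have dF (x : R) : is_derive x 1 F a.
  have : is_derive x 1 F (a * 1 + x * 0 + 0) by rewrite /F; der.
  by rewrite mulr1 mulr0 !addr0.
have F'E : derive1 F = cst a.
  apply/funext => x; rewrite derive1E; exact: (@derive_val _ _ _ _ _ _ _ (dF x)).
rewrite (@increasing_ge0_integration_by_substitutionT R F G)//.
- by apply: eq_integral => v _; rewrite !fctE F'E.
- by move=> x y xy; rewrite /F ltrD2r ltr_pM2l.
- by rewrite F'E => x; exact: cvg_cst.
- by rewrite F'E; exact: is_cvg_cst.
- by rewrite F'E; exact: is_cvg_cst.
- apply/cvgrNyPle => M.
  apply: filterS (nbhs_ninfty_le (num_real ((M - b) / a))) => y.
  by rewrite ler_pdivlMr// lerBrDr mulrC.
- apply/cvgryPge => M.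
  apply: filterS (nbhs_pinfty_ge (num_real ((M - b) / a))) => y.
  by rewrite ler_pdivrMr// lerBlDr mulrC.
Qed.

Lemma integral_scale (R : realType) (f : R -> R) (c : R) : 0 < c ->
  (forall x : R, 0 < x -> {for x, continuous f}) ->
  (forall x : R, 0 < x -> 0 <= f x) ->
  (\int[leb R]_(x in `]0%R, +oo[) (f x)%:E =
   \int[leb R]_(x in `]0%R, +oo[) (c * f (c * x))%:E)%E.
Proof.
move=> c0 cf f0.
rewrite integral_expR_subst// [RHS]integral_expR_subst; last 2 first.
- move=> x x0; apply: contM; first exact: cvg_cst.
  apply: (@cont_comp _ ( *%R c) f); last by apply: cf; rewrite mulr_gt0.
  by apply: contM; [exact: cvg_cst|exact: cvg_id].
- by move=> x x0; rewrite mulr_ge0 ?(ltW c0)// f0// mulr_gt0.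
rewrite (@integral_affine _ (fun v => f (expR v) * expR v) 1 (ln c))//.
- apply: eq_integral => v _; congr EFin.
  by rewrite mul1r mulr1 expRD lnK ?posrE// [expR v * c]mulrC; ring.
- move=> x; apply: contM; last exact: continuous_expR.
  by apply: cont_comp; [exact: continuous_expR|apply/cf; exact: expR_gt0].
- by move=> x; rewrite mulr_ge0 ?expR_ge0// f0// expR_gt0.
Qed.

Lemma integral_reflect (R : realType) (f : R -> R) :
  continuous f -> (forall x, 0 <= f x) ->
  (\int[leb R]_x (f x)%:E = \int[leb R]_x (f (- x))%:E)%E.
Proof.
move=> cf f0; have h1 := integral_exhaustT_ge0 cf f0.
have cfN : continuous (fun x => f (- x)).
  exact: cont_reflect.
have h2 := integral_exhaustT_ge0 cfN (fun x => f0 (- x)).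
have E : (fun k : nat => \int[leb R]_(x in symseg R k) (f x)%:E)%E =
    (fun k : nat => \int[leb R]_(x in symseg R k) (f (- x))%:E)%E.
  apply/funext => k.
  have := @integration_by_substitution_oppr R f (- k%:R) k%:R.
  rewrite opprK => -> //.
  - by rewrite -subr_ge0 opprK addr_ge0.
  - exact: continuous_subspaceT.
by rewrite E in h1; exact: (@cvg_unique _ (@ereal_hausdorff R) _ _ _ _ h1 h2).
Qed.

(** A linear change of variables that holds for nonnegative continuous
    functions extends to integrable ones: apply it to |f| and |f| + f. *)
Lemma Rintegral_signed (R : realType) (D D' : set R) (f : R -> R)
    (L : (R -> R) -> R -> R) : measurable D -> measurable D' ->
  (forall g x, D' x -> L (fun t => `|g t|) x = `|L g x|) ->
  (forall g1 g2 x, L (fun t => g1 t + g2 t) x = L g1 x + L g2 x) ->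
  measurable_fun D' (L f) ->
  (\int[leb R]_(x in D) (`|f x|)%:E =
   \int[leb R]_(x in D') (L (fun t => `|f t|) x)%:E)%E ->
  (\int[leb R]_(x in D) (`|f x| + f x)%:E =
   \int[leb R]_(x in D') (L (fun t => `|f t| + f t) x)%:E)%E ->
  (leb R).-integrable D (EFin \o f) ->
  (leb R).-integrable D' (EFin \o L f) /\
  \int[leb R]_(x in D) f x = \int[leb R]_(x in D') L f x.
Proof.
move=> mD mD' Ln LD mL e1 e2 intf.
have intL : (leb R).-integrable D' (EFin \o L f).
  apply/integrableP; split; first exact/measurable_EFinP.
  have /integrableP[_] := intf.
  have -> : (\int[leb R]_(x in D) `|(EFin \o f) x| =
    \int[leb R]_(x in D') `|(EFin \o L f) x|)%E.
    rewrite /= e1; apply: eq_integral => x; rewrite inE => Dx.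
    by rewrite Ln.
  by [].
split=> //.
have e1' : \int[leb R]_(x in D) `|f x| = \int[leb R]_(x in D') `|L f x|.
  rewrite /Rintegral e1; congr fine; apply: eq_integral => x.
  by rewrite inE => Dx; rewrite Ln.
have e2' : \int[leb R]_(x in D) (`|f x| + f x) =
    \int[leb R]_(x in D') (`|L f x| + L f x).
  rewrite /Rintegral e2; congr fine; apply: eq_integral => x.
  by rewrite inE => Dx; rewrite LD Ln.
rewrite RintegralD// in e2'; last exact: integrable_norm.
rewrite RintegralD// in e2'; last exact: integrable_norm.
by rewrite e1' in e2'; exact: addrI e2'.
Qed.

Lemma Rintegral_scale (R : realType) (f : R -> R) (c : R) : 0 < c ->
  (forall x : R, 0 < x -> {for x, continuous f}) ->
  (leb R).-integrable `]0, +oo[ (EFin \o f) ->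
  (leb R).-integrable `]0, +oo[ (fun x => (c * f (c * x))%:E) /\
  \int[leb R]_(x in `]0, +oo[) f x = \int[leb R]_(x in `]0, +oo[) (c * f (c * x)).
Proof.
move=> c0 cf intf.
apply: (@Rintegral_signed R (Rpos R) (Rpos R) f (fun g x => c * g (c * x))) => //.
- by move=> g x _; rewrite normrM (gtr0_norm c0).
- by move=> g1 g2 x; rewrite mulrDr.
- apply: open_cont_measurable => x x0; apply: contM; first exact: cvg_cst.
  apply: (@cont_comp _ ( *%R c) f); last by apply: cf; rewrite mulr_gt0.
  by apply: contM; [exact: cvg_cst|exact: cvg_id].
- apply: (integral_scale c0) => // x x0; exact/cont_norm/cf.
- apply: (integral_scale c0) => x x0.
    by apply: contD; [exact/cont_norm/cf|exact: cf].
  exact: normD_ge0.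
Qed.

Lemma Rintegral_reflect (R : realType) (f : R -> R) :
  continuous f -> (leb R).-integrable setT (EFin \o f) ->
  \int[leb R]_x f x = \int[leb R]_x f (- x).
Proof.
move=> cf intf.
apply: (@Rintegral_signed R setT setT f (fun g x => g (- x)) _ _ _ _ _ _ _ _).2 => //.
- apply: continuous_measurable_fun; exact: cont_reflect.
- by apply: (@integral_reflect _ (fun x => `|f x|)) => // x; exact/cont_norm/cf.
- apply: (@integral_reflect _ (fun x => `|f x| + f x)) => x; last exact: normD_ge0.
  exact: (contD (cont_norm (cf x)) (cf x)).
Qed.

Lemma Rintegral_odd (R : realType) (f : R -> R) :
  continuous f -> (leb R).-integrable setT (EFin \o f) ->
  (forall x, f (- x) = - f x) -> \int[leb R]_x f x = 0.
Proof.
move=> cf intf oddf; have := Rintegral_reflect cf intf.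
under [RHS]eq_Rintegral do rewrite oddf -mulN1r.
rewrite RintegralZl// mulN1r => /eqP.
by rewrite -subr_eq0 opprK -mulr2n mulrn_eq0/= => /eqP.
Qed.

Lemma Rintegral_even (R : realType) (f : R -> R) :
  continuous f -> (leb R).-integrable setT (EFin \o f) ->
  (forall x, f (- x) = f x) ->
  \int[leb R]_x f x = 2 * \int[leb R]_(x in `]0, +oo[) f x.
Proof.
move=> cf intf evenf.
have intS (g : R -> R) : (leb R).-integrable setT (EFin \o g) ->
  (leb R).-integrable `]0, +oo[ (EFin \o g) by apply: integrableS.
have key (g : R -> R) : continuous g -> (forall x, 0 <= g x) ->
    (forall x, g (- x) = g x) -> (leb R).-integrable setT (EFin \o g) ->
    \int[leb R]_x g x = 2 * \int[leb R]_(x in `]0, +oo[) g x.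
  move=> cg g0 eg intg; rewrite /Rintegral ge0_symfun_integralT//; last first.
    by move=> x; rewrite /= eg.
  rewrite -set_itvcy -integral_itv_obnd_cbnd.
    rewrite fineM//; apply: (@integrable_fin_num _ _ _ (leb R) (Rpos R)) => //.
    exact: intS.
  by apply/measurable_EFinP; apply: measurable_funTS; exact: continuous_measurable_fun.
have intn := integrable_norm intf.
have e1 := key (fun x => `|f x|) (fun x => cont_norm (cf x)) (fun x => normr_ge0 _)
  (fun x => congr1 Num.norm (evenf x)) intn.
have := key (fun x => `|f x| + f x)
  (fun x => contD (cont_norm (cf x)) (cf x)) (fun x => normD_ge0 (f x)).
rewrite RintegralD// RintegralD//; [|exact: intS|exact: intS].
rewrite mulrDr e1 => h; apply/addrI/h; first by move=> x; rewrite evenf.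
exact: integrableD_EFin.
Qed.

(** * Fubini's theorem and integrability of powers times exponentials *)

Lemma integrable_measurable (R : realType) (D : set R) (f : R -> R) :
  (leb R).-integrable D (EFin \o f) -> measurable_fun D f.
Proof. by move=> h; apply/measurable_EFinP; exact: measurable_int h. Qed.

Lemma integrable_even_ge0 (R : realType) (g : R -> R) :
  continuous g -> (forall x, 0 <= g x) -> (forall x, g (- x) = g x) ->
  (leb R).-integrable `]0, +oo[ (EFin \o g) ->
  (leb R).-integrable setT (EFin \o g).
Proof.
move=> cg g0 eg /integrableP[_ ig]; apply/integrableP; split.
  by apply/measurable_EFinP; exact: continuous_measurable_fun.
have -> : (\int[leb R]_x `|(EFin \o g) x| = \int[leb R]_x (g x)%:E)%E.
  by apply: eq_integral => x _; rewrite /= ger0_norm.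
rewrite ge0_symfun_integralT//; last by move=> x; rewrite /= eg.
rewrite -set_itvcy -integral_itv_obnd_cbnd; last first.
  by apply/measurable_EFinP; apply: measurable_funTS; exact: continuous_measurable_fun.
apply: lte_mul_pinfty => //.
apply: le_lt_trans ig; rewrite le_eqVlt; apply/orP; left; apply/eqP.
by apply: eq_integral => x _; rewrite /= ger0_norm.
Qed.

Lemma integrable_prod_bound (R : realType) (D1 D2 : set R) (a b : R -> R) :
  measurable D1 -> measurable D2 ->
  (leb R).-integrable D1 (EFin \o a) -> (leb R).-integrable D2 (EFin \o b) ->
  (leb R \x leb R)%E.-integrable setT
    (fun z : R * R => ((a \_ D1) z.1 * (b \_ D2) z.2)%:E).
Proof.
move=> mD1 mD2 ia ib.
have iA : (leb R).-integrable setT (EFin \o (a \_ D1)).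
  by rewrite -restrict_EFin; exact: (@integrable_mkcond _ _ R (leb R) D1 (EFin \o a) mD1).1 ia.
have iB : (leb R).-integrable setT (EFin \o (b \_ D2)).
  by rewrite -restrict_EFin; exact: (@integrable_mkcond _ _ R (leb R) D2 (EFin \o b) mD2).1 ib.
move: (a \_ D1) (b \_ D2) iA iB => A B iA iB.
have mA : measurable_fun setT A by exact: integrable_measurable iA.
have mB : measurable_fun setT B by exact: integrable_measurable iB.
apply/integrable12ltyP.
  apply/measurable_EFinP; apply: measurable_funM.
    by apply: measurableT_comp => //; exact: measurable_fst.
  by apply: measurableT_comp => //; exact: measurable_snd.
have /= e x : (\int[leb R]_y `|((A x * B y)%:E)| =
    `|A x|%:E * \int[leb R]_y `|(B y)%:E|)%E.
  rewrite -ge0_integralZl//.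
    by apply: eq_integral => y _; rewrite EFinM abseM.
  by apply/measurable_EFinP; apply: measurableT_comp.
under eq_integral do rewrite e.
rewrite ge0_integralZr//.
- apply: lte_mul_pinfty.
  + exact: integral_ge0.
  + apply/fin_numP; split; last first.
      by have /integrableP[_] := iA; rewrite lt_neqAle => /andP[].
    by rewrite -ltNye (lt_le_trans _ (integral_ge0 _ _)).
  + by have /integrableP[_] := iB.
- by apply/measurable_EFinP; apply: measurableT_comp.
- exact: integral_ge0.
Qed.

(** A bound by a product a x * b y gives absolute integrability on D1 x D2. Both
    iterated integrals are those of the extension of f by zero to the plane. *)
Lemma Fubini_real (R : realType) (D1 D2 : set R) (f : R * R -> R) (a b : R -> R) :
  measurable D1 -> measurable D2 -> measurable_fun setT f ->
  (leb R).-integrable D1 (EFin \o a) -> (leb R).-integrable D2 (EFin \o b) ->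
  (forall x y, D1 x -> D2 y -> `|f (x, y)| <= a x * b y) ->
  (leb R).-integrable D1 (fun x => (\int[leb R]_(y in D2) f (x, y))%:E) /\
      \int[leb R]_(x in D1) (\int[leb R]_(y in D2) f (x, y)) =
      \int[leb R]_(y in D2) (\int[leb R]_(x in D1) f (x, y)).
Proof.
move=> mD1 mD2 mf ia ib fab.
pose g z := f z * (\1_D1 z.1 * \1_D2 z.2).
have gE1 x y : D1 x -> D2 y -> g (x, y) = f (x, y).
  by move=> Dx Dy; rewrite /g !indicE !mem_set// !mulr1.
have gE2 x y : ~ D1 x -> g (x, y) = 0.
  by move=> Dx; rewrite /g !indicE memNset// mul0r mulr0.
have gE3 x y : ~ D2 y -> g (x, y) = 0.
  by move=> Dx; rewrite /g !indicE [y \in _]memNset// !mulr0.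
have mg : measurable_fun setT g.
  apply: measurable_funM => //; apply: measurable_funM.
    by apply: measurableT_comp; [exact: measurable_indic|exact: measurable_fst].
  by apply: measurableT_comp; [exact: measurable_indic|exact: measurable_snd].
have ig : (leb R \x leb R)%E.-integrable setT (EFin \o g).
  apply: le_integrable (integrable_prod_bound mD1 mD2 ia ib) => //.
    exact/measurable_EFinP.
  move=> [x y] _ /=; rewrite lee_fin.
  have [Dx|Dx] := pselect (D1 x); last by rewrite gE2// normr0.
  have [Dy|Dy] := pselect (D2 y); last by rewrite gE3// normr0.
  by rewrite gE1// !patchE !mem_set// (le_trans (fab _ _ Dx Dy))// ler_norm.
have fx x : D1 x -> (leb R).-integrable D2 (fun y => (f (x, y))%:E).
  move=> Dx; apply: (@integrable_le _ _ (fun y => f (x, y)) (fun y => a x * b y)) => //.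
  - apply: measurable_funTS; exact: measurableT_comp.
  - by move=> y; exact: fab.
  - exact: integrable_scaled.
have fy y : D2 y -> (leb R).-integrable D1 (fun x => (f (x, y))%:E).
  move=> Dy; apply: (@integrable_le _ _ (fun x => f (x, y)) (fun x => b y * a x)) => //.
  - apply: measurable_funTS; exact: measurableT_comp.
  - by move=> x Dx; rewrite mulrC; exact: fab.
  - exact: integrable_scaled.
have FE : (fun x => \int[leb R]_y (g (x, y))%:E)%E =
    (fun x => (\int[leb R]_(y in D2) f (x, y))%:E) \_ D1.
  apply/funext => x; rewrite patchE; case: ifPn => Dx.
    rewrite inE in Dx; rewrite /Rintegral fineK; last first.
      by apply: integrable_fin_num => //; exact: fx.
    rewrite [RHS]integral_mkcond; apply: eq_integral => y _.
    rewrite patchE; case: ifPn => Dy; rewrite ?inE ?notin_setE in Dy.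
      by rewrite gE1.
    by rewrite gE3.
  rewrite notin_setE in Dx; rewrite integral0_eq// => y _.
  by rewrite gE2.
have GE : (fun y => \int[leb R]_x (g (x, y))%:E)%E =
    (fun y => (\int[leb R]_(x in D1) f (x, y))%:E) \_ D2.
  apply/funext => y; rewrite patchE; case: ifPn => Dy.
    rewrite inE in Dy; rewrite /Rintegral fineK; last first.
      by apply: integrable_fin_num => //; exact: fy.
    rewrite [RHS]integral_mkcond; apply: eq_integral => x _.
    rewrite patchE; case: ifPn => Dx; rewrite ?inE ?notin_setE in Dx.
      by rewrite gE1.
    by rewrite gE2.
  rewrite notin_setE in Dy; rewrite integral0_eq// => x _.
  by rewrite gE3.
split.
- apply: (@integrable_mkcond _ _ R (leb R) D1 _ mD1).2; rewrite -FE.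
  exact: (@integrable_fubini_F _ _ _ _ _ _ _ _ ig).
- rewrite {1}/Rintegral [X in fine X]integral_mkcond -FE.
  rewrite [RHS]/Rintegral [X in _ = fine X]integral_mkcond -GE.
  by rewrite (@Fubini _ _ _ _ _ _ _ _ ig).
Qed.

Lemma expR_ln (R : realType) (t : R) : 0 < t -> expR (ln t) = t.
Proof. by move=> t0; rewrite lnK. Qed.

Lemma ln_le_linear (R : realType) (a l : R) : 0 < a -> 0 < l ->
  exists C, forall t, 0 < t -> a * ln t <= C + l * t.
Proof.
move=> a0 l0; exists (- (a * ln (l / a))) => t t0.
have k0 : 0 < l / a by rewrite divr_gt0.
have := ltW (ln_sublinear (mulr_gt0 k0 t0)).
rewrite (lnM (k0 : l / a \is Num.pos) (t0 : t \is Num.pos)) -(ler_pM2l a0) mulrDr.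
have -> : a * (l / a * t) = l * t by field; rewrite gt_eqF.
lra.
Qed.

Lemma ln_le_lin2 (R : realType) (a l b : R) : 0 < l -> 0 < b ->
  exists C, forall t, 0 < t -> a * ln t <= C + l * t + b / t.
Proof.
move=> l0 b0; have [a0|a0|<-] := ltgtP 0 a.
- have [C hC] := ln_le_linear a0 l0; exists C => t t0.
  by rewrite (le_trans (hC t t0))// lerDl divr_ge0 ?ltW.
- have na : 0 < - a by rewrite oppr_gt0.
  have [C hC] := ln_le_linear na b0; exists C => t t0.
  have := hC t^-1; rewrite invr_gt0 => /(_ t0); rewrite lnV ?posrE// mulrNN.
  by move/le_trans; apply; rewrite -addrA lerD2l lerDr mulr_ge0 ?ltW.
- exists 0 => t t0; rewrite mul0r add0r addr_ge0//.
  + by rewrite mulr_ge0 ?ltW.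
  + by rewrite divr_ge0 ?ltW.
Qed.

Lemma cont_lin_ln (R : realType) (a l t : R) : 0 < t ->
  {for t, continuous (fun t => expR (a * ln t - l * t))}.
Proof.
move=> t0; apply: cont_expR; apply: contD.
  by apply: contM; [exact: cvg_cst|exact: continuous_ln].
by apply: contN; apply: contM; [exact: cvg_cst|exact: cvg_id].
Qed.

(** The primitive - 1 / (1 + t^s) of s t^(s-1) / (1 + t^s)^2 is bounded, and that
   function dominates t^(s-1) exp (- l t) both at 0 and at infinity. *)
Lemma integrable_pow_exp (R : realType) (s l : R) : 0 < s -> 0 < l ->
  (leb R).-integrable `]0, +oo[ (fun t => (expR ((s - 1) * ln t - l * t))%:E).
Proof.
move=> s0 l0.
pose X (t : R) := expR (s * ln t).
have X0 t : 0 < X t by exact: expR_gt0.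
have X1 t : 1 + X t != 0 by rewrite gt_eqF// addr_gt0.
pose F t := - (1 + X t)^-1.
pose f t := s * X t / (t * (1 + X t) ^+ 2).
have cX (t : R) : 0 < t -> {for t, continuous X}.
  move=> t0; apply: cont_expR; apply: contM; first exact: cvg_cst.
  exact: continuous_ln.
have if0 : (leb R).-integrable `]0, +oo[ (EFin \o f).
  apply: (@integrable_of_primitive R F f 1).
  - move=> t t0; rewrite /F /X.
    have : is_derive t 1 F (- (- (1 + X t) ^- 2 * (0 + X t * (s * (t^-1 * 1) + ln t * 0)))).
      by rewrite /F /X; der => //; exact: X1.
    move/is_derive_eq; apply; rewrite /f; field.
    by rewrite X1 gt_eqF.
  - move=> t t0; apply: contM; first by apply: contM; [exact: cvg_cst|exact: cX].
    apply: contV; first by rewrite mulf_neq0 ?expf_neq0// gt_eqF.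
    apply: contM; first exact: cvg_id.
    rewrite (_ : (fun t => _ ^+ 2) = (fun t => (1 + X t) * (1 + X t))); last first.
      by apply/funext => u; rewrite expr2.
    by apply: contM; (apply: contD; [exact: cvg_cst|exact: cX]).
  - move=> t t0; rewrite divr_ge0// mulr_ge0 ?(ltW s0) ?(ltW (X0 _))// ?(ltW t0)//.
    by rewrite exprn_ge0// addr_ge0// ltW.
  - move=> t t0; rewrite normrN ger0_norm ?invr_ge0 ?addr_ge0 ?(ltW (X0 _))//.
    by rewrite invf_le1 ?addr_gt0// lerDl ltW.
have s2 : 0 < s * 2 by rewrite mulr_gt0.
have [C hC] := ln_le_linear s2 l0.
have K0 : 0 <= (2 + 2 * expR C) / s by rewrite divr_ge0 ?(ltW s0)// addr_ge0// mulr_ge0// expR_ge0.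
apply: (@integrable_le _ _ _ (fun t => (2 + 2 * expR C) / s * f t)) => //.
- by apply: open_cont_measurable => t t0; exact: cont_lin_ln.
- move=> t /=; rewrite in_itv/= andbT => t0.
  rewrite ger0_norm ?expR_ge0//.
  have -> : expR ((s - 1) * ln t - l * t) = X t / t * expR (- (l * t)).
    by rewrite mulrBl mul1r expRB expRB expR_ln// expRN.
  have -> : (2 + 2 * expR C) / s * f t =
     X t / t * ((2 + 2 * expR C) / (1 + X t) ^+ 2).
    by rewrite /f; field; rewrite X1 !gt_eqF.
  rewrite ler_pM2l ?divr_gt0// ler_pdivlMr ?exprn_gt0 ?addr_gt0//.
  have e1 : expR (- (l * t)) <= 1 by rewrite expR_le1 oppr_le0 mulr_ge0 ?ltW.
  have e2 : expR (- (l * t)) * X t ^+ 2 <= expR C.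
    rewrite /X -expRM_natr -expRD ler_expR -lerBrDl opprK.
    by rewrite mulrAC; exact: hC.
  have e3 : (1 + X t) ^+ 2 <= 2 + 2 * X t ^+ 2.
    rewrite -subr_ge0 (_ : _ - _ = (1 - X t) ^+ 2) ?sqr_ge0//; ring.
  rewrite (le_trans (ler_wpM2l (expR_ge0 _) e3))// mulrDr lerD//.
    by rewrite mulrC ler_piMr.
  by rewrite mulrCA ler_pM2l.
- exact: integrable_scaled.
Qed.

Lemma integrable_exp (R : realType) (l : R) : 0 < l ->
  (leb R).-integrable `]0, +oo[ (fun t => (expR (- (l * t)))%:E).
Proof.
move=> l0; have h := @integrable_pow_exp R 1 l ltr01 l0.
rewrite (_ : (fun t => _) = (fun t : R => (expR ((1 - 1) * ln t - l * t))%:E))//.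
by apply/funext => t; rewrite subrr mul0r add0r.
Qed.

Lemma integrable_pow_exp_inv (R : realType) (a l b : R) : 0 < l -> 0 < b ->
  (leb R).-integrable `]0, +oo[
    (fun t => (expR (a * ln t - l * t - b / t))%:E).
Proof.
move=> l0 b0; have l20 : 0 < l / 2 by rewrite divr_gt0.
have [C hC] := ln_le_lin2 a l20 b0.
apply: (@integrable_le _ _ _ (fun t => expR C * expR (- (l / 2 * t)))) => //.
- apply: open_cont_measurable => t t0; apply: cont_expR; apply: contD.
    apply: contD; first by apply: contM; [exact: cvg_cst|exact: continuous_ln].
    by apply: contN; apply: contM; [exact: cvg_cst|exact: cvg_id].
  apply: contN; apply: contM; first exact: cvg_cst.
  by apply: contV; [rewrite gt_eqF|exact: cvg_id].
- move=> t /=; rewrite in_itv/= andbT => t0; rewrite ger0_norm ?expR_ge0//.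
  rewrite -expRD ler_expR; have := hC t t0; lra.
- by apply: integrable_scaled => //; exact: integrable_exp.
Qed.

(** * The Poisson kernel *)

Lemma cvg0_of_exp_bound (R : realType) (u : nat -> R) (K c : R) : 0 < c ->
  (forall n, `|u n| <= K * expR (- (c * n%:R))) -> u n @[n --> \oo] --> (0 : R).
Proof.
move=> c0 uK; apply/norm_cvg0P.
have h : (K * expR (- c) ^+ n) @[n --> \oo] --> (0 : R).
  rewrite -(mulr0 K); apply: cvgM; first exact: cvg_cst.
  by apply: cvg_expr; rewrite ger0_norm ?expR_ge0// expR_lt1 oppr_lt0.
apply: (squeeze_cvgr _ (cvg_cst (0 : R)) h); apply: nearW => n.
by rewrite normr_ge0/= -expRM_natr mulNr.
Qed.

Lemma cont_linear (R : realType) (k x : R) : {for x, continuous (fun y => k * y)}.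
Proof. by apply: contM; [exact: cvg_cst|exact: cvg_id]. Qed.

Lemma le_expRn (R : realType) (n : nat) : n%:R <= expR n%:R :> R.
Proof. by apply: le_trans (expR_ge1Dx _); rewrite lerDr. Qed.

Lemma poisson_half (R : realType) (e k : R) : 0 < e ->
  \int[leb R]_(y in `]0, +oo[) (expR (- (e * y)) * cos (k * y)) = e / (e ^+ 2 + k ^+ 2).
Proof.
move=> e0.
have d0 : e ^+ 2 + k ^+ 2 != 0 by rewrite gt_eqF// ltr_wpDr ?sqr_ge0// exprn_gt0.
pose F (y : R) := expR (- (e * y)) * (k * sin (k * y) - e * cos (k * y))
  * (e ^+ 2 + k ^+ 2)^-1.
pose f (y : R) := expR (- (e * y)) * cos (k * y).
have dF (y : R) : is_derive y 1 F (f y).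
  have : is_derive y 1 F
    (expR (- (e * y)) * (k * sin (k * y) - e * cos (k * y)) * 0 +
     (e ^+ 2 + k ^+ 2)^-1 *
     (expR (- (e * y)) * ((k * (cos (k * y) * (k * 1 + y * 0)) + sin (k * y) * 0)
        + - (e * (- sin (k * y) * (k * 1 + y * 0)) + cos (k * y) * 0)) +
      (k * sin (k * y) - e * cos (k * y)) * (expR (- (e * y)) * - (e * 1 + y * 0)))).
    by rewrite /F; der.
  by move/is_derive_eq; apply; rewrite /f; field.
have -> : e / (e ^+ 2 + k ^+ 2) = 0 - F 0.
  by rewrite /F !mulr0 oppr0 expR0 sin0 cos0; ring.
apply: (@FTC_itv0y R F f).
- move=> y _; apply: contM; first by apply/cont_expR/contN; exact: cont_linear.
  by apply: cont_cos; exact: cont_linear.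
- apply: (@integrable_le _ _ f
    (fun y => expR (- (e * y)))) => //; last exact: integrable_exp.
    apply: measurable_funTS; apply: continuous_measurable_fun => y.
    apply: (@contM _ (fun y : R => expR (- (e * y)))); first by apply/cont_expR/contN; exact: cont_linear.
    by apply: cont_cos; exact: cont_linear.
  move=> y _; rewrite normrM ger0_norm ?expR_ge0// ler_piMr ?expR_ge0//.
  exact: cos_max.
- apply: (@cvg_comp _ _ _ (fun n : nat => expR (- n%:R : R)) F); first exact: cvgn_expR.
  exact: der_continuous (dF 0).
- apply: (@cvg0_of_exp_bound _ _ ((`|k| + `|e|) * `|(e ^+ 2 + k ^+ 2)^-1|) e) => //.
  move=> n; rewrite [leRHS]mulrC mulrA /F normrM ler_wpM2r// normrM.
  rewrite ler_pM//.
    rewrite ger0_norm ?expR_ge0// ler_expR lerN2 ler_pM2l//; exact: le_expRn.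
  rewrite (le_trans (ler_normB _ _))// !normrM lerD// ler_piMr//.
  + exact: sin_max.
  + exact: cos_max.
Qed.

Lemma cont_exp_norm (R : realType) (e y : R) :
  {for y, continuous (fun y : R => expR (- (e * `|y|)))}.
Proof.
apply/cont_expR/contN; apply: contM; first exact: cvg_cst.
by apply: cont_norm; exact: cvg_id.
Qed.

Lemma integrable_exp_norm (R : realType) (e : R) : 0 < e ->
  (leb R).-integrable setT (fun y : R => (expR (- (e * `|y|)))%:E).
Proof.
move=> e0; apply: (@integrable_even_ge0 _ (fun y => expR (- (e * `|y|)))).
- exact: cont_exp_norm.
- by move=> x; exact: expR_ge0.
- by move=> x; rewrite normrN.
- apply: eq_integrable (integrable_exp e0) => //.
  move=> x; rewrite inE/= in_itv/= andbT => x0.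
  by rewrite /= gtr0_norm.
Qed.

Lemma integrable_exp_norm_trig (R : realType) (e k : R) (c : R -> R) : 0 < e ->
  continuous c -> (forall x, `|c x| <= 1) ->
  continuous (fun y : R => expR (- (e * `|y|)) * c (y * k)) /\
  (leb R).-integrable setT (fun y : R => (expR (- (e * `|y|)) * c (y * k))%:E).
Proof.
move=> e0 cc c1.
have cf : continuous (fun y : R => expR (- (e * `|y|)) * c (y * k)).
  move=> y; apply: (@contM _ (fun y : R => expR (- (e * `|y|)))); first exact: cont_exp_norm.
  apply: (@cont_comp _ (fun y : R => y * k) c); last exact: cc.
  by apply: contM; [exact: cvg_id|exact: cvg_cst].
split=> //; apply: (@integrable_le _ _ (fun y => expR (- (e * `|y|)) * c (y * k))
   (fun y => expR (- (e * `|y|)))) => //; last exact: integrable_exp_norm.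
  exact: continuous_measurable_fun.
by move=> y _; rewrite normrM ger0_norm ?expR_ge0// ler_piMr ?expR_ge0.
Qed.

Lemma poisson_cos (R : realType) (e k : R) : 0 < e ->
  \int[leb R]_y (expR (- (e * `|y|)) * cos (y * k)) = 2 * (e / (e ^+ 2 + k ^+ 2)).
Proof.
move=> e0.
have [cf intf] := integrable_exp_norm_trig k e0 (@continuous_cos R) (@cos_max R).
rewrite Rintegral_even//; last by move=> y; rewrite normrN mulNr cosN.
rewrite -poisson_half//; congr (_ * _); apply: eq_Rintegral => y.
by rewrite inE/= in_itv/= andbT => y0; rewrite gtr0_norm// [y * k]mulrC.
Qed.

Lemma poisson_sin (R : realType) (e k : R) : 0 < e ->
  \int[leb R]_y (expR (- (e * `|y|)) * sin (y * k)) = 0.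
Proof.
move=> e0.
have [cf intf] := integrable_exp_norm_trig k e0 (@continuous_sin R) (@sin_max R).
by rewrite Rintegral_odd// => y; rewrite normrN mulNr sinN mulrN.
Qed.

Lemma integrable_oneDsqrV (R : realType) :
  (leb R).-integrable setT (fun y : R => ((1 + y ^+ 2)^-1)%:E).
Proof.
apply: (@integrable_even_ge0 _ (fun y : R => (1 + y ^+ 2)^-1)).
- exact: continuous_oneDsqrV.
- by move=> x; rewrite invr_ge0 addr_ge0// sqr_ge0.
- by move=> x; rewrite sqrrN.
- apply/integrableP; split.
    apply/measurable_EFinP; apply: measurable_funTS.
    by apply: continuous_measurable_fun; exact: continuous_oneDsqrV.
  apply: (@le_lt_trans _ _ (pi / 2 : R)%:E); last exact: ltry.
  rewrite -integral0y_oneDsqr -integral_itv_obnd_cbnd; last first.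
    apply/measurable_EFinP; apply: measurable_funTS.
    by apply: continuous_measurable_fun; exact: continuous_oneDsqrV.
  rewrite le_eqVlt; apply/orP; left; apply/eqP; apply: eq_integral => x _ /=.
  by rewrite ger0_norm// invr_ge0 addr_ge0// sqr_ge0.
Qed.

Lemma Rintegral_oneDsqrV (R : realType) : \int[leb R]_y (1 + y ^+ 2)^-1 = pi :> R.
Proof.
rewrite Rintegral_even//.
- rewrite /Rintegral integral_itv_obnd_cbnd; last first.
    apply/measurable_EFinP; apply: measurable_funTS.
    by apply: continuous_measurable_fun; exact: continuous_oneDsqrV.
  by have := @integral0y_oneDsqr R; rewrite /oneDsqr => -> /=; field.
- exact: continuous_oneDsqrV.
- exact: integrable_oneDsqrV.
- by move=> x; rewrite sqrrN.
Qed.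

(** * Fourier inversion on the multiplicative group of positive reals *)

(** The damping factor exp (- e |y|) makes the double integral absolutely
    convergent. As it vanishes nowhere, dividing by it also yields the
    measurability of the undamped transform. *)
Lemma trig_transform_Fubini (R : realType) (q c : R -> R) (w : R) :
  measurable_fun setT q -> (leb R).-integrable `]0, +oo[ (EFin \o q) ->
  continuous c -> (forall x, `|c x| <= 1) ->
  measurable_fun setT (fun y : R => \int[leb R]_(t in `]0, +oo[) (q t * c (y * (ln t - w)))) /\
  (forall e, 0 < e ->
   (leb R).-integrable setT (fun y : R => (expR (- (e * `|y|)) *
      \int[leb R]_(t in `]0, +oo[) (q t * c (y * (ln t - w))))%:E) /\
   \int[leb R]_y (expR (- (e * `|y|)) *
      \int[leb R]_(t in `]0, +oo[) (q t * c (y * (ln t - w)))) =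
   \int[leb R]_(t in `]0, +oo[) (q t *
      \int[leb R]_y (expR (- (e * `|y|)) * c (y * (ln t - w))))).
Proof.
move=> mq iq cc c1.
have mc : measurable_fun setT c by exact: continuous_measurable_fun.
have ic y : (leb R).-integrable `]0, +oo[ (EFin \o (fun t => q t * c (y * (ln t - w)))).
  apply: (@integrable_le _ _ _ (fun t => `|q t|)) => //; last exact: integrable_norm.
    apply: measurable_funTS; apply: measurable_funM => //.
    apply: measurableT_comp => //; apply: measurable_funM => //.
    by apply: measurable_funB => //; exact: measurable_ln.
  by move=> t _; rewrite normrM ler_piMr.
pose T y := \int[leb R]_(t in `]0, +oo[) (q t * c (y * (ln t - w))).
have key e : 0 < e ->
   (leb R).-integrable setT (fun y : R => (expR (- (e * `|y|)) * T y)%:E) /\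
   \int[leb R]_y (expR (- (e * `|y|)) * T y) = \int[leb R]_(t in `]0, +oo[) (q t *
      \int[leb R]_y (expR (- (e * `|y|)) * c (y * (ln t - w)))).
  move=> e0.
  have mf : measurable_fun setT (fun z : R * R =>
      expR (- (e * `|z.1|)) * (q z.2 * c (z.1 * (ln z.2 - w)))).
    have m1 : measurable_fun setT (fun z : R * R => z.1) by exact: measurable_fst.
    have m2 : measurable_fun setT (fun z : R * R => z.2) by exact: measurable_snd.
    apply: measurable_funM.
      apply: measurableT_comp; first exact: measurable_expR.
      apply: measurableT_comp => //; apply: measurable_funM => //.
      by apply: measurableT_comp.
    apply: measurable_funM; first exact: measurableT_comp.
    apply: measurableT_comp => //; apply: measurable_funM => //.
    by apply: measurable_funB => //; exact: (measurableT_comp (@measurable_ln R)).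
  have bnd (y t : R) : setT y -> Rpos R t ->
      `|expR (- (e * `|y|)) * (q t * c (y * (ln t - w)))| <= expR (- (e * `|y|)) * `|q t|.
    by move=> _ _; rewrite !normrM ger0_norm ?expR_ge0// ler_wpM2l ?expR_ge0// ler_piMr.
  have mpos : measurable (Rpos R) by [].
  have [h1 h2] := Fubini_real measurableT mpos mf (integrable_exp_norm e0)
    (integrable_norm iq) bnd.
  have E y : \int[leb R]_(t in `]0, +oo[) (expR (- (e * `|y|)) * (q t * c (y * (ln t - w)))) =
      expR (- (e * `|y|)) * T y by rewrite RintegralZl.
  split; first by move: h1; under eq_fun do rewrite /= E.
  move: h2; under eq_Rintegral do rewrite /= E.
  move=> ->; apply: eq_Rintegral => t _ /=.
  have [_ intt] := integrable_exp_norm_trig (ln t - w) e0 cc c1.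
  by rewrite -RintegralZl//; apply: eq_Rintegral => y _; rewrite mulrCA.
split=> //.
have [/(@integrable_measurable R setT) m1 _] := key 1 ltr01.
rewrite (_ : (fun y => _) = (fun y => expR (1 * `|y|) * (expR (- (1 * `|y|)) * T y))); last first.
  by apply/funext => y; rewrite mulrA -expRD addrN expR0 mul1r.
apply: measurable_funM => //; apply: measurableT_comp; first exact: measurable_expR.
by apply: measurable_funM => //; exact: measurableT_comp.
Qed.

Lemma cvg_scaled (R : realType) (f : R -> R) (a : R) :
  {for 0, continuous f} -> f (n.+1%:R^-1 * a) @[n --> \oo] --> f 0.
Proof.
move=> cf; have h : (n.+1%:R^-1 * a : R) @[n --> \oo] --> 0 * a.
  by apply: cvgM; [exact: cvg_harmonic|exact: cvg_cst].
by rewrite mul0r in h; exact: cvg_trans (cvg_app f h) cf.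
Qed.

Section inversion.
Context (R : realType) (q : R -> R) (w M : R) (B : R -> R).
Hypotheses (q0 : forall t : R, 0 < t -> 0 <= q t)
  (cq : forall t : R, 0 < t -> {for t, continuous q})
  (mq : measurable_fun setT q) (iq : (leb R).-integrable `]0, +oo[ (EFin \o q))
  (qM : forall v, q (expR v) * expR v <= M)
  (iB : (leb R).-integrable setT (EFin \o B)).

Let phi (c : R -> R) (y : R) := \int[leb R]_(t in `]0, +oo[) (q t * c (y * (ln t - w))).

(** As e tends to 0 the damping factor exp (- e |y|) disappears. *)
Lemma damped_cvg (c : R -> R) : continuous c -> (forall x, `|c x| <= 1) ->
  (forall y, `|phi c y| <= B y) ->
  (leb R).-integrable setT (EFin \o phi c) /\
  \int[leb R]_y (expR (- (n.+1%:R^-1 * `|y|)) * phi c y) @[n --> \oo]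
    --> \int[leb R]_y phi c y.
Proof.
move=> cc c1 phiB; have [mphi _] := trig_transform_Fubini w mq iq cc c1.
apply: (@Rintegral_dominated R setT (fun n y => expR (- (n.+1%:R^-1 * `|y|)) * phi c y)
  (phi c) B) => //.
- move=> n; apply: measurable_funM => //; apply: continuous_measurable_fun.
  exact: cont_exp_norm.
- move=> y _; rewrite -[X in _ --> X]mul1r; apply: cvgM; last exact: cvg_cst.
  have := @cvg_scaled R (fun x => expR (- x)) `|y|; rewrite oppr0 expR0; apply.
  by apply/cont_expR/contN; exact: cvg_id.
- move=> n y _; rewrite normrM ger0_norm ?expR_ge0//.
  by apply: le_trans (phiB y); rewrite ler_piMl// expR_le1 oppr_le0 mulr_ge0.
Qed.

Lemma cont_q_exp (v : R) : {for v, continuous (fun v => q (expR v) * expR v)}.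
Proof.
apply: contM; last exact: continuous_expR.
by apply: cont_comp; [exact: continuous_expR|apply/cq; exact: expR_gt0].
Qed.

(** The substitution t = exp (e xi + w) turns the Poisson kernel of width e into
   the fixed density 1 / (1 + xi^2). *)
Lemma poisson_average (e : R) : 0 < e ->
  \int[leb R]_(t in `]0, +oo[) (q t * (2 * (e / (e ^+ 2 + (ln t - w) ^+ 2)))) =
  \int[leb R]_x (2 * (q (expR (e * x + w)) * expR (e * x + w)) * (1 + x ^+ 2)^-1).
Proof.
move=> e0; have d0 x : e ^+ 2 + x ^+ 2 != 0.
  by rewrite gt_eqF// ltr_wpDr ?sqr_ge0// exprn_gt0.
have cS (f : R -> R) (x : R) : {for x, continuous f} ->
    {for x, continuous (fun t => e / (e ^+ 2 + (f t - w) ^+ 2))}.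
  move=> cf; apply: contM; first exact: cvg_cst.
  apply: contV => //; apply: contD; first exact: cvg_cst.
  rewrite (_ : (fun t => _ ^+ 2) = (fun t => (f t - w) * (f t - w))); last first.
    by apply/funext => u; rewrite expr2.
  by apply: contM; (apply: contD; [exact: cf|exact: cvg_cst]).
have pos x : 0 <= 2 * (e / (e ^+ 2 + x ^+ 2)).
  by rewrite mulr_ge0// divr_ge0 ?(ltW e0)// addr_ge0 ?sqr_ge0.
rewrite /Rintegral integral_expR_subst; last 2 first.
- move=> t t0; apply: contM; first exact: cq.
  apply: contM; first exact: cvg_cst.
  by apply: cS; exact: continuous_ln.
- by move=> t t0; rewrite mulr_ge0// q0.
rewrite (@integral_affine _ (fun v => q (expR v) *
   (2 * (e / (e ^+ 2 + (ln (expR v) - w) ^+ 2))) * expR v) e w)//.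
- congr fine; apply: eq_integral => x _; congr EFin.
  rewrite expRK addrK.
  have x0 : 1 + x ^+ 2 != 0 by rewrite gt_eqF// ltr_wpDr ?sqr_ge0.
  have -> : e ^+ 2 + (e * x) ^+ 2 = e ^+ 2 * (1 + x ^+ 2) by ring.
  by field; rewrite x0 gt_eqF.
- move=> v.
  rewrite (_ : (fun v => _) = (fun v => q (expR v) * expR v *
      (2 * (e / (e ^+ 2 + (v - w) ^+ 2))))); last first.
    by apply/funext => u; rewrite expRK mulrAC.
  apply: (@contM _ (fun v => q (expR v) * expR v)); first exact: cont_q_exp.
  apply: contM; first exact: cvg_cst.
  by apply: cS; exact: cvg_id.
- by move=> v; rewrite mulr_ge0 ?expR_ge0// mulr_ge0// q0// expR_gt0.
Qed.

(** After damping and Fubini the inner integral is a Poisson kernel, whose mass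
    concentrates at ln t = w as the damping disappears. *)
Lemma inversion_cos : (forall y, `|phi cos y| <= B y) ->
  \int[leb R]_y phi cos y = 2 * pi * (q (expR w) * expR w).
Proof.
move=> phiB; have [_ h1] := damped_cvg (@continuous_cos R) (@cos_max R) phiB.
have [_ tr] := trig_transform_Fubini w mq iq (@continuous_cos R) (@cos_max R).
pose g v := q (expR v) * expR v.
have E n : \int[leb R]_y (expR (- (n.+1%:R^-1 * `|y|)) * phi cos y) =
    \int[leb R]_x (2 * g (n.+1%:R^-1 * x + w) * (1 + x ^+ 2)^-1).
  have n0 : 0 < n.+1%:R^-1 :> R by rewrite invr_gt0.
  rewrite (tr _ n0).2 -poisson_average//; apply: eq_Rintegral => t _.
  by rewrite poisson_cos.
rewrite (eq_cvg _ _ E) in h1.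
have cg : {for 0, continuous (fun x => g (x + w))}.
  apply: (@cont_comp _ (fun x => x + w) g); last exact: cont_q_exp.
  by apply: contD; [exact: cvg_id|exact: cvg_cst].
have [|||| _ h2] := @Rintegral_dominated R setT
  (fun n x => 2 * g (n.+1%:R^-1 * x + w) * (1 + x ^+ 2)^-1)
  (fun x => 2 * g w * (1 + x ^+ 2)^-1) (fun x => 2 * M * (1 + x ^+ 2)^-1)
  measurableT.
- move=> n; apply: continuous_measurable_fun => x.
  apply: (@contM _ (fun x => 2 * g (n.+1%:R^-1 * x + w))); last exact: continuous_oneDsqrV.
  apply: contM; first exact: cvg_cst.
  apply: (@cont_comp _ (fun x => n.+1%:R^-1 * x + w) g); last exact: cont_q_exp.
  by apply: contD; [exact: cont_linear|exact: cvg_cst].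
- move=> x _; apply: cvgM; last exact: cvg_cst.
  apply: cvgM; first exact: cvg_cst.
  by have := @cvg_scaled R (fun x => g (x + w)) x cg; rewrite add0r.
- by apply: integrable_scaled => //; exact: integrable_oneDsqrV.
- move=> n x _; have p0 : 0 <= (1 + x ^+ 2)^-1 by rewrite invr_ge0 addr_ge0 ?sqr_ge0.
  rewrite ger0_norm; last by rewrite mulr_ge0// mulr_ge0// /g mulr_ge0 ?expR_ge0// q0 ?expR_gt0.
  by rewrite ler_wpM2r// ler_pM2l// /g qM.
rewrite (@cvg_unique _ (@Rhausdorff R) _ _ _ _ h1 h2).
rewrite RintegralZl//; last exact: integrable_oneDsqrV.
by rewrite Rintegral_oneDsqrV /g; ring.
Qed.

Lemma inversion_sin : (forall y, `|phi sin y| <= B y) -> \int[leb R]_y phi sin y = 0.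
Proof.
move=> phiB; have [_ h1] := damped_cvg (@continuous_sin R) (@sin_max R) phiB.
have [_ tr] := trig_transform_Fubini w mq iq (@continuous_sin R) (@sin_max R).
have E n : \int[leb R]_y (expR (- (n.+1%:R^-1 * `|y|)) * phi sin y) = 0.
  have n0 : 0 < n.+1%:R^-1 :> R by rewrite invr_gt0.
  rewrite (tr _ n0).2 (_ : (fun t => _) = cst 0) ?Rintegral_cst// ?mul0r//.
  by apply/funext => t; rewrite poisson_sin// mulr0.
rewrite (eq_cvg _ _ E) in h1.
exact: (@cvg_unique _ (@Rhausdorff R) _ _ _ _ h1 (cvg_cst _)).
Qed.

End inversion.

(** * Complex integrals *)

Definition cis (R : realType) (t : R) : R[i] := (cos t +i* sin t)%C.

Lemma ReCM (R : realType) (x y : R[i]) :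
  complex.Re (x * y) = complex.Re x * complex.Re y - complex.Im x * complex.Im y.
Proof. by case: x y => a b [c d]. Qed.

Lemma ImCM (R : realType) (x y : R[i]) :
  complex.Im (x * y) = complex.Re x * complex.Im y + complex.Im x * complex.Re y.
Proof. by case: x y => a b [c d]. Qed.

Lemma ReCD (R : realType) (x y : R[i]) : complex.Re (x + y) = complex.Re x + complex.Re y.
Proof. by case: x y => a b [c d]. Qed.

Lemma ImCD (R : realType) (x y : R[i]) : complex.Im (x + y) = complex.Im x + complex.Im y.
Proof. by case: x y => a b [c d]. Qed.

Lemma eq_complexP (R : realType) (x y : R[i]) :
  complex.Re x = complex.Re y -> complex.Im x = complex.Im y -> x = y.
Proof. by case: x y => a b [c d] /= -> ->. Qed.

Lemma cisD (R : realType) (s t : R) : cis (s + t) = cis s * cis t.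
Proof.
by apply: eq_complexP; rewrite ?ReCM ?ImCM /= ?cosD ?sinD//; ring.
Qed.

Lemma rCM (R : realType) (x y : R) : (x * y)%:C%C = x%:C%C * y%:C%C.
Proof. exact: rmorphM. Qed.

Lemma rCD (R : realType) (a b : R) : (a + b)%:C%C = a%:C%C + b%:C%C.
Proof. exact: (rmorphD (real_complex R)). Qed.

Lemma rCN (R : realType) (a : R) : (- a)%:C%C = - a%:C%C.
Proof. by apply: eq_complexP; rewrite /= ?oppr0. Qed.

Lemma rCV (R : realType) (a : R) : (a^-1)%:C%C = a%:C%C^-1.
Proof. exact: (fmorphV (real_complex R)). Qed.

Lemma rCX (R : realType) (a : R) (n : nat) : (a ^+ n)%:C%C = a%:C%C ^+ n.
Proof. exact: (rmorphXn (real_complex R)). Qed.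

Lemma rC_sum (R : realType) (n : nat) (F : 'I_n -> R) :
  (\sum_(i < n) F i)%:C%C = \sum_(i < n) (F i)%:C%C.
Proof. exact: (rmorph_sum (real_complex R)). Qed.

Lemma i_neq0 (R : realType) : 'i%C != 0 :> R[i].
Proof. by rewrite eq_complex /= oner_eq0 andbF. Qed.

Lemma cis0 (R : realType) : cis 0 = 1 :> R[i].
Proof. by rewrite /cis cos0 sin0. Qed.

Lemma cis_turn (R : realType) : cis (pi *+ 2) = 1 :> R[i].
Proof. by rewrite /cis cos2pi sin2pi. Qed.

Lemma eq_cintegral (R : realType) (D : set R) (f g : R -> R[i]) :
  (forall t, D t -> f t = g t) -> cintegral D f = cintegral D g.
Proof.
move=> fg; apply: eq_complexP => /=; apply: eq_Rintegral => t; rewrite inE => Dt;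
  by rewrite fg.
Qed.

Lemma eq_cintegrable (R : realType) (D : set R) (f g : R -> R[i]) :
  measurable D -> (forall t, D t -> f t = g t) ->
  cintegrable D f -> cintegrable D g.
Proof.
move=> mD fg [h1 h2]; split.
- by apply: eq_integrable h1 => // t; rewrite inE => Dt; rewrite fg.
- by apply: eq_integrable h2 => // t; rewrite inE => Dt; rewrite fg.
Qed.

Lemma cintegrableZ (R : realType) (D : set R) (c : R[i]) (f : R -> R[i]) :
  measurable D -> cintegrable D f -> cintegrable D (fun t => c * f t).
Proof.
move=> mD [h1 h2]; split.
- under eq_fun do rewrite ReCM EFinB.
  by apply: integrableB => //; under eq_fun do rewrite EFinM; exact: integrableZl.
- under eq_fun do rewrite ImCM EFinD.
  by apply: integrableD => //; under eq_fun do rewrite EFinM; exact: integrableZl.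
Qed.

Lemma cintegralZ (R : realType) (D : set R) (c : R[i]) (f : R -> R[i]) :
  measurable D -> cintegrable D f ->
  cintegral D (fun t => c * f t) = c * cintegral D f.
Proof.
move=> mD [h1 h2].
have iZ k (g : R -> R) := @integrable_scaled R D k g mD.
apply: eq_complexP => /=.
- rewrite ReCM /= -!RintegralZl// -RintegralB//; [|exact: iZ|exact: iZ].
  by apply: eq_Rintegral => t _; rewrite ReCM.
- rewrite ImCM /= -!RintegralZl// -RintegralD//; [|exact: iZ|exact: iZ].
  by apply: eq_Rintegral => t _; rewrite ImCM.
Qed.

Lemma cintegrableD (R : realType) (D : set R) (f g : R -> R[i]) :
  measurable D -> cintegrable D f -> cintegrable D g ->
  cintegrable D (fun t => f t + g t).
Proof.
move=> mD [f1 f2] [g1 g2]; split.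
- by under eq_fun do rewrite ReCD; exact: integrableD_EFin.
- by under eq_fun do rewrite ImCD; exact: integrableD_EFin.
Qed.

Lemma cintegralD (R : realType) (D : set R) (f g : R -> R[i]) :
  measurable D -> cintegrable D f -> cintegrable D g ->
  cintegral D (fun t => f t + g t) = cintegral D f + cintegral D g.
Proof.
move=> mD [f1 f2] [g1 g2]; apply: eq_complexP => /=.
- by rewrite -RintegralD//; apply: eq_Rintegral => t _; rewrite ReCD.
- by rewrite -RintegralD//; apply: eq_Rintegral => t _; rewrite ImCD.
Qed.

Lemma cintegrable0 (R : realType) (D : set R) :
  measurable D -> cintegrable D (fun _ => 0 : R[i]).
Proof. by move=> mD; split; exact: integrable0. Qed.

Lemma cintegral_sum (R : realType) (D : set R) (I : Type) (r : seq I)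
    (f : I -> R -> R[i]) : measurable D -> (forall i, cintegrable D (f i)) ->
  cintegrable D (fun t => \sum_(i <- r) f i t) /\
  cintegral D (fun t => \sum_(i <- r) f i t) = \sum_(i <- r) cintegral D (f i).
Proof.
move=> mD fi; elim: r => [|i r [IH1 IH2]].
  split.
    by apply: (eq_cintegrable mD _ (cintegrable0 mD)) => t _; rewrite big_nil.
  rewrite big_nil (@eq_cintegral _ _ _ (fun _ => 0)); last by move=> t _; rewrite big_nil.
  by rewrite /cintegral/= Rintegral_cst// mul0r.
split.
  apply: (@eq_cintegrable _ _ (fun t => f i t + \sum_(j <- r) f j t)) => //.
    by move=> t _; rewrite big_cons.
  exact: cintegrableD.
rewrite big_cons -IH2 -cintegralD//.
by apply: eq_cintegral => t _; rewrite big_cons.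
Qed.

(** * Mellin inversion *)

(** The Mellin transform on a vertical line, as a function of the ordinate: with
    q t = t^(c-1) f t this is the Mellin transform of f at c + i y. *)
Definition mellin (R : realType) (q : R -> R) (y : R) : R[i] :=
  cintegral (Rpos R) (fun t => (q t)%:C%C * cis (y * ln t)).

Lemma mellinE (R : realType) (q : R -> R) (y : R) :
  mellin q y = ((\int[leb R]_(t in `]0, +oo[) (q t * cos (y * ln t))) +i*
                (\int[leb R]_(t in `]0, +oo[) (q t * sin (y * ln t))))%C.
Proof.
apply: eq_complexP => /=; apply: eq_Rintegral => t _.
- by rewrite mul0r subr0.
- by rewrite mul0r addr0.
Qed.

Lemma integrable_trig (R : realType) (q c : R -> R) (y : R) :
  measurable_fun setT q -> (leb R).-integrable `]0, +oo[ (EFin \o q) ->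
  continuous c -> (forall x, `|c x| <= 1) ->
  (leb R).-integrable `]0, +oo[ (fun t => (q t * c (y * ln t))%:E).
Proof.
move=> mq iq cc c1.
apply: (@integrable_le _ _ (fun t => q t * c (y * ln t)) (fun t => `|q t|)) => //; last first.
  exact: integrable_norm.
  by move=> t _; rewrite normrM ler_piMr.
apply: measurable_funTS; apply: measurable_funM => //.
apply: measurableT_comp; first exact: continuous_measurable_fun.
by apply: measurable_funM => //; exact: measurable_ln.
Qed.

Lemma mellin_cis (R : realType) (q : R -> R) (y w : R) :
  measurable_fun setT q -> (leb R).-integrable `]0, +oo[ (EFin \o q) ->
  mellin q y * cis (- (y * w)) =
  ((\int[leb R]_(t in `]0, +oo[) (q t * cos (y * (ln t - w)))) +i*
   (\int[leb R]_(t in `]0, +oo[) (q t * sin (y * (ln t - w)))))%C.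
Proof.
move=> mq iq.
have ic := integrable_trig y mq iq (@continuous_cos R) (@cos_max R).
have isn := integrable_trig y mq iq (@continuous_sin R) (@sin_max R).
have iZ (k : R) (g : R -> R) : (leb R).-integrable (Rpos R) (EFin \o g) ->
    (leb R).-integrable (Rpos R) (EFin \o (fun t => g t * k)).
  by move=> ig; rewrite (_ : _ \o _ = (fun t => (EFin \o g) t * k%:E)%E)//; exact: integrableZr.
rewrite mellinE; apply: eq_complexP; rewrite ?ReCM ?ImCM /=.
- rewrite -!RintegralZr// -RintegralB//; [|exact: iZ|exact: iZ].
  by apply: eq_Rintegral => t _; rewrite mulrBr cosD cosN sinN; ring.
- rewrite -!RintegralZr// -RintegralD//; [|exact: iZ|exact: iZ].
  by apply: eq_Rintegral => t _; rewrite mulrBr sinD cosN sinN; ring.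
Qed.

Lemma le_Re_Im_cis (R : realType) (z : R[i]) (b t : R) :
  `|complex.Re z| <= b -> `|complex.Im z| <= b ->
  `|complex.Re (z * cis t)| <= 2 * b /\ `|complex.Im (z * cis t)| <= 2 * b.
Proof.
move=> h1 h2; have b2 : 2 * b = b * 1 + b * 1 by ring.
rewrite ReCM ImCM b2; split.
- rewrite (le_trans (ler_normB _ _))// !normrM lerD// ler_pM//.
  + exact: cos_max.
  + exact: sin_max.
- rewrite (le_trans (ler_normD _ _))// !normrM lerD// ler_pM//.
  + exact: sin_max.
  + exact: cos_max.
Qed.

(** The transform re-centred at w splits into a cosine part, which carries the
    value, and a sine part, which integrates to 0. *)
Lemma mellin_inversion (R : realType) (q B : R -> R) (w M : R) :
  (forall t : R, 0 < t -> 0 <= q t) ->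
  (forall t : R, 0 < t -> {for t, continuous q}) ->
  measurable_fun setT q -> (leb R).-integrable `]0, +oo[ (EFin \o q) ->
  (forall v, q (expR v) * expR v <= M) ->
  (leb R).-integrable setT (EFin \o B) ->
  (forall y, `|complex.Re (mellin q y)| <= B y) ->
  (forall y, `|complex.Im (mellin q y)| <= B y) ->
  cintegral setT (fun y => mellin q y * cis (- (y * w))) =
  (2 * pi * (q (expR w) * expR w))%:C%C.
Proof.
move=> q0 cq mq iq qM iB reB imB.
have i2B : (leb R).-integrable setT (EFin \o (fun y => 2 * B y)).
  exact: integrable_scaled.
have reC y := (le_Re_Im_cis (- (y * w)) (reB y) (imB y)).1.
have imC y := (le_Re_Im_cis (- (y * w)) (reB y) (imB y)).2.
rewrite (eq_cintegral (fun y _ => mellin_cis y w mq iq)).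
apply: eq_complexP.
- apply: (inversion_cos q0 cq mq iq qM i2B) => y.
  by have := reC y; rewrite mellin_cis.
- apply: (inversion_sin mq iq i2B) => y.
  by have := imC y; rewrite mellin_cis.
Qed.

(** * Euler's Gamma function *)

(** Euler's density t^(s-1) exp (- t). All powers of positive reals are written as
    exponentials of logarithms, so that identities between them are linear
    identities between exponents. *)
Definition gamma_weight (R : realType) (s t : R) : R := expR ((s - 1) * ln t - t).

Lemma gamma_weight_ge0 (R : realType) (s t : R) : 0 <= gamma_weight s t.
Proof. exact: expR_ge0. Qed.

Lemma gamma_weight_measurable (R : realType) (s : R) :
  measurable_fun setT (gamma_weight s).
Proof.
apply: measurableT_comp; first exact: measurable_expR.
apply: measurable_funB => //; apply: measurable_funM => //; exact: measurable_ln.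
Qed.

Lemma gamma_weight_cont (R : realType) (s t : R) : 0 < t ->
  {for t, continuous (gamma_weight s)}.
Proof.
move=> t0; apply: cont_expR; apply: contD.
  by apply: contM; [exact: cvg_cst|exact: continuous_ln].
by apply: contN; exact: cvg_id.
Qed.

Lemma gamma_weight_integrable (R : realType) (s : R) : 0 < s ->
  (leb R).-integrable `]0, +oo[ (EFin \o gamma_weight s).
Proof.
move=> s0; have := integrable_pow_exp s0 (@ltr01 R).
rewrite (_ : (fun t => _) = (EFin \o gamma_weight s))//.
by apply/funext => t; rewrite /= mul1r.
Qed.

Lemma gamma_weightS (R : realType) (s t : R) : 0 < t ->
  gamma_weight (s + 1) t = t * gamma_weight s t.
Proof.
move=> t0; rewrite -{2}(expR_ln t0) /gamma_weight -expRD; congr expR; ring.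
Qed.

Lemma clog_real (R : realType) (t : R) : 0 < t -> clog t%:C%C = (ln t +i* 0)%C.
Proof.
move=> t0; rewrite /clog /carg /cabs /= lexx expr0n addr0 sqrtr_sqr gtr0_norm//.
by rewrite divff ?gt_eqF// acos1.
Qed.

Lemma cexpE (R : realType) (a b : R) : cexp (a +i* b)%C = (expR a)%:C%C * cis b.
Proof. by apply: eq_complexP; rewrite ?ReCM ?ImCM /= mul0r ?subr0 ?addr0. Qed.

Lemma cpow_real (R : realType) (t a b : R) : 0 < t ->
  cpow t%:C%C (a +i* b)%C = (expR (a * ln t))%:C%C * cis (b * ln t).
Proof.
by move=> t0; rewrite /cpow clog_real// -cexpE; congr cexp;
  apply: eq_complexP; rewrite ?ReCM ?ImCM /= mulr0 ?subr0 ?add0r.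
Qed.

Lemma Gamma_mellin (R : realType) (s y : R) : 0 < s ->
  Gamma (s +i* y)%C = mellin (gamma_weight s) y.
Proof.
move=> s0; rewrite /Gamma /=.
have -> : Num.truncn (1 - s) = 0%N.
  apply/truncn0Pn; rewrite -ltNge; lra.
rewrite big_ord0 divr1 addr0; apply: eq_cintegral => t; rewrite /= in_itv/= andbT => t0.
have -> : (s +i* y)%C - 1 = ((s - 1) +i* y)%C :> R[i].
  by apply: eq_complexP => /=; rewrite ?subr0.
rewrite cpow_real// mulrAC -rmorphM/= -expRD.
by congr (_%:C%C * _); rewrite /gamma_weight.
Qed.

(** Integration by parts for t^s exp (- t) c (y ln t), which vanishes at both ends.
    The cases c = cos and c = sin are the real and imaginary parts of the
    functional equation of Gamma. *)
Lemma gamma_weight_parts (R : realType) (s y : R) (c c' : R -> R) : 0 < s ->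
  continuous c -> continuous c' ->
  (forall x, `|c x| <= 1) -> (forall x, `|c' x| <= 1) ->
  (forall x : R, is_derive x 1 c (c' x)) ->
  \int[leb R]_(t in `]0, +oo[) (gamma_weight (s + 1) t * c (y * ln t)) =
  s * \int[leb R]_(t in `]0, +oo[) (gamma_weight s t * c (y * ln t)) +
  y * \int[leb R]_(t in `]0, +oo[) (gamma_weight s t * c' (y * ln t)).
Proof.
move=> s0 cc cc' c1 c1' dc.
have s10 : 0 < s + 1 by rewrite addr_gt0.
pose g0 := gamma_weight s; pose g1 := gamma_weight (s + 1).
have i0 : (leb R).-integrable (Rpos R) (EFin \o g0) by exact: gamma_weight_integrable.
have i1 : (leb R).-integrable (Rpos R) (EFin \o g1) by exact: gamma_weight_integrable.
have m0 : measurable_fun setT g0 by exact: gamma_weight_measurable.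
have m1 : measurable_fun setT g1 by exact: gamma_weight_measurable.
have iZ k (g : R -> R) := @integrable_scaled R (Rpos R) k g (measurable_itv _).
have ia := integrable_trig y m0 i0 cc c1.
have ib := integrable_trig y m0 i0 cc' c1'.
have ic := integrable_trig y m1 i1 cc c1.
pose F t := g1 t * c (y * ln t).
pose f t := s * (g0 t * c (y * ln t)) + y * (g0 t * c' (y * ln t)) - g1 t * c (y * ln t).
have if_ : (leb R).-integrable (Rpos R) (EFin \o f).
  rewrite (_ : _ \o _ = (fun t => (s * (g0 t * c (y * ln t)) + y * (g0 t * c' (y * ln t)))%:E
     - (g1 t * c (y * ln t))%:E)%E)//.
  by apply: integrableB => //; apply: integrableD_EFin => //; apply: iZ.
have cl (k t : R -> R) (x : R) : continuous k -> 0 < x ->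
    {for x, continuous (fun t => k (y * ln t))}.
  move=> ck x0; apply: (@cont_comp _ (fun t => y * ln t) k); last exact: ck.
  by apply: contM; [exact: cvg_cst|exact: continuous_ln].
have dF (t : R) : 0 < t -> is_derive t 1 F (f t).
  move=> t0.
  have dl : is_derive t 1 (fun t => y * ln t) (y * t^-1).
    have : is_derive t 1 (fun t : R => y * ln t) (y * (t^-1 * 1) + ln t * 0) by der.
    by move/is_derive_eq; apply; ring.
  have dcl : is_derive t 1 (fun t => c (y * ln t)) (c' (y * ln t) * (y * t^-1)).
    exact: (@is_derive1_comp _ c (fun t => y * ln t)).
  have : is_derive t 1 F (g1 t * (c' (y * ln t) * (y * t^-1)) + c (y * ln t) *
     (g1 t * ((s + 1 - 1) * (t^-1 * 1) + ln t * 0 + - 1))).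
    by rewrite /F /g1 /gamma_weight; der.
  move/is_derive_eq; apply; rewrite /f /g1 gamma_weightS// -/(g0 t); field.
  by rewrite gt_eqF.
have bF t : `|F t| <= g1 t.
  by rewrite normrM ger0_norm ?gamma_weight_ge0// ler_piMr// gamma_weight_ge0.
have : \int[leb R]_(t in Rpos R) f t = 0 - 0.
  apply: (@FTC_itv0y R F f) => //.
  - move=> t t0; apply: contD.
      apply: contD; (apply: contM; first exact: cvg_cst).
        by apply: contM; [exact: gamma_weight_cont|exact: cl].
      by apply: contM; [exact: gamma_weight_cont|exact: cl].
    apply: contN; apply: contM; first exact: gamma_weight_cont.
    exact: cl.
  - apply: (@cvg0_of_exp_bound _ _ 1 s) => // n.
    rewrite mul1r (le_trans (bF _))// ler_expR expRK addrK.
    by have := expR_ge0 (- n%:R : R); rewrite mulrN; lra.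
  - have h2 : 0 < 2^-1 :> R by rewrite invr_gt0.
    have [C hC] := ln_le_linear s0 h2.
    apply: (@cvg0_of_exp_bound _ _ (expR C) 2^-1) => // n.
    rewrite (le_trans (bF _))// -expRD ler_expR addrK.
    have := hC _ (expR_gt0 n%:R); have := le_expRn R n; lra.
rewrite subrr /f RintegralB//; last by apply: integrableD_EFin => //; exact: iZ.
rewrite RintegralD//; [|exact: iZ|exact: iZ].
by rewrite !RintegralZl// => /eqP; rewrite subr_eq0 => /eqP ->.
Qed.

Lemma mellin_gammaS (R : realType) (s y : R) : 0 < s ->
  mellin (gamma_weight (s + 1)) y = (s +i* y)%C * mellin (gamma_weight s) y.
Proof.
move=> s0; rewrite !mellinE.
have cN : continuous (fun x : R => - sin x).
  by move=> x; apply: contN; exact: continuous_sin.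
have c1N x : `|- sin x| <= 1 :> R by rewrite normrN; exact: sin_max.
apply: eq_complexP; rewrite ?ReCM ?ImCM /=.
- rewrite (gamma_weight_parts y s0 (@continuous_cos R) cN (@cos_max R) c1N).
  congr (_ + _); rewrite -mulrN; congr (_ * _).
  under eq_Rintegral do rewrite mulrN -mulN1r.
  rewrite RintegralZl ?mulN1r//; apply: integrable_trig.
  + exact: gamma_weight_measurable.
  + exact: gamma_weight_integrable.
  + exact: continuous_sin.
  + exact: sin_max.
- exact: (gamma_weight_parts y s0 (@continuous_sin R) (@continuous_cos R)
    (@sin_max R) (@cos_max R)).
Qed.

Lemma GammaS (R : realType) (s : R[i]) : 0 < complex.Re s ->
  Gamma (s + 1) = s * Gamma s.
Proof.
case: s => s y /= s0.
have -> : (s +i* y)%C + 1 = ((s + 1) +i* y)%C :> R[i].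
  by apply: eq_complexP => /=; rewrite ?addr0.
by rewrite !Gamma_mellin ?addr_gt0// mellin_gammaS.
Qed.

Lemma Gamma1 (R : realType) : Gamma (1 : R[i]) = 1.
Proof.
rewrite (_ : 1 = (1 +i* 0)%C :> R[i])// Gamma_mellin// mellinE.
have := @poisson_half R 1 0 ltr01; rewrite expr1n expr0n/= addr0 divr1 => h.
apply: eq_complexP => /=.
- rewrite -[RHS]h; apply: eq_Rintegral => t _.
  by rewrite /gamma_weight subrr !mul0r mul1r add0r.
- rewrite (_ : (fun t => _) = cst 0) ?Rintegral_cst// ?mul0r//.
  by apply/funext => t; rewrite mul0r sin0 mulr0.
Qed.

Lemma natC (R : realType) (n : nat) : n%:R = (n%:R)%:C%C :> R[i].
Proof. by rewrite rmorph_nat. Qed.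

Lemma Gamma_nat (R : realType) (n : nat) : Gamma (n.+1%:R : R[i]) = (n`!)%:R.
Proof.
elim: n => [|n IH]; first by rewrite Gamma1.
rewrite -natr1 GammaS ?IH ?factS ?natrM//.
by rewrite natC /= ltr0n.
Qed.

Lemma rGamma_nat (R : realType) (n : nat) : rGamma (n.+1%:R : R) = (n`!)%:R.
Proof.
by rewrite /rGamma -natC Gamma_nat natC.
Qed.

Lemma mellin_bound (R : realType) (q : R -> R) (y : R) :
  measurable_fun setT q -> (leb R).-integrable `]0, +oo[ (EFin \o q) ->
  `|complex.Re (mellin q y)| <= \int[leb R]_(t in `]0, +oo[) `|q t| /\
  `|complex.Im (mellin q y)| <= \int[leb R]_(t in `]0, +oo[) `|q t|.
Proof.
move=> mq iq; rewrite mellinE /=.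
have inq : (leb R).-integrable (Rpos R) (EFin \o (fun t => `|q t|)).
  exact: integrable_norm.
have key (c : R -> R) : continuous c -> (forall x, `|c x| <= 1) ->
    `|\int[leb R]_(t in `]0, +oo[) (q t * c (y * ln t))| <=
    \int[leb R]_(t in `]0, +oo[) `|q t|.
  move=> cc c1; have iqc := integrable_trig y mq iq cc c1.
  rewrite (le_trans (le_normr_Rintegral _ iqc))//.
  apply: le_Rintegral => //; first exact: (integrable_norm iqc).
  by move=> t _; rewrite normrM ler_piMr.
split.
- by apply: key; [exact: continuous_cos|exact: cos_max].
- by apply: key; [exact: continuous_sin|exact: sin_max].
Qed.

Definition normsq (R : realType) (z : R[i]) : R :=
  complex.Re z ^+ 2 + complex.Im z ^+ 2.

Lemma normsqM (R : realType) (x y : R[i]) : normsq (x * y) = normsq x * normsq y.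
Proof. by rewrite /normsq ReCM ImCM; ring. Qed.

Lemma le_sqrD1 (R : realType) (x : R) : 0 <= x -> x <= (x + 1) ^+ 2.
Proof. by move=> x0; nra. Qed.

(** Shifting the argument twice gains the factor 1 / |s (s + 1)|, which is all
    the vertical decay that absolute convergence needs. *)
Lemma mellin_gamma_decay (R : realType) (s : R) : 0 < s ->
  exists C, forall y,
    `|complex.Re (mellin (gamma_weight s) y)| <= C * (1 + y ^+ 2)^-1 /\
    `|complex.Im (mellin (gamma_weight s) y)| <= C * (1 + y ^+ 2)^-1.
Proof.
move=> s0; pose K := \int[leb R]_(t in `]0, +oo[) `|gamma_weight (s + 1 + 1) t|.
have s1 : 0 < s + 1 by rewrite addr_gt0.
have s2 : 0 < s + 1 + 1 by rewrite addr_gt0.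
(* m (1 + y^2) bounds s^2 + y^2 from below. *)
pose m := Num.min 1 (s ^+ 2).
have m0 : 0 < m by rewrite lt_min ltr01 exprn_gt0.
pose D := 2 * K ^+ 2 / m.
have D0 : 0 <= D by rewrite /D divr_ge0 ?(ltW m0)// mulr_ge0// sqr_ge0.
exists (D + 1) => y; pose z := mellin (gamma_weight s) y.
have y0 : 0 < 1 + y ^+ 2 by rewrite ltr_wpDr ?sqr_ge0.
have [bR bI] := mellin_bound y (gamma_weight_measurable (s + 1 + 1))
  (gamma_weight_integrable s2).
have e : normsq (mellin (gamma_weight (s + 1 + 1)) y) =
    ((s + 1) ^+ 2 + y ^+ 2) * (s ^+ 2 + y ^+ 2) * normsq z.
  by rewrite mellin_gammaS// mellin_gammaS// !normsqM mulrA.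
have b : normsq (mellin (gamma_weight (s + 1 + 1)) y) <= 2 * K ^+ 2.
  have sq u : `|u| <= K -> u ^+ 2 <= K ^+ 2.
    move=> uK; rewrite -[u ^+ 2]real_normK ?num_real// ler_sqr ?nnegrE//.
    exact: le_trans uK.
  by rewrite /normsq mulr_natl mulr2n lerD// sq.
have l1 : 1 + y ^+ 2 <= (s + 1) ^+ 2 + y ^+ 2.
  by rewrite lerD2r -{1}(expr1n _ 2) ler_sqr ?nnegrE ?(ltW s1)// lerDr ltW.
have l2 : m * (1 + y ^+ 2) <= s ^+ 2 + y ^+ 2.
  rewrite mulrDr mulr1 lerD//; first by rewrite /m ge_min lexx orbT.
  by rewrite ler_piMl ?sqr_ge0// /m ge_min lexx.
have z0 : 0 <= normsq z by rewrite addr_ge0 ?sqr_ge0.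
have nz : normsq z <= D * (1 + y ^+ 2)^-1 ^+ 2.
  rewrite exprVn ler_pdivlMr ?exprn_gt0// /D mulrC ler_pdivlMr//.
  apply: (le_trans _ b); rewrite e mulrAC ler_wpM2r// expr2 -mulrA.
  by apply: ler_pM => //; [exact: ltW|rewrite mulr_ge0 ?ltW|rewrite mulrC].
have fin u : u ^+ 2 <= normsq z -> `|u| <= (D + 1) * (1 + y ^+ 2)^-1.
  move=> uz; rewrite -ler_sqr ?nnegrE ?mulr_ge0 ?addr_ge0 ?invr_ge0 ?(ltW y0)//.
  rewrite real_normK ?num_real// (le_trans uz)// (le_trans nz)// exprMn.
  by rewrite ler_wpM2r ?sqr_ge0// le_sqrD1.
by split; apply: fin; rewrite /normsq ?lerDl ?lerDr sqr_ge0.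
Qed.

(** Cahen-Mellin: the inverse Mellin transform of Gamma is exp (- t), here at
    t = exp w. *)
Lemma Cahen_Mellin (R : realType) (s w : R) : 0 < s ->
  cintegral setT (fun y => mellin (gamma_weight s) y * cis (- (y * w))) =
  (2 * pi * expR (s * w - expR w))%:C%C.
Proof.
move=> s0; have [C hC] := mellin_gamma_decay s0.
have ge v : gamma_weight s (expR v) * expR v = expR (s * v - expR v).
  by rewrite /gamma_weight expRK -expRD; congr expR; ring.
have [M hM] := ln_le_linear s0 (@ltr01 R).
rewrite (@mellin_inversion _ _ (fun y => C * (1 + y ^+ 2)^-1) w (expR M)).
- by rewrite ge.
- by move=> t _; exact: gamma_weight_ge0.
- by move=> t; exact: gamma_weight_cont.
- exact: gamma_weight_measurable.
- exact: gamma_weight_integrable.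
- move=> v; rewrite ge ler_expR; have := hM _ (expR_gt0 v); rewrite expRK; lra.
- by apply: integrable_scaled => //; exact: integrable_oneDsqrV.
- by move=> y; have [] := hC y.
- by move=> y; have [] := hC y.
Qed.

(** * Gamma has no zero in the right half-plane *)

Lemma sin_le_norm (R : realType) (x : R) : `|sin x| <= `|x|.
Proof.
wlog x0 : x / 0 <= x.
  move=> h; have [/h//|x0] := leP 0 x.
  by have := h (- x); rewrite sinN !normrN; apply; rewrite oppr_ge0 ltW.
have [c _] := @MVT_segment R (@sin R) (@cos R) 0 x x0
  (fun x _ => is_derive_sin x) (continuous_subspaceT (@continuous_sin R)).
by rewrite sin0 !subr0 => ->; rewrite normrM ler_piMl// cos_max.
Qed.

Lemma cos_ge_sqr (R : realType) (x : R) : 1 - x ^+ 2 / 2 <= cos x.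
Proof.
have -> : cos x = 1 - sin (x / 2) ^+ 2 *+ 2.
  have e : x = (x / 2) *+ 2 by rewrite -mulr_natr mulfVK.
  by rewrite {1}e cos_mulr2n cos2sin2 !mulr2n; ring.
have := sin_le_norm (x / 2); rewrite -ler_sqr ?nnegrE// !real_normK ?num_real//.
by rewrite exprMn -mulr_natr; lra.
Qed.

(** For u = exp v the right-hand side is 4 (exp (v/2) - exp (- v/2))^2, and
    exp (v/2) - exp (- v/2) >= v/2 when v >= 0. *)
Lemma sqr_ln_le (R : realType) (u : R) : 0 < u ->
  ln u ^+ 2 <= 4 * (u - 2 + u^-1).
Proof.
move=> u0; rewrite -{2 3}(expR_ln u0); move: (ln u) => v; rewrite -expRN.
wlog v0 : v / 0 <= v.
  move=> h; have [/h//|v0] := leP 0 v.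
  have := h (- v); rewrite sqrrN opprK oppr_ge0 ltW// => /(_ isT); lra.
pose a := expR (v / 2).
have aV : expR (- (v / 2)) = a^-1 by rewrite expRN.
have a0 : 0 < a by exact: expR_gt0.
have -> : expR v = a ^+ 2 by rewrite /a -expRM_natr mulfVK.
have -> : expR (- v) = a^-1 ^+ 2.
  by rewrite -aV -expRM_natr; congr expR; field.
have a1 : 1 + v / 2 <= a by exact: expR_ge1Dx.
have b1 : a^-1 <= 1.
  by rewrite -aV expR_le1 oppr_le0 divr_ge0.
have ab : v / 2 <= a - a^-1 by lra.
have -> : a ^+ 2 - 2 + a^-1 ^+ 2 = (a - a^-1) ^+ 2 by field; rewrite gt_eqF.
have : (v / 2) ^+ 2 <= (a - a^-1) ^+ 2.
  rewrite ler_sqr ?nnegrE//; first by rewrite divr_ge0.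
  by apply: le_trans ab; rewrite divr_ge0.
lra.
Qed.

Lemma Rintegral_gammaS (R : realType) (s : R) : 0 < s ->
  \int[leb R]_(t in `]0, +oo[) gamma_weight (s + 1) t =
  s * \int[leb R]_(t in `]0, +oo[) gamma_weight s t.
Proof.
move=> s0.
have E u : \int[leb R]_(t in `]0, +oo[) gamma_weight u t =
    complex.Re (mellin (gamma_weight u) 0).
  rewrite mellinE /=; apply: eq_Rintegral => t _.
  by rewrite mul0r cos0 mulr1.
by rewrite !E mellin_gammaS// ReCM /= mul0r subr0.
Qed.

Lemma Rintegral_gamma_gt0 (R : realType) (s : R) : 1 <= s ->
  0 < \int[leb R]_(t in `]0, +oo[) gamma_weight s t.
Proof.
move=> s1; have s0 : 0 < s by exact: lt_le_trans s1.
have ig := gamma_weight_integrable s0.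
have sub : (`[1, 2]%classic : set R) `<=` Rpos R.
  by move=> x; rewrite /= !in_itv/= andbT => /andP[h _]; exact: lt_le_trans h.
have ig' : (leb R).-integrable (`[1, 2]%classic : set R) (EFin \o gamma_weight s).
  exact: integrableS ig.
apply: (@lt_le_trans _ _ (expR (- 2 : R) * 1)); first by rewrite mulr1 expR_gt0.
apply: (@le_trans _ _ (\int[leb R]_(t in `[1, 2]) gamma_weight s t)).
  have m1 : fine (leb R (`[1, 2]%classic : set R)) = 1.
    by rewrite lebesgue_measure_itv/= lte_fin ltr1n/=; ring.
  have le t : (`[1, 2]%classic : set R) t -> expR (- 2) <= gamma_weight s t.
    rewrite /= in_itv/= => /andP[t1 t2]; rewrite ler_expR.
    have : 0 <= (s - 1) * ln t by rewrite mulr_ge0 ?ln_ge0// subr_ge0.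
    lra.
  rewrite -[X in _ * X]m1 -Rintegral_cst//; apply: le_Rintegral => //.
  apply: (@integrable_le _ _ _ (gamma_weight s)) => // t Dt.
  by rewrite ger0_norm ?expR_ge0// le.
rewrite fine_le//.
- exact: integrable_fin_num ig'.
- exact: integrable_fin_num ig.
apply: ge0_subset_integral => //.
  by apply/measurable_EFinP/measurable_funTS; exact: gamma_weight_measurable.
by move=> t _; rewrite lee_fin gamma_weight_ge0.
Qed.

(** The Gamma distribution of large parameter a is concentrated near a, so the
    mean of (t / a)^(i y) under it stays close to 1. *)
Lemma mellin_gamma_neq0 (R : realType) (a y : R) : 1 + 2 * y ^+ 2 < a - 1 ->
  mellin (gamma_weight a) y != 0.
Proof.
move=> ha; have y20 : 0 <= y ^+ 2 by exact: sqr_ge0.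
have a1 : 1 < a - 1 by lra.
have a0 : 0 < a by lra.
have am0 : 0 < a - 1 by lra.
have ap0 : 0 < a + 1 by lra.
apply/negP => /eqP z0.
have := mellin_cis y (ln a) (gamma_weight_measurable a) (gamma_weight_integrable a0).
rewrite z0 mul0r => /(congr1 (@complex.Re _))/= /esym e0.
pose I u := \int[leb R]_(t in `]0, +oo[) gamma_weight u t.
have I1 : I (a + 1) = a * I a by exact: Rintegral_gammaS.
have I2 : I a = (a - 1) * I (a - 1).
  by have := Rintegral_gammaS am0; rewrite subrK.
have ge1a : 1 <= a by lra.
have Ia0 : 0 < I a by exact: Rintegral_gamma_gt0 ge1a.
have ip := gamma_weight_integrable ap0.
have ia := gamma_weight_integrable a0.
have im := gamma_weight_integrable am0.
have mpos : measurable (Rpos R) by [].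
have iD := integrableD_EFin mpos
  (integrable_scaled (1 + 4 * y ^+ 2) mpos ia)
  (integrableD_EFin mpos (integrable_scaled (- (2 * y ^+ 2 / a)) mpos ip)
    (integrable_scaled (- (2 * y ^+ 2 * a)) mpos im)).
have : \int[leb R]_(t in `]0, +oo[) ((1 + 4 * y ^+ 2) * gamma_weight a t +
      (- (2 * y ^+ 2 / a) * gamma_weight (a + 1) t +
       - (2 * y ^+ 2 * a) * gamma_weight (a - 1) t)) <=
    \int[leb R]_(t in `]0, +oo[) (gamma_weight a t * cos (y * (ln t - ln a))).
  apply: le_Rintegral => //.
    apply: (@integrable_le _ _ _ (gamma_weight a)) => //.
      apply: measurable_funTS; apply: measurable_funM.
        exact: gamma_weight_measurable.
      apply: measurableT_comp; first exact: (continuous_measurable_fun (@continuous_cos R)).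
      by apply: measurable_funM => //; apply: measurable_funB => //; exact: measurable_ln.
    move=> t _; rewrite normrM ger0_norm ?gamma_weight_ge0// ler_piMr ?gamma_weight_ge0//.
    exact: cos_max.
  move=> t /=; rewrite in_itv/= andbT => t0.
  have g1 : gamma_weight (a + 1) t = t * gamma_weight a t by exact: gamma_weightS.
  have g2 : gamma_weight (a - 1) t = t^-1 * gamma_weight a t.
    by rewrite -{2}(subrK 1 a) gamma_weightS// mulrA mulVf ?mul1r// gt_eqF.
  rewrite g1 g2.
  have -> : (1 + 4 * y ^+ 2) * gamma_weight a t +
      (- (2 * y ^+ 2 / a) * (t * gamma_weight a t) +
       - (2 * y ^+ 2 * a) * (t^-1 * gamma_weight a t)) =
      gamma_weight a t * (1 - 2 * y ^+ 2 * (t / a - 2 + (t / a)^-1)).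
    by field; rewrite !gt_eqF.
  rewrite ler_wpM2l ?gamma_weight_ge0//.
  apply: le_trans (cos_ge_sqr _); rewrite -ln_div ?posrE// exprMn lerD2l lerN2.
  have := sqr_ln_le (divr_gt0 t0 a0); move: (ln _ ^+ 2) (t / a - 2 + (t / a)^-1) => L U LU.
  by rewrite ler_pdivrMr// (le_trans (ler_wpM2l y20 LU))//; lra.
rewrite e0 RintegralD//; [|exact: integrable_scaled|apply: integrableD_EFin => //; exact: integrable_scaled].
rewrite RintegralD//; [|exact: integrable_scaled|exact: integrable_scaled].
rewrite !RintegralZl// -/(I a) -/(I (a + 1)) -/(I (a - 1)) I1.
have -> : I (a - 1) = I a / (a - 1) by rewrite I2 mulrC mulKf// gt_eqF.
apply/negP; rewrite -ltNge.
have -> : (1 + 4 * y ^+ 2) * I a + (- (2 * y ^+ 2 / a) * (a * I a) +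
   - (2 * y ^+ 2 * a) * (I a / (a - 1))) = I a * ((a - 1 - 2 * y ^+ 2) / (a - 1)).
  by field; rewrite !gt_eqF.
by rewrite mulr_gt0// divr_gt0//; lra.
Qed.

(** By the functional equation a zero at s would give zeros at all s + k, and
    mellin_gamma_neq0 excludes them for large k. *)
Lemma Gamma_neq0 (R : realType) (s : R[i]) : 0 < complex.Re s -> Gamma s != 0.
Proof.
case: s => a y /= a0; apply/negP => /eqP z0.
have all0 k : Gamma ((a + k%:R) +i* y)%C = 0 :> R[i].
  elim: k => [|k IH]; first by rewrite addr0.
  rewrite -natr1 addrA (_ : (_ +i* _)%C = ((a + k%:R) +i* y)%C + 1).
    by rewrite GammaS ?IH ?mulr0//= ltr_wpDr.
  by apply: eq_complexP => /=; rewrite ?addr0.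
(* Large enough for the hypothesis of mellin_gamma_neq0 at a + k. *)
have [k hk] : exists k : nat, 2 + 2 * y ^+ 2 < k%:R.
  by exists (Num.truncn (2 + 2 * y ^+ 2)).+1; exact: truncnS_gt.
have /eqP := all0 k; apply/negP; rewrite Gamma_mellin ?ltr_wpDr//.
by apply: mellin_gamma_neq0; lra.
Qed.

(** * Falling factorials *)

Definition ffactC (R : realType) (w : R[i]) (l : nat) : R[i] :=
  \prod_(i < l) (w - i%:R).

(** Coordinates, in the basis of falling factorials, of the polynomial
    (1 - a (w + 1)) ... (m - a (w + 1)) / m! in w. *)
Fixpoint newton (R : realType) (a : R) (m l : nat) : R :=
  if m is k.+1 then
    ((m%:R - a - a * l%:R) * newton a k l -
     a * (if l is l'.+1 then newton a k l' else 0)) / m%:R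
  else (l == 0%N)%:R.

Lemma newton_gt (R : realType) (a : R) (m l : nat) : (m < l)%N -> newton a m l = 0.
Proof.
elim: m l => [|m IH] [|l] //= ml; rewrite IH//; last exact: ltnW.
by rewrite IH// !mulr0 subr0 mul0r.
Qed.

Lemma newton_lead (R : realType) (a : R) (m : nat) : newton a m m = (- a) ^+ m / m`!%:R.
Proof.
elim: m => [|m IH]; first by rewrite /= expr0 divr1.
rewrite /= newton_gt// mulr0 add0r IH factS natrM exprS; field.
by rewrite nat1r !pnatr_eq0 -lt0n fact_gt0.
Qed.

Lemma ffactCS (R : realType) (w : R[i]) (l : nat) :
  ffactC w l.+1 = ffactC w l * (w - l%:R).
Proof. by rewrite /ffactC big_ord_recr. Qed.

(** The next factor is absorbed through w * w^(l) = w^(l+1) + l w^(l), where w^(l)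
    is the falling factorial. *)
Lemma newton_expand (R : realType) (a : R) (m : nat) (w : R[i]) :
  (\prod_(i < m) (i.+1%:R - a%:C%C * (w + 1))) / m`!%:R =
  \sum_(l < m.+1) (newton a m l)%:C%C * ffactC w l.
Proof.
elim: m => [|m IH].
  by rewrite big_ord0 big_ord1 /ffactC big_ord0 divr1 mulr1.
rewrite big_ord_recr/= factS natrM invfM [X in _ * X]mulrC mulrACA IH big_distrl/=.
rewrite [RHS](eq_bigr (fun l : 'I_m.+2 =>
  ((m.+1%:R - a - a * l%:R) / m.+1%:R * newton a m l)%:C%C * ffactC w l -
  (a / m.+1%:R * (if (l : nat) is l'.+1 then newton a m l' else 0))%:C%C * ffactC w l)); last first.
  move=> l _; rewrite -mulrBl -rmorphB/=; congr (_%:C%C * _); ring.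
rewrite sumrB [X in _ = X - _]big_ord_recr/= newton_gt// mulr0 mul0r addr0.
rewrite [X in _ = _ - X]big_ord_recl/= mulr0 mul0r add0r -sumrB.
apply: eq_bigr => l _; rewrite ffactCS.
rewrite !rmorphM !rmorphB !rmorphM/= fmorphV !rmorph_nat.
by ring.
Qed.

(** * The Fox function as a real integral *)

Lemma measurable_fun_sumR (R : realType) (D : set R) (k : nat) (F : nat -> R -> R) :
  (forall l, measurable_fun D (F l)) -> measurable_fun D (fun t => \sum_(l < k) F l t).
Proof.
move=> mF; elim: k => [|k IH].
  by under eq_fun do rewrite big_ord0; exact: measurable_cst.
by under eq_fun do rewrite big_ord_recr/=; exact: measurable_funD.
Qed.

Lemma cont_sumR (R : realType) (x : R) (k : nat) (F : nat -> R -> R) :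
  (forall l, {for x, continuous (F l)}) ->
  {for x, continuous (fun t => \sum_(l < k) F l t)}.
Proof.
move=> cF; elim: k => [|k IH].
  rewrite (_ : (fun t => _) = cst 0); first exact: cvg_cst.
  by apply/funext => t; rewrite big_ord0.
rewrite (_ : (fun t => _) = (fun t => \sum_(l < k) F l t + F k t)); first exact: contD.
by apply/funext => t; rewrite big_ord_recr.
Qed.

Lemma integrable_sumR (R : realType) (D : set R) (k : nat) (F : nat -> R -> R) :
  measurable D -> (forall l, (leb R).-integrable D (EFin \o F l)) ->
  (leb R).-integrable D (EFin \o (fun t => \sum_(l < k) F l t)).
Proof.
move=> mD iF; elim: k => [|k IH].
  rewrite (_ : _ \o _ = cst 0%E); first exact: integrable0.
  by apply/funext => t; rewrite /= big_ord0.
rewrite (_ : _ \o _ = (fun t => (\sum_(l < k) F l t + F k t)%:E)).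
  exact: integrableD_EFin.
by apply/funext => t; rewrite /= big_ord_recr.
Qed.

Lemma Rintegral_sum (R : realType) (D : set R) (k : nat) (F : nat -> R -> R) :
  measurable D -> (forall l, (leb R).-integrable D (EFin \o F l)) ->
  \int[leb R]_(t in D) (\sum_(l < k) F l t) = \sum_(l < k) \int[leb R]_(t in D) F l t.
Proof.
move=> mD iF; elim: k => [|k IH].
  rewrite big_ord0 (_ : (fun t => _) = cst 0) ?Rintegral_cst ?mul0r//.
  by apply/funext => t; rewrite big_ord0.
rewrite big_ord_recr/= -IH -RintegralD//; last exact: integrable_sumR.
by apply: eq_Rintegral => t _; rewrite big_ord_recr.
Qed.

(** The polynomial Q for which [t^(m)] exp (- y (1 - t)^a) (1 - t)^(a - 1) is
    exp (- y) Q y. *)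
Definition wright_poly (R : realType) (a : R) (m : nat) (t : R) : R :=
  \sum_(l < m.+1) newton a m l * (- t) ^+ l.

Lemma wright_poly_cont (R : realType) (a : R) (m : nat) (x : R) :
  {for x, continuous (wright_poly a m)}.
Proof.
apply: (@cont_sumR R x m.+1 (fun l t => newton a m l * (- t) ^+ l)) => l.
apply: contM; first exact: cvg_cst.
apply: (@cont_comp _ (fun t => - t) (fun t => t ^+ l)); last exact: exprn_continuous.
by apply: contN; exact: cvg_id.
Qed.

Lemma wright_poly_measurable (R : realType) (a : R) (m : nat) :
  measurable_fun setT (wright_poly a m).
Proof. by apply: continuous_measurable_fun => x; exact: wright_poly_cont. Qed.

(** The density whose Mellin transform at s = c + i y is Gamma (1 + s) times the
    ratio Gamma (m + 1 + a s) / (m! Gamma (1 + a s)), a polynomial in s. *)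
Definition wright_weight (R : realType) (a : R) (m : nat) (c t : R) : R :=
  gamma_weight (c + 1) t * wright_poly a m t.

Lemma gamma_weight_pow (R : realType) (s t : R) (l : nat) : 0 < t ->
  gamma_weight s t * t ^+ l = gamma_weight (s + l%:R) t.
Proof.
move=> t0; elim: l => [|l IH]; first by rewrite expr0 mulr1 addr0.
by rewrite exprSr mulrA IH -natr1 addrA gamma_weightS// mulrC.
Qed.

Lemma wright_weightE (R : realType) (a : R) (m : nat) (c t : R) : 0 < t ->
  wright_weight a m c t =
  \sum_(l < m.+1) (newton a m l * (- 1) ^+ l) * gamma_weight (c + 1 + l%:R) t.
Proof.
move=> t0; rewrite /wright_weight /wright_poly mulr_sumr; apply: eq_bigr => l _.
by rewrite -gamma_weight_pow// [(- t) ^+ l]exprNn; ring.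
Qed.

Lemma wright_weight_measurable (R : realType) (a : R) (m : nat) (c : R) :
  measurable_fun setT (wright_weight a m c).
Proof.
by apply: measurable_funM; [exact: gamma_weight_measurable|exact: wright_poly_measurable].
Qed.

Lemma wright_weight_integrable (R : realType) (a : R) (m : nat) (c : R) : -1 < c ->
  (leb R).-integrable `]0, +oo[ (EFin \o wright_weight a m c).
Proof.
move=> c1.
have : (leb R).-integrable (Rpos R) (EFin \o (fun t => \sum_(l < m.+1)
    (newton a m l * (- 1) ^+ l) * gamma_weight (c + 1 + l%:R) t)).
  apply: (@integrable_sumR _ _ m.+1 (fun l t =>
    (newton a m l * (- 1) ^+ l) * gamma_weight (c + 1 + l%:R) t)) => // l.
  apply: integrable_scaled => //; apply: gamma_weight_integrable.
  by rewrite ltr_wpDr// -ltrBlDr sub0r.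
apply: eq_integrable => // t; rewrite inE/= in_itv/= andbT => t0.
by rewrite wright_weightE.
Qed.

Lemma cintegrable_mellin (R : realType) (q : R -> R) (y : R) :
  measurable_fun setT q -> (leb R).-integrable `]0, +oo[ (EFin \o q) ->
  cintegrable (Rpos R) (fun t => (q t)%:C%C * cis (y * ln t)).
Proof.
move=> mq iq; split.
- rewrite (_ : (fun t => _) = (fun t => (q t * cos (y * ln t))%:E)).
    by apply: integrable_trig => //; [exact: continuous_cos|exact: cos_max].
  by apply/funext => t; rewrite ReCM /= mul0r subr0.
- rewrite (_ : (fun t => _) = (fun t => (q t * sin (y * ln t))%:E)).
    by apply: integrable_trig => //; [exact: continuous_sin|exact: sin_max].
  by apply/funext => t; rewrite ImCM /= mul0r addr0.
Qed.

Lemma mellin_gamma_rising (R : realType) (s y : R) (l : nat) : 0 < s ->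
  mellin (gamma_weight (s + l%:R)) y =
  mellin (gamma_weight s) y * \prod_(i < l) ((s +i* y)%C + i%:R).
Proof.
move=> s0; elim: l => [|l IH]; first by rewrite big_ord0 mulr1 addr0.
rewrite big_ord_recr/= mulrA -IH -natr1 addrA mellin_gammaS ?ltr_wpDr// mulrC.
by congr (_ * _); rewrite natC; apply: eq_complexP => /=; rewrite ?addr0.
Qed.

(** Multiplying the density by t^l raises the argument of Gamma by l; the rising
    factorials so produced at s + 1 are, up to sign, falling factorials at
    w = - (s + 1), and newton_expand recombines them into the product. *)
Lemma mellin_wright_weight (R : realType) (a : R) (m : nat) (c y : R) : -1 < c ->
  mellin (wright_weight a m c) y = mellin (gamma_weight (c + 1)) y *
  ((\prod_(i < m) (i.+1%:R + a%:C%C * (c +i* y)%C)) / m`!%:R).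
Proof.
move=> c1; have c0 : 0 < c + 1 by rewrite -ltrBlDr sub0r.
have mpos : measurable (Rpos R) by [].
pose f (l : 'I_m.+1) t := (newton a m l * (- 1) ^+ l)%:C%C *
  ((gamma_weight (c + 1 + l%:R) t)%:C%C * cis (y * ln t)).
have if_ l : cintegrable (Rpos R) (f l).
  apply: cintegrableZ => //; apply: cintegrable_mellin.
    exact: gamma_weight_measurable.
  by apply: gamma_weight_integrable; rewrite ltr_wpDr.
rewrite [LHS](@eq_cintegral _ _ _ (fun t => \sum_(l < m.+1) f l t)); last first.
  move=> t; rewrite /= in_itv/= andbT => t0.
  rewrite wright_weightE// rmorph_sum/= mulr_suml; apply: eq_bigr => l _.
  by rewrite rmorphM -mulrA.
rewrite (cintegral_sum _ mpos if_).2.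
have -> : \prod_(i < m) (i.+1%:R + a%:C%C * (c +i* y)%C) =
    \prod_(i < m) (i.+1%:R - a%:C%C * (- ((c +i* y)%C + 1) + 1)).
  by apply: eq_bigr => i _; ring.
rewrite newton_expand mulr_sumr; apply: eq_bigr => l _.
rewrite cintegralZ//; last first.
  apply: cintegrable_mellin; first exact: gamma_weight_measurable.
  by apply: gamma_weight_integrable; rewrite ltr_wpDr.
rewrite -/(mellin _ y) mellin_gamma_rising//.
have -> : ffactC (- ((c +i* y)%C + 1)) l =
    ((- 1) ^+ l)%:C%C * \prod_(i < l) (((c + 1) +i* y)%C + i%:R).
  rewrite rmorphXn/= (_ : _ ^+ l = \prod_(i < l) (- 1 : R)%:C%C); last first.
    by rewrite prodr_const card_ord.
  rewrite -big_split/=.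
  apply: eq_bigr => i _; rewrite rmorphN rmorph1 mulN1r -opprD; congr (- (_ + _)).
  by apply: eq_complexP => /=; rewrite ?addr0.
by rewrite rmorphM/=; ring.
Qed.

(** Fubini: pairing A with a Mellin transform moves the transform onto A. *)
Lemma mellin_parseval (R : realType) (A : R -> R[i]) (B q : R -> R) :
  measurable_fun setT (fun y => complex.Re (A y)) ->
  measurable_fun setT (fun y => complex.Im (A y)) ->
  (leb R).-integrable setT (EFin \o B) ->
  (forall y, `|complex.Re (A y)| <= B y) ->
  (forall y, `|complex.Im (A y)| <= B y) ->
  measurable_fun setT q -> (leb R).-integrable `]0, +oo[ (EFin \o q) ->
  cintegrable setT (fun y => A y * mellin q y) /\
  cintegral setT (fun y => A y * mellin q y) =
  cintegral (Rpos R) (fun t => (q t)%:C%C * cintegral setT (fun y => A y * cis (y * ln t))).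
Proof.
move=> mA1 mA2 iB A1B A2B mq iq.
have mpos : measurable (Rpos R) by [].
have mz1 : measurable_fun setT (fun z : R * R => z.1) by exact: measurable_fst.
have mz2 : measurable_fun setT (fun z : R * R => z.2) by exact: measurable_snd.
have i2B := integrable_scaled 2 (@measurableT _ R) iB.
have UB (U c : R -> R) : (forall y, `|U y| <= B y) -> (forall x, `|c x| <= 1) ->
    forall y s, `|U y * c s| <= B y.
  by move=> h hc y s; rewrite normrM -[B y]mulr1 ler_pM.
have iUc (U c : R -> R) t : measurable_fun setT U -> (forall y, `|U y| <= B y) ->
    continuous c -> (forall x, `|c x| <= 1) ->
    (leb R).-integrable setT (EFin \o (fun y => U y * c (y * ln t))).
  move=> mU hU cc hc; apply: (integrable_le _ _ _ iB) => //.
    apply: measurable_funM => //; apply: measurableT_comp.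
      exact: continuous_measurable_fun.
    exact: measurable_funM.
  by move=> y _; exact: UB.
have key (U V : R -> R) : measurable_fun setT U -> measurable_fun setT V ->
    (forall y, `|U y| <= B y) -> (forall y, `|V y| <= B y) ->
    (leb R).-integrable setT (fun y => (U y * complex.Re (mellin q y) +
      V y * complex.Im (mellin q y))%:E) /\
    \int[leb R]_y (U y * complex.Re (mellin q y) + V y * complex.Im (mellin q y)) =
    \int[leb R]_(t in `]0, +oo[) (q t * (\int[leb R]_y (U y * cos (y * ln t)) +
       \int[leb R]_y (V y * sin (y * ln t)))).
  move=> mU mV hU hV.
  pose f (z : R * R) := q z.2 * (U z.1 * cos (z.1 * ln z.2) + V z.1 * sin (z.1 * ln z.2)).
  have mf : measurable_fun setT f.
    have ml : measurable_fun setT (fun z : R * R => z.1 * ln z.2).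
      by apply: measurable_funM => //; exact: (measurableT_comp (@measurable_ln R)).
    apply: measurable_funM; first exact: measurableT_comp.
    apply: measurable_funD; apply: measurable_funM.
    - exact: measurableT_comp.
    - by apply: measurableT_comp ml; exact: (continuous_measurable_fun (@continuous_cos R)).
    - exact: measurableT_comp.
    - by apply: measurableT_comp ml; exact: (continuous_measurable_fun (@continuous_sin R)).
  have bf (y t : R) : setT y -> Rpos R t -> `|f (y, t)| <= 2 * B y * `|q t|.
    move=> _ _; rewrite /f normrM mulrC ler_wpM2r// (le_trans (ler_normD _ _))//.
    rewrite mulr_natl mulr2n lerD//.
    + exact: (UB U (@cos R) hU (@cos_max R)).
    + exact: (UB V (@sin R) hV (@sin_max R)).
  have [h1 h2] := Fubini_real measurableT mpos mf i2B (integrable_norm iq) bf.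
  have E y : \int[leb R]_(t in `]0, +oo[) f (y, t) =
      U y * complex.Re (mellin q y) + V y * complex.Im (mellin q y).
    have ic := integrable_trig y mq iq (@continuous_cos R) (@cos_max R).
    have is' := integrable_trig y mq iq (@continuous_sin R) (@sin_max R).
    transitivity (\int[leb R]_(t in `]0, +oo[)
        (U y * (q t * cos (y * ln t)) + V y * (q t * sin (y * ln t)))).
      by apply: eq_Rintegral => t _; rewrite /f/=; ring.
    rewrite (RintD mpos (integrable_scaled (U y) mpos ic)
      (integrable_scaled (V y) mpos is')).
    by rewrite (RintZ (U y) mpos ic) (RintZ (V y) mpos is') mellinE.
  split; first by move: h1; under eq_fun do rewrite E.
  move: h2; under eq_Rintegral do rewrite E; move=> ->.
  apply: eq_Rintegral => t _; rewrite -RintegralD//; last 2 first.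
  - exact: (iUc U (@cos R) t mU hU (@continuous_cos R) (@cos_max R)).
  - exact: (iUc V (@sin R) t mV hV (@continuous_sin R) (@sin_max R)).
  rewrite -RintegralZl//; apply: integrableD_EFin => //.
  - exact: (iUc U (@cos R) t mU hU (@continuous_cos R) (@cos_max R)).
  - exact: (iUc V (@sin R) t mV hV (@continuous_sin R) (@sin_max R)).
have mN : measurable_fun setT (fun y => - complex.Im (A y)) by exact: measurableT_comp.
have hN y : `|- complex.Im (A y)| <= B y by rewrite normrN.
have [k1 k2] := key _ _ mA1 mN A1B hN.
have [k3 k4] := key _ _ mA2 mA1 A2B A1B.
have eR y : complex.Re (A y * mellin q y) =
    complex.Re (A y) * complex.Re (mellin q y) + - complex.Im (A y) * complex.Im (mellin q y).
  by rewrite ReCM mulNr.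
have eI y : complex.Im (A y * mellin q y) =
    complex.Im (A y) * complex.Re (mellin q y) + complex.Re (A y) * complex.Im (mellin q y).
  by rewrite ImCM addrC.
split; first by split; [under eq_fun do rewrite eR|under eq_fun do rewrite eI].
apply: eq_complexP.
- transitivity (\int[leb R]_y (complex.Re (A y) * complex.Re (mellin q y) +
      - complex.Im (A y) * complex.Im (mellin q y))).
    by apply: eq_Rintegral => y _; exact: eR.
  rewrite k2 /=; apply: eq_Rintegral => t _.
  rewrite mul0r subr0; congr (_ * _).
  rewrite -RintD; [|exact: measurableT| |].
  + by apply: eq_Rintegral => y _; rewrite ReCM /= mulNr.
  + exact: (iUc _ (@cos R) t mA1 A1B (@continuous_cos R) (@cos_max R)).
  + exact: (iUc _ (@sin R) t mN hN (@continuous_sin R) (@sin_max R)).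
- transitivity (\int[leb R]_y (complex.Im (A y) * complex.Re (mellin q y) +
      complex.Re (A y) * complex.Im (mellin q y))).
    by apply: eq_Rintegral => y _; exact: eI.
  rewrite k4 /=; apply: eq_Rintegral => t _.
  rewrite mul0r addr0; congr (_ * _).
  rewrite -RintD; [|exact: measurableT| |].
  + by apply: eq_Rintegral => y _; rewrite ImCM /= addrC.
  + exact: (iUc _ (@cos R) t mA2 A2B (@continuous_cos R) (@cos_max R)).
  + exact: (iUc _ (@sin R) t mA1 A1B (@continuous_sin R) (@sin_max R)).
Qed.

Local Open Scope complex_scope.

Lemma Gamma_rising (R : realType) (w : R[i]) (m : nat) : 0 < complex.Re w ->
  Gamma (w + m%:R) = Gamma w * \prod_(i < m) (w + i%:R).
Proof.
move=> w0; elim: m => [|m IH]; first by rewrite big_ord0 addr0 mulr1.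
rewrite -natr1 addrA GammaS.
  by rewrite IH big_ord_recr/= mulrC mulrA.
by rewrite natC; case: w w0 {IH} => u v /= u0; rewrite ltr_wpDr.
Qed.

Lemma cintegral_real (R : realType) (D : set R) (f : R -> R) : measurable D ->
  cintegral D (fun t => (f t)%:C) = (\int[leb R]_(t in D) f t)%:C.
Proof.
by move=> mD; apply: eq_complexP => //=; rewrite Rintegral_cst ?mul0r.
Qed.

(** Its integral over t > 0, times m!, is the value of the Fox function
    (is_foxH_wright). *)
Definition fox_density (R : realType) (al : R) (m : nat) (a z t : R) : R :=
  expR (a * (ln z - ln t) - t - z / t) * wright_poly al m t.

Lemma fox_densityE (R : realType) (al : R) (m : nat) (a z t : R) : 0 < t ->
  fox_density al m a z t =
  \sum_(l < m.+1) (newton al m l * (- 1) ^+ l * expR (a * ln z)) *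
    expR ((l%:R - a) * ln t - 1 * t - z / t).
Proof.
move=> t0; rewrite /fox_density /wright_poly mulr_sumr; apply: eq_bigr => l _.
have tl : t ^+ l = expR (l%:R * ln t) by rewrite expRM_natl expR_ln.
rewrite [(- t) ^+ l]exprNn tl.
have -> : a * (ln z - ln t) - t - z / t =
   a * ln z + ((l%:R - a) * ln t - 1 * t - z / t) - l%:R * ln t by ring.
rewrite expRB expRD; field; exact: lt0r_neq0 (expR_gt0 _).
Qed.

Lemma fox_density_integrable (R : realType) (al : R) (m : nat) (a z : R) : 0 < z ->
  (leb R).-integrable `]0, +oo[ (EFin \o fox_density al m a z).
Proof.
move=> z0.
have : (leb R).-integrable (Rpos R) (EFin \o (fun t => \sum_(l < m.+1)
    (newton al m l * (- 1) ^+ l * expR (a * ln z)) *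
    expR ((l%:R - a) * ln t - 1 * t - z / t))).
  apply: (@integrable_sumR _ _ m.+1 (fun l t =>
    (newton al m l * (- 1) ^+ l * expR (a * ln z)) *
    expR ((l%:R - a) * ln t - 1 * t - z / t))) => // l.
  by apply: integrable_scaled => //; exact: integrable_pow_exp_inv.
apply: eq_integrable => // t; rewrite inE/= in_itv/= andbT => t0.
by rewrite fox_densityE.
Qed.

Local Notation wright_foxH al m a z := (foxH_integrand 3 0 [:: (1, al)]
  [:: (m.+1%:R, al); (a%:C, 1); (1, 1)] z%:C).

(** The quotient Gamma (m + 1 + al s) / Gamma (1 + al s) is a product of m linear
    factors because Gamma (1 + al s) is not 0, and the rest is a product of two
    Mellin transforms. *)
Lemma foxH_integrandE (R : realType) (al : R) (m : nat) (a z c y : R) :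
  0 < al < 1 -> 0 < z -> -1 < c -> - a < c ->
  wright_foxH al m a z (c +i* y) =
  (m`!%:R * expR (- (c * ln z)))%:C *
  (mellin (gamma_weight (a + c)) y * cis (- (y * ln z)) *
   mellin (wright_weight al m c) y).
Proof.
move=> /andP[al0 al1] z0 c1 ca.
have c0 : 0 < c + 1 by rewrite -ltrBlDr sub0r.
have ac0 : 0 < a + c by rewrite -ltrBlDl sub0r.
rewrite /foxH_integrand /= !big_cons !big_nil !mulr1.
set s := (c +i* y).
have e1 : m.+1%:R + al%:C * s = (1 + al%:C * s) + m%:R.
  by rewrite -nat1r addrAC.
have re1 : 0 < complex.Re (1 + al%:C * s).
  rewrite /s /= mul0r subr0; nra.
have e2 : a%:C + 1%:C * s = ((a + c) +i* y).
  by rewrite rmorph1 mul1r /s; apply: eq_complexP => /=; rewrite ?add0r.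
have e3 : 1 + 1%:C * s = ((c + 1) +i* y).
  by rewrite rmorph1 mul1r /s; apply: eq_complexP => /=; rewrite ?add0r// addrC.
rewrite e1 e2 e3 (Gamma_mellin y ac0) (Gamma_mellin y c0) Gamma_rising//.
have -> : - s = (- c) +i* (- y) by [].
rewrite cpow_real// mellin_wright_weight// !mulNr.
have G0 := Gamma_neq0 re1.
have -> : \prod_(i < m) (1 + al%:C * s + i%:R) = \prod_(i < m) (i.+1%:R + al%:C * s).
  by apply: eq_bigr => i _; rewrite -nat1r addrAC.
have f0 : m`!%:R != 0 :> R[i] by rewrite pnatr_eq0 -lt0n fact_gt0.
rewrite rmorphM/= rmorph_nat.
move: (Gamma _) G0 (mellin _ y) (mellin (gamma_weight (c + 1)) y) (\prod_(i < m) _)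
  (cis _) (expR _)%:C m`!%:R f0 => G G0 M1 M2 P C0 E F F0.
by field; rewrite G0 F0.
Qed.

(** Parseval moves one Mellin transform onto the other factor, which Cahen-Mellin
    inverts to an exponential; the abscissa c then cancels. *)
Lemma foxH_line (R : realType) (al : R) (m : nat) (a z c : R) :
  0 < al < 1 -> 0 < z -> -1 < c -> - a < c ->
  cintegrable setT (fun y => wright_foxH al m a z (c +i* y)) /\
  cintegral setT (fun y => wright_foxH al m a z (c +i* y)) =
  (2 * pi * (m`!%:R * \int[leb R]_(t in `]0, +oo[) fox_density al m a z t))%:C.
Proof.
move=> al01 z0 c1 ca; have ac0 : 0 < a + c by rewrite -ltrBlDl sub0r.
have [C hC] := mellin_gamma_decay ac0.
pose A y := mellin (gamma_weight (a + c)) y * cis (- (y * ln z)).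
pose B y := 2 * (C * (1 + y ^+ 2)^-1).
pose q := wright_weight al m c.
pose K := m`!%:R * expR (- (c * ln z)).
have mg := gamma_weight_measurable (a + c).
have ig := gamma_weight_integrable ac0.
have AE : A = (fun y => (\int[leb R]_(t in `]0, +oo[) (gamma_weight (a + c) t * cos (y * (ln t - ln z))))
   +i* (\int[leb R]_(t in `]0, +oo[) (gamma_weight (a + c) t * sin (y * (ln t - ln z))))).
  by apply/funext => y; rewrite /A mellin_cis.
have mA1 : measurable_fun setT (fun y => complex.Re (A y)).
  rewrite AE /=.
  exact: (trig_transform_Fubini (ln z) mg ig (@continuous_cos R) (@cos_max R)).1.
have mA2 : measurable_fun setT (fun y => complex.Im (A y)).
  rewrite AE /=.
  exact: (trig_transform_Fubini (ln z) mg ig (@continuous_sin R) (@sin_max R)).1.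
have iB : (leb R).-integrable setT (EFin \o B).
  apply: integrable_scaled => //; apply: integrable_scaled => //.
  exact: integrable_oneDsqrV.
have bA y := le_Re_Im_cis (- (y * ln z)) (hC y).1 (hC y).2.
have [h1 h2] := mellin_parseval mA1 mA2 iB (fun y => (bA y).1) (fun y => (bA y).2)
  (wright_weight_measurable al m c) (wright_weight_integrable al m c1).
have E y : wright_foxH al m a z (c +i* y) = K%:C * (A y * mellin q y).
  exact: foxH_integrandE.
rewrite (funext E); split; first exact: (cintegrableZ _ (@measurableT _ _) h1).
rewrite (cintegralZ _ (@measurableT _ _) h1) h2.
have -> : cintegral (Rpos R) (fun t => (q t)%:C *
    cintegral setT (fun y => A y * cis (y * ln t))) =
    cintegral (Rpos R) (fun t => (2 * pi * expR (c * ln z) * fox_density al m a z t)%:C).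
  apply: eq_cintegral => t; rewrite /= in_itv/= andbT => t0.
  rewrite (@eq_cintegral _ _ _ (fun y => mellin (gamma_weight (a + c)) y *
    cis (- (y * (ln z - ln t))))); last first.
    by move=> y _; rewrite /A -mulrA -cisD; congr (_ * cis _); ring.
  rewrite (Cahen_Mellin _ ac0) -rCM; apply: (congr1 (real_complex R)).
  have ez : expR (ln z - ln t) = z / t.
    by rewrite (expRB (ln z) (ln t)) (expR_ln z0) (expR_ln t0).
  rewrite ez /q /wright_weight /fox_density.
  have -> : expR (c * ln z) = (expR (a * (ln z - ln t) - t - z / t))^-1 *
     (gamma_weight (c + 1) t * expR ((a + c) * (ln z - ln t) - z / t)).
    rewrite -expRN /gamma_weight -!expRD; congr expR; ring.
  move: (lt0r_neq0 (expR_gt0 (a * (ln z - ln t) - t - z / t))) => h0.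
  by field.
have mpos : measurable (Rpos R) by [].
rewrite (cintegral_real _ mpos) (RintZ _ mpos (fox_density_integrable al m a z0)).
rewrite -rCM; apply: (congr1 (real_complex R)); rewrite /K.
have -> : expR (c * ln z) = (expR (- (c * ln z)))^-1 by rewrite expRN invrK.
move: (lt0r_neq0 (expR_gt0 (- (c * ln z)))) => h0.
by field.
Qed.

(** The separating lines are exactly those with c > -1 and c > - a. *)
Lemma is_foxH_wright (R : realType) (al : R) (m : nat) (a z : R) :
  0 < al < 1 -> 0 < z -> 0 < a ->
  is_foxH 3 0 [:: (1, al)] [:: (m.+1%:R, al); (a%:C, 1); (1, 1)] z%:C
    (m`!%:R * \int[leb R]_(t in `]0, +oo[) fox_density al m a z t)%:C.
Proof.
move=> al01 z0 a0; have /andP[al0 al1] := al01.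
have al0C : al%:C = al +i* 0 by [].
split=> //.
- move=> u; rewrite !inE => /or4P[] /eqP-> //=.
- exists 0; split; last by move=> u; rewrite take0.
  have pos (p q : R) : 0 < p -> 0 < q -> complex.Re (- p%:C / q%:C) < 0.
    move=> p0 q0; rewrite -fmorphV -rmorphN -rmorphM/= mulNr oppr_lt0.
    by rewrite divr_gt0.
  move=> u; rewrite /= !inE => /or3P[] /eqP-> k /=.
  + by rewrite (natC R m.+1) (natC R k) -rmorphD; apply: pos => //; rewrite ltr_wpDr.
  + by rewrite (natC R k) -rmorphD; apply: pos => //; rewrite ltr_wpDr.
  + by rewrite (natC R k) -(rmorph1 (real_complex R)) -rmorphD; apply: pos => //; rewrite ltr_wpDr.
- move=> c [sep _].
  have re1 (u : R[i]) : complex.Re (- (u + 0%:R) / 1%:C) = - complex.Re u.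
    by rewrite addr0 (rmorph1 (real_complex R)) divr1; case: u.
  have c1 : -1 < c.
    have : complex.Re (- (1 + 0%:R) / 1%:C) < c :> R.
      by apply: (sep (1, 1)); rewrite /= !inE eqxx !orbT.
    by rewrite re1.
  have ca : - a < c.
    have : complex.Re (- (a%:C + 0%:R) / 1%:C) < c.
      by apply: (sep (a%:C, 1)); rewrite /= !inE eqxx !orbT.
    by rewrite re1.
  have [h1 h2] := foxH_line m al01 z0 c1 ca.
  split=> //.
  rewrite (@eq_cintegral _ _ _ (fun y => 'i * wright_foxH al m a z (c +i* y))); last first.
    by move=> y _; rewrite mulrC.
  rewrite (cintegralZ _ (@measurableT _ _) h1) h2 (rCM (2 * pi)) -(mulr_natl pi 2).
  have i0 := i_neq0 R.
  have p0 : (2 * pi)%:C != 0 :> R[i].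
    by rewrite (_ : 0 = 0%:C)// (inj_eq (@complexI _)) mulf_neq0// gt_eqF// pi_gt0.
  move: (_ * \int[_]_(t in _) _)%:C (2 * pi)%:C p0 => X P P0.
  by rewrite mulrA ['i * P]mulrC mulKf// mulf_neq0.
Qed.

(** * Principal powers along curves in the right half-plane *)

Definition curve_derive (R : realType) (f : R -> R[i]) (t : R) (d : R[i]) : Prop :=
  is_derive t 1 (fun s => complex.Re (f s)) (complex.Re d) /\
  is_derive t 1 (fun s => complex.Im (f s)) (complex.Im d).

Lemma curve_derive_eq (R : realType) (f : R -> R[i]) (t : R) (d d' : R[i]) :
  d = d' -> curve_derive f t d -> curve_derive f t d'.
Proof. by move=> ->. Qed.

Lemma curve_derive_ext (R : realType) (f g : R -> R[i]) (t : R) (d : R[i]) :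
  f =1 g -> curve_derive f t d -> curve_derive g t d.
Proof. by move=> /funext ->. Qed.

Lemma curve_deriveM (R : realType) (f g : R -> R[i]) (t : R) (a b : R[i]) :
  curve_derive f t a -> curve_derive g t b ->
  curve_derive (fun s => f s * g s) t (a * g t + f t * b).
Proof.
move=> [f1 f2] [g1 g2]; split.
- under eq_fun do rewrite ReCM.
  have := derD (derM f1 g1) (derN (derM f2 g2)).
  by move/is_derive_eq; apply; rewrite ReCD !ReCM; ring.
- under eq_fun do rewrite ImCM.
  have := derD (derM f1 g2) (derM f2 g1).
  by move/is_derive_eq; apply; rewrite ImCD !ImCM; ring.
Qed.

Lemma curve_derive_cst (R : realType) (c : R[i]) (t : R) :
  curve_derive (fun _ => c) t 0.
Proof. by split; exact: der_cst. Qed.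

Lemma curve_deriveZ (R : realType) (c : R[i]) (f : R -> R[i]) (t : R) (a : R[i]) :
  curve_derive f t a -> curve_derive (fun s => c * f s) t (c * a).
Proof.
move=> fa; have := curve_deriveM (curve_derive_cst c t) fa.
by apply: curve_derive_eq; rewrite mul0r add0r.
Qed.

Lemma curve_derive_cis (R : realType) (k t : R) :
  curve_derive (fun s => cis (k * s)) t (k%:C * 'i * cis (k * t)).
Proof.
have dk : is_derive t 1 (fun s : R => k * s) k.
  have : is_derive t 1 (fun s : R => k * s) (k * 1 + t * 0) by der.
  by move/is_derive_eq; apply; ring.
split.
- have := der_cos dk.
  by move/is_derive_eq; apply; rewrite !ReCM !ImCM /=; ring.
- have := der_sin dk.
  by move/is_derive_eq; apply; rewrite ImCM !ReCM !ImCM /=; ring.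
Qed.

Lemma curve_derive_cont (R : realType) (f : R -> R[i]) (t : R) (d : R[i]) :
  curve_derive f t d ->
  {for t, continuous (fun s => complex.Re (f s))} /\
  {for t, continuous (fun s => complex.Im (f s))}.
Proof. by move=> [f1 f2]; split; [exact: der_continuous f1|exact: der_continuous f2]. Qed.

Definition arg_right (R : realType) (z : R[i]) : R :=
  atan (complex.Im z / complex.Re z).

Lemma normsq_gt0 (R : realType) (z : R[i]) : 0 < complex.Re z -> 0 < normsq z.
Proof. by move=> z0; rewrite /normsq ltr_wpDr ?sqr_ge0// exprn_gt0. Qed.

Lemma atan_ge0 (R : realType) (v : R) : 0 <= v -> 0 <= atan v.
Proof. by move=> v0; rewrite -[leLHS](@atan0 R) le_atan. Qed.

(** On the right half-plane the principal argument is atan (Im / Re), which is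
    differentiable without case distinction. *)
Lemma clog_right (R : realType) (z : R[i]) : 0 < complex.Re z ->
  clog z = (ln (normsq z) / 2) +i* arg_right z.
Proof.
case: z => x y /= x0; have N0 : 0 < x ^+ 2 + y ^+ 2 by exact: (@normsq_gt0 _ (x +i* y)).
have c0 : 0 < cabs (x +i* y) by rewrite /cabs sqrtr_gt0.
have cE : cabs (x +i* y) = x * Num.sqrt (1 + (y / x) ^+ 2).
  rewrite /cabs /= -{2}(gtr0_norm x0) -sqrtr_sqr -sqrtrM ?sqr_ge0//; congr Num.sqrt.
  by field; rewrite gt_eqF.
have s0 : 0 < Num.sqrt (1 + (y / x) ^+ 2).
  by rewrite sqrtr_gt0 ltr_wpDr ?sqr_ge0.
have q : x / cabs (x +i* y) = cos (atan (y / x)).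
  by rewrite cos_atan cE; field; rewrite !gt_eqF.
have pi2 : pi / 2 <= pi :> R by rewrite ler_pdivrMr// ler_pMr ?pi_gt0// ler1n.
apply: eq_complexP => /=.
- have -> : normsq (x +i* y) = cabs (x +i* y) ^+ 2.
    by rewrite /cabs sqr_sqrtr//= ltW.
  by rewrite lnXn// mulr2n; field.
- rewrite /carg /= q /arg_right /=; case: ifPn => y0.
    rewrite cosK// in_itv/=; apply/andP; split.
      by apply: atan_ge0; rewrite divr_ge0// ltW.
    by rewrite (le_trans _ pi2)// ltW// atan_ltpi2.
  rewrite -cosN cosK ?opprK// in_itv/= -atanN; apply/andP; split.
    apply: atan_ge0; rewrite -mulNr divr_ge0 ?(ltW x0)//.
    by rewrite oppr_ge0 ltW// ltNge.
  by rewrite (le_trans _ pi2)// ltW// atan_ltpi2.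
Qed.

Lemma cpow_right (R : realType) (z : R[i]) (g : R) : 0 < complex.Re z ->
  cpow z g%:C = (expR (g * (ln (normsq z) / 2)))%:C * cis (g * arg_right z).
Proof.
move=> z0; rewrite /cpow clog_right// -cexpE; congr cexp.
by apply: eq_complexP; rewrite ?ReCM ?ImCM /= mul0r ?subr0 ?addr0.
Qed.

Lemma cpowD (R : realType) (z w1 w2 : R[i]) : cpow z (w1 + w2) = cpow z w1 * cpow z w2.
Proof.
rewrite /cpow mulrDl; case: (w1 * _) => a b; case: (w2 * _) => c d.
by rewrite -[X in cexp X]/((a + c) +i* (b + d)) !cexpE expRD cisD rCM mulrACA.
Qed.

Lemma cpow0 (R : realType) (z : R[i]) : cpow z 0%:C = 1.
Proof.
rewrite /cpow (rmorph0 (real_complex R)) mul0r (cexpE 0 0) expR0.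
by apply: eq_complexP; rewrite ?ReCM ?ImCM /= ?cos0 ?sin0 ?mul0r ?mulr0 ?subr0 ?addr0 ?mulr1.
Qed.

Lemma cpow_neq0 (R : realType) (z w : R[i]) : cpow z w != 0.
Proof.
have : cpow z w * cpow z (- w) = 1 by rewrite -cpowD subrr -(rmorph0 (real_complex R)) cpow0.
by move=> h; apply/negP => /eqP h0; move: h; rewrite h0 mul0r => /esym/eqP; rewrite oner_eq0.
Qed.

Lemma cpow1 (R : realType) (z : R[i]) : 0 < complex.Re z -> cpow z 1%:C = z.
Proof.
case: z => x y /= x0; have N0 : 0 < x ^+ 2 + y ^+ 2 by exact: (@normsq_gt0 _ (x +i* y)).
rewrite cpow_right// !mul1r.
pose r := expR (ln (normsq (x +i* y)) / 2).
have r0 : 0 < r by exact: expR_gt0.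
have r2 : r ^+ 2 = x ^+ 2 + y ^+ 2.
  by rewrite /r -expRM_natr mulfVK// expR_ln.
have c0 : 0 < cos (atan (y / x)).
  by apply: cos_gt0_pihalf; rewrite atan_gtNpi2 atan_ltpi2.
have t : sin (atan (y / x)) = y / x * cos (atan (y / x)).
  by rewrite -{2}(atanK (y / x)) /tan mulfVK// gt_eqF.
have rc : r * cos (atan (y / x)) = x.
  apply/eqP; rewrite -(@eqrXn2 _ 2)// ?mulr_ge0 ?(ltW r0) ?(ltW c0) ?(ltW x0)//.
  have := cos2Dsin2 (atan (y / x)); rewrite t exprMn => h.
  rewrite exprMn r2.
  have -> : x ^+ 2 + y ^+ 2 = x ^+ 2 * (1 + (y / x) ^+ 2) by field; rewrite gt_eqF.
  by rewrite -mulrA mulrDl mul1r h mulr1.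
apply: eq_complexP; rewrite ?ReCM ?ImCM /= -/r /arg_right /= mul0r ?subr0 ?addr0//.
by rewrite t mulrCA rc mulfVK// gt_eqF.
Qed.

Lemma cpowB1 (R : realType) (z : R[i]) (g : R) : 0 < complex.Re z ->
  cpow z g%:C = cpow z (g - 1)%:C * z.
Proof. by move=> z0; rewrite -{3}(cpow1 z0) -cpowD -rmorphD subrK. Qed.

(** The chain rule for a principal power, whose branch is smooth on Re > 0. *)
Lemma curve_derive_cpow (R : realType) (z : R -> R[i]) (g t : R) (d : R[i]) :
  (forall s, 0 < complex.Re (z s)) -> curve_derive z t d ->
  curve_derive (fun s => cpow (z s) g%:C) t (g%:C * cpow (z t) (g - 1)%:C * d).
Proof.
move=> zp [d1 d2].
apply: (@curve_derive_ext _ (fun s => (expR (g * (ln (normsq (z s)) / 2)))%:C *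
    cis (g * arg_right (z s)))).
  by move=> s; rewrite cpow_right.
pose x s := complex.Re (z s); pose y s := complex.Im (z s).
have xt : x t != 0 by rewrite gt_eqF// /x.
have N0 : 0 < normsq (z t) by exact: normsq_gt0.
pose dl := (x t * complex.Re d + y t * complex.Im d) / normsq (z t).
pose da := (x t * complex.Im d - y t * complex.Re d) / normsq (z t).
have dL : is_derive t 1 (fun s => g * (ln (normsq (z s)) / 2)) (g * dl).
  have h : is_derive t 1 (fun s => normsq (z s))
      (2 * (x t * complex.Re d + y t * complex.Im d)).
    rewrite /normsq; under eq_fun do rewrite !expr2.
    have := derD (derM d1 d1) (derM d2 d2).
    by move/is_derive_eq; apply; rewrite /x /y; ring.
  have hl := @der_ln R (fun s => normsq (z s)) t _ N0 h.
  have : is_derive t 1 (fun s => g * (ln (normsq (z s)) * 2^-1))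
    (g * (ln (normsq (z t)) * 0 + 2^-1 * ((normsq (z t))^-1 *
       (2 * (x t * complex.Re d + y t * complex.Im d)))) +
     (ln (normsq (z t)) * 2^-1) * 0) by der.
  by move/is_derive_eq; apply; rewrite /dl; field; rewrite gt_eqF.
have dA : is_derive t 1 (fun s => g * arg_right (z s)) (g * da).
  have h := der_atan (derM d2 (derV xt d1)).
  have := derM (der_cst t g) h.
  move/is_derive_eq; apply; rewrite /da /normsq -/(x t) -/(y t).
  by field; rewrite xt; rewrite /normsq -/(x t) -/(y t) in N0; rewrite gt_eqF//=
    (_ : _ + _ = x t ^+ 2 + y t ^+ 2) ?gt_eqF//; ring.
have dE : g%:C * cpow (z t) (g - 1)%:C * d =
    (g%:C * (dl +i* da)) * ((expR (g * (ln (normsq (z t)) / 2)))%:C *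
    cis (g * arg_right (z t))).
  rewrite -cpow_right// (cpowB1 g (zp t)).
  have -> : d = (dl +i* da) * z t.
    move: N0; rewrite /normsq -/(x t) -/(y t) => N0.
    have nz : x t ^+ 2 + y t ^+ 2 != 0 by rewrite gt_eqF.
    rewrite /dl /da /normsq -/(x t) -/(y t).
    by apply: eq_complexP; rewrite ?ReCM ?ImCM /= -/(x t) -/(y t); field.
  by ring.
rewrite dE; split.
- rewrite (_ : (fun s => _) = (fun s => expR (g * (ln (normsq (z s)) / 2)) *
      cos (g * arg_right (z s)))); last first.
    by apply/funext => s; rewrite ReCM /= mul0r subr0.
  have := derM (der_expR dL) (der_cos dA).
  by move/is_derive_eq; apply; rewrite !ReCM !ImCM /= ?ReCM ?ImCM /=; ring.
- rewrite (_ : (fun s => _) = (fun s => expR (g * (ln (normsq (z s)) / 2)) *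
      sin (g * arg_right (z s)))); last first.
    by apply/funext => s; rewrite ImCM /= mul0r addr0.
  have := derM (der_expR dL) (der_sin dA).
  by move/is_derive_eq; apply; rewrite !ImCM !ReCM /= ?ReCM ?ImCM /=; ring.
Qed.

(** * Integrals of powers along circles *)

Notation turn R := (`[0, (pi *+ 2 : R)]%classic : set R).

Lemma pi2_gt0 (R : realType) : 0 < pi *+ 2 :> R.
Proof. by rewrite mulrn_wgt0// pi_gt0. Qed.

Lemma turn_mu (R : realType) : \int[leb R]_(t in turn R) (1 : R) = pi *+ 2.
Proof.
rewrite Rintegral_cst// mul1r /= lebesgue_measure_itv /= lte_fin pi2_gt0.
by rewrite /= subr0.
Qed.

Lemma turn_integrable (R : realType) (f : R -> R) : continuous f ->
  (leb R).-integrable (turn R) (EFin \o f).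
Proof.
move=> cf; apply: continuous_compact_integrable; first exact: segment_compact.
exact: continuous_subspaceT.
Qed.

Definition ccont (R : realType) (f : R -> R[i]) : Prop :=
  continuous (fun t => complex.Re (f t)) /\ continuous (fun t => complex.Im (f t)).

Lemma ccontD (R : realType) (f g : R -> R[i]) :
  ccont f -> ccont g -> ccont (fun t => f t + g t).
Proof.
move=> [a b] [c d]; split=> t.
- by under eq_fun do rewrite ReCD; apply: contD; [exact: a|exact: c].
- by under eq_fun do rewrite ImCD; apply: contD; [exact: b|exact: d].
Qed.

Lemma ccontZ (R : realType) (c : R[i]) (f : R -> R[i]) :
  ccont f -> ccont (fun t => c * f t).
Proof.
move=> [a b]; split=> t.
- under eq_fun => u do rewrite (ReCM c (f u)).
  apply: (@contD R (fun u => complex.Re c * complex.Re (f u))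
      (fun u => - (complex.Im c * complex.Im (f u)))); last apply: contN.
    by apply: contM; [exact: cvg_cst|exact: a].
  by apply: contM; [exact: cvg_cst|exact: b].
- under eq_fun => u do rewrite (ImCM c (f u)).
  apply: (@contD R (fun u => complex.Re c * complex.Im (f u))
      (fun u => complex.Im c * complex.Re (f u))).
    by apply: contM; [exact: cvg_cst|exact: b].
  by apply: contM; [exact: cvg_cst|exact: a].
Qed.

Lemma turn_FTC (R : realType) (f f' : R -> R[i]) :
  (forall t, curve_derive f t (f' t)) ->
  ccont f' ->
  cintegral (turn R) f' = f (pi *+ 2) - f 0.
Proof.
move=> df [c1 c2]; apply: eq_complexP.
- have d (t : R) : 0 <= t <= pi *+ 2 ->
      is_derive t 1 (fun s => complex.Re (f s)) (complex.Re (f' t)).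
    by move=> _; case: (df t).
  have c (t : R) : 0 <= t <= pi *+ 2 -> {for t, continuous (fun s => complex.Re (f' s))}.
    by move=> _; exact: c1.
  by rewrite /cintegral /= /Rintegral (FTC_segment (pi2_gt0 R) d c) ReCD; case: (f 0).
- have d (t : R) : 0 <= t <= pi *+ 2 ->
      is_derive t 1 (fun s => complex.Im (f s)) (complex.Im (f' t)).
    by move=> _; case: (df t).
  have c (t : R) : 0 <= t <= pi *+ 2 -> {for t, continuous (fun s => complex.Im (f' s))}.
    by move=> _; exact: c2.
  by rewrite /cintegral /= /Rintegral (FTC_segment (pi2_gt0 R) d c) ImCD; case: (f 0).
Qed.

(** For |r| < 1 this circle stays in the right half-plane, where principal powers
    are smooth. *)
Definition shifted_circle (R : realType) (r t : R) : R[i] := 1 - r%:C * cis t.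

Lemma shifted_circle_lb (R : realType) (r t : R) :
  1 - `|r| <= complex.Re (shifted_circle r t).
Proof.
rewrite /shifted_circle /= mul0r subr0 lerD2l lerN2.
rewrite (le_trans (ler_norm _))// normrM ler_piMr//; exact: cos_max.
Qed.

Lemma shifted_circle_gt0 (R : realType) (r t : R) : `|r| < 1 ->
  0 < complex.Re (shifted_circle r t).
Proof. by move=> r1; rewrite (lt_le_trans _ (shifted_circle_lb r t))// subr_gt0. Qed.

Lemma cis_derive (R : realType) (t : R) : curve_derive (@cis R) t ('i * cis t).
Proof.
have := curve_derive_cis 1 t; rewrite mul1r.
by under [X in curve_derive X _ _]eq_fun do rewrite mul1r; rewrite mul1r.
Qed.

Lemma curve_deriveN (R : realType) (f : R -> R[i]) (t : R) (a : R[i]) :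
  curve_derive f t a -> curve_derive (fun s => - f s) t (- a).
Proof.
move=> /(curve_deriveZ (-1)); rewrite mulN1r; apply: curve_derive_ext => s.
by rewrite mulN1r.
Qed.

Lemma curve_deriveD (R : realType) (f g : R -> R[i]) (t : R) (a b : R[i]) :
  curve_derive f t a -> curve_derive g t b ->
  curve_derive (fun s => f s + g s) t (a + b).
Proof.
move=> [f1 f2] [g1 g2]; split.
- by under eq_fun do rewrite ReCD; rewrite ReCD; exact: derD.
- by under eq_fun do rewrite ImCD; rewrite ImCD; exact: derD.
Qed.

Lemma shifted_circle_derive (R : realType) (r t : R) :
  curve_derive (shifted_circle r) t (- (r%:C * ('i * cis t))).
Proof.
have := curve_deriveD (curve_derive_cst 1 t)
  (curve_deriveN (curve_deriveZ r%:C (cis_derive t))).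
by rewrite add0r.
Qed.

(** Over a period this integrates to 2 pi times the Fourier coefficient of index
    - k of the power g on the circle. *)
Definition fourier_power (R : realType) (r k g t : R) : R[i] :=
  cis (k * t) * cpow (shifted_circle r t) g%:C.

Lemma fourier_power_derive (R : realType) (r k g t : R) : `|r| < 1 ->
  curve_derive (fourier_power r k g) t
    ('i * (k%:C * fourier_power r k g t
           + (- (g * r))%:C * fourier_power r (k + 1) (g - 1) t)).
Proof.
move=> r1.
have := curve_deriveM (curve_derive_cis k t)
  (curve_derive_cpow g (fun s => shifted_circle_gt0 s r1) (shifted_circle_derive r t)).
apply: curve_derive_eq; rewrite /fourier_power (mulrDl k 1 t) mul1r cisD.
by rewrite rCN (rCM g r); ring.
Qed.

Lemma fourier_power_cont (R : realType) (r k g : R) : `|r| < 1 ->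
  ccont (fourier_power r k g).
Proof.
move=> r1; split=> t; have [] := curve_derive_cont (fourier_power_derive k g t r1) => //.
Qed.

Lemma fourier_power_integrable (R : realType) (r k g : R) : `|r| < 1 ->
  cintegrable (turn R) (fourier_power r k g).
Proof.
by move=> r1; have [c1 c2] := fourier_power_cont k g r1; split; exact: turn_integrable.
Qed.

Definition fourier_coef (R : realType) (r k g : R) : R[i] :=
  cintegral (turn R) (fourier_power r k g).

(** Integrating the derivative of a periodic function over a period. *)
Lemma fourier_coef_rec (R : realType) (r k g : R) : `|r| < 1 ->
  cis (k * (pi *+ 2)) = 1 ->
  k%:C * fourier_coef r k g = (g * r)%:C * fourier_coef r (k + 1) (g - 1).
Proof.
move=> r1 k1.
pose f' t := 'i * (k%:C * fourier_power r k g t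
           + (- (g * r))%:C * fourier_power r (k + 1) (g - 1) t).
have c1 := fourier_power_cont k g r1.
have c2 := fourier_power_cont (k + 1) (g - 1) r1.
have i1 := fourier_power_integrable k g r1.
have i2 := fourier_power_integrable (k + 1) (g - 1) r1.
have mT : measurable (turn R) by exact: measurable_itv.
have h0 : cintegral (turn R) f' = 0.
  rewrite (@turn_FTC _ (fourier_power r k g)).
  - by rewrite /fourier_power k1 mulr0 cis0 /shifted_circle cis_turn cis0 subrr.
  - by move=> t; exact: fourier_power_derive.
  - by apply: ccontZ; apply: ccontD; exact: ccontZ.
move: h0; rewrite /f' cintegralZ//; last first.
  by apply: cintegrableD => //; apply: cintegrableZ.
rewrite cintegralD//; [|exact: cintegrableZ|exact: cintegrableZ].
rewrite !cintegralZ// -!/(fourier_coef _ _ _) => /eqP.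
rewrite mulf_eq0 (negbTE (i_neq0 R)) /= rCN mulNr subr_eq0.
by move/eqP.
Qed.

(** The recurrence at k = 0 has left-hand side 0; radius 0 needs k = 1 instead. *)
Lemma fourier_coef1_eq0 (R : realType) (r g : R) : `|r| < 1 -> g != 0 ->
  fourier_coef r 1 (g - 1) = 0.
Proof.
move=> r1 g0; have [->|r0] := eqVneq r 0.
  have := @fourier_coef_rec _ 0 1 (g - 1); rewrite normr0 mulr0 !mul1r mul0r.
  by apply; [exact: ltr01|exact: cis_turn].
have := @fourier_coef_rec _ r 0 g r1.
rewrite !mul0r add0r => /(_ (cis0 R))/esym/eqP; rewrite mulf_eq0 => /orP[|/eqP//].
by rewrite eq_complex /= eqxx andbT mulf_eq0 (negbTE g0) (negbTE r0).
Qed.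

Definition norm_power_bound (R : realType) (r g : R) : R :=
  expR (`|g| * (`|ln ((1 - r) ^+ 2)| + `|ln (8 : R)|)).

Lemma cpow_circle_bound (R : realType) (r s g t : R) : 0 < r < 1 -> `|s| <= r ->
  expR (g * (ln (normsq (shifted_circle s t)) / 2)) <= norm_power_bound r g.
Proof.
move=> /andP[r0 r1] sr; rewrite ler_expR (le_trans (ler_norm _))// normrM ler_wpM2l//.
have l1 : (1 - r) ^+ 2 <= normsq (shifted_circle s t).
  have lb : 1 - r <= complex.Re (shifted_circle s t).
    by rewrite (le_trans _ (shifted_circle_lb s t))// lerD2l lerN2.
  have r1' : 0 <= 1 - r by rewrite subr_ge0 ltW.
  have lb0 := le_trans r1' lb.
  by rewrite /normsq ler_wpDr ?sqr_ge0//; apply: lerXn2r lb; rewrite nnegrE.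
(* The exact maximum is (1 + r)^2 < 4; the slack makes the estimate linear. *)
have l2 : normsq (shifted_circle s t) <= 8.
  have /andP[sa sb] : - 1 <= s <= 1 by rewrite -ler_norml (le_trans sr)// ltW.
  have /andP[ca cb] : - 1 <= cos t <= 1 by rewrite -ler_norml cos_max.
  have cs := cos2Dsin2 t.
  rewrite /normsq /= !mul0r !subr0 !addr0 add0r.
  have -> : (1 - s * cos t) ^+ 2 + (- (s * sin t)) ^+ 2 =
      1 - 2 * (s * cos t) + s ^+ 2 * (cos t ^+ 2 + sin t ^+ 2) by ring.
  rewrite cs mulr1; nra.
have p1 : 0 < (1 - r) ^+ 2 by rewrite exprn_gt0// subr_gt0.
have p2 : 0 < normsq (shifted_circle s t) by exact: lt_le_trans l1.
have e1 : ln ((1 - r) ^+ 2) <= ln (normsq (shifted_circle s t)) by rewrite ler_ln.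
have e2 : ln (normsq (shifted_circle s t)) <= ln 8 by rewrite ler_ln// posrE.
rewrite normrM (ger0_norm (_ : 0 <= 2^-1))//.
rewrite (le_trans (_ : _ <= `|ln (normsq (shifted_circle s t))|))//.
  by have := normr_ge0 (ln (normsq (shifted_circle s t))); lra.
by rewrite ler_norml; have := ler_norm (ln (8 : R)); have := ler_norm (- ln ((1 - r) ^+ 2));
  have := normr_ge0 (ln (8 : R)); have := normr_ge0 (ln ((1 - r) ^+ 2)); rewrite normrN; lra.
Qed.

(** Differentiates the integrand of the mean over the circle of radius r sin s; the
    sine keeps the radius below 1 for every real s. *)
Lemma radial_derive (R : realType) (r g s t : R) : 0 < r < 1 ->
  curve_derive (fun s => fourier_power (r * sin s) 0 g t) s
    ((- (g * r * cos s))%:C * fourier_power (r * sin s) 1 (g - 1) t).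
Proof.
move=> /andP[r0 r1].
have rs u : `|r * sin u| < 1.
  by rewrite normrM (le_lt_trans _ r1)// (gtr0_norm r0) ler_piMr ?(ltW r0)// sin_max.
have d1 : curve_derive (fun u : R => (r * sin u)%:C) s (r * cos s)%:C.
  split=> /=; last exact: der_cst.
  have h := @derM _ (fun _ => r) (fun u : R => sin u) s _ _ (der_cst s r) (der_sin (der_id s)).
  by move/is_derive_eq: h; apply; ring.
have d2 : curve_derive (fun u => shifted_circle (r * sin u) t) s (- ((r * cos s)%:C * cis t)).
  have := curve_deriveD (curve_derive_cst 1 s)
    (curve_deriveN (curve_deriveM d1 (curve_derive_cst (cis t) s))).
  by rewrite mulr0 add0r addr0.
have := curve_deriveM (curve_derive_cst (cis (0 * t)) s)
  (curve_derive_cpow g (fun u => shifted_circle_gt0 t (rs u)) d2).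
rewrite /fourier_power; apply: curve_derive_eq; rewrite (mul0r t) (mul0r (cpow _ _)) add0r (mul1r t) cis0 mul1r rCN.
by rewrite -(mulrA g r) (rCM g); ring.
Qed.

Lemma cpow_1 (R : realType) (g : R) : cpow 1 g%:C = 1.
Proof.
have h : 0 < complex.Re (1 : R[i]) by exact: ltr01.
rewrite cpow_right// /arg_right /normsq /= expr1n expr0n addr0 ln1 !mul0r mulr0 expR0.
by rewrite atan0 mulr0 cis0 mulr1.
Qed.

Lemma fourier_power0 (R : realType) (g t : R) : fourier_power 0 0 g t = 1.
Proof.
by rewrite /fourier_power /shifted_circle mul0r cis0 mul0r subr0 cpow_1 mulr1.
Qed.

Section RadialMean.
Variables (R : realType) (r g : R) (p : R[i] -> R).
Hypotheses (r01 : 0 < r < 1) (g0 : g != 0).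
Hypothesis pE : p = @complex.Re R \/ p = @complex.Im R.

Lemma radial_lt1 (s : R) : `|r * sin s| <= r /\ `|r * sin s| < 1.
Proof.
move: r01 => /andP[r0 r1].
have h : `|r * sin s| <= r by rewrite normrM (gtr0_norm r0) ler_piMr ?(ltW r0)// sin_max.
by split=> //; exact: le_lt_trans r1.
Qed.

Let f (s t : R) : R := p (fourier_power (r * sin s) 0 g t).
Let f1 (s t : R) : R :=
  p ((- (g * r * cos s))%:C * fourier_power (r * sin s) 1 (g - 1) t).

Let f_derive (s t : R) : is_derive s 1 (fun s => f s t) (f1 s t).
Proof. by have [] := radial_derive g s t r01; rewrite /f /f1; case: pE => ->. Qed.

Let f_integrable (s : R) : (leb R).-integrable (turn R) (EFin \o f s).
Proof.
have [] := fourier_power_integrable 0 g (radial_lt1 s).2.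
by rewrite /f; case: pE => ->.
Qed.

Let f1_bound (s t : R) : `|f1 s t| <= `|g| * norm_power_bound r (g - 1).
Proof.
have [a1 a2] := radial_lt1 s.
have -> : f1 s t = p ((- (g * r * cos s) *
    expR ((g - 1) * (ln (normsq (shifted_circle (r * sin s) t)) / 2)))%:C *
    cis (1 * t + (g - 1) * arg_right (shifted_circle (r * sin s) t))).
  rewrite /f1 /fourier_power cpow_right; last exact: shifted_circle_gt0.
  by congr p; rewrite cisD (rCM (- _)); ring.
have h (a u : R) : `|p (a%:C * cis u)| <= `|a|.
  case: pE => ->; rewrite ?ReCM ?ImCM /= mul0r ?subr0 ?addr0 normrM ler_piMr//.
  - exact: cos_max.
  - exact: sin_max.
rewrite (le_trans (h _ _))// normrM ler_pM//.
  rewrite normrN !normrM -mulrA ler_piMr// -(mulr1 1) ler_pM//; last exact: cos_max.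
  by move: r01 => /andP[r0 r1]; rewrite gtr0_norm// ltW.
by rewrite ger0_norm ?expR_ge0//; exact: cpow_circle_bound.
Qed.

Let f1_int (s : R) : \int[leb R]_(t in turn R) f1 s t = 0.
Proof.
have [_ a2] := radial_lt1 s.
have := cintegralZ (- (g * r * cos s))%:C (measurable_itv _)
  (fourier_power_integrable 1 (g - 1) a2).
rewrite -/(fourier_coef _ _ _) fourier_coef1_eq0// mulr0 => h.
have : p (cintegral (turn R) (fun t => (- (g * r * cos s))%:C *
  fourier_power (r * sin s) 1 (g - 1) t)) = p 0 by rewrite h.
by rewrite /f1; case: pE => ->.
Qed.

(** The radial derivative of the mean is a multiple of fourier_coef _ 1 _, hence 0,
    and at s = 0 the circle degenerates to the point 1. *)
Lemma radial_mean_cst (s : R) :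
  \int[leb R]_(t in turn R) f s t = \int[leb R]_(t in turn R) p 1.
Proof.
pose F (s : R) := \int[leb R]_(t in turn R) f s t.
have dF (a : R) : is_derive a 1 F 0.
  have aI : `]a - 1, a + 1[%classic a by rewrite /= in_itv /=; apply/andP; split; lra.
  have mT : measurable (turn R) by exact: measurable_itv.
  have iG : (leb R).-integrable (turn R) (EFin \o
      (fun _ : R => `|g| * norm_power_bound r (g - 1))).
    by apply: turn_integrable => x; exact: cvg_cst.
  have G0 (y : R) : 0 <= `|g| * norm_power_bound r (g - 1).
    by rewrite mulr_ge0// expR_ge0.
  have dv (x y : R) : derivable (fun s => f s y) x 1 by case: (f_derive x y).
  have p1 (x y : R) : partial1of2 f x y = f1 x y.
    by rewrite partial1of2E; case: (f_derive x y).
  have Gb (x y : R) : `]a - 1, a + 1[%classic x -> turn R y ->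
      `|partial1of2 f x y| <= `|g| * norm_power_bound r (g - 1).
    by move=> _ _; rewrite p1; exact: f1_bound.
  have h1 := @derivable_under_integral R _ _ (leb R) f (turn R) mT a _ _ aI
    (fun x _ => f_integrable x) (fun x y _ _ => dv x y) _ G0 iG Gb.
  have h2 := @differentiation_under_integral R _ _ (leb R) f (turn R) mT a _ _ aI
    (fun x _ => f_integrable x) (fun x y _ _ => dv x y) _ G0 iG Gb.
  apply: DeriveDef => //; rewrite -derive1E h2.
  rewrite -[RHS](f1_int a); apply: eq_Rintegral => t _; exact: p1.
rewrite -/(F s) (@is_derive_0_is_cst _ F s 0)// /F /f.
by apply: eq_Rintegral => t _; rewrite sin0 mulr0 fourier_power0.
Qed.

End RadialMean.

Lemma cintegral_turn1 (R : realType) : cintegral (turn R) (fun _ => 1) = (pi *+ 2)%:C.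
Proof.
apply: eq_complexP; rewrite /cintegral /=; first exact: turn_mu.
by rewrite Rintegral_cst// mul0r.
Qed.

(** The mean value property of a holomorphic power on a disc around 1. *)
Lemma fourier_coef0 (R : realType) (r g : R) : 0 < r < 1 ->
  fourier_coef r 0 g = (pi *+ 2)%:C.
Proof.
move=> r01; have [->|g0] := eqVneq g 0.
  rewrite -cintegral_turn1; apply: eq_cintegral => t _.
  by rewrite /fourier_power (mul0r t) cis0 cpow0 mulr1.
have E (p : R[i] -> R) : p = @complex.Re R \/ p = @complex.Im R ->
    \int[leb R]_(t in turn R) p (fourier_power r 0 g t) =
    \int[leb R]_(t in turn R) p 1.
  move=> pE; rewrite -(radial_mean_cst r01 g0 pE (pi / 2)).
  by apply: eq_Rintegral => t _; rewrite sin_pihalf mulr1.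
rewrite -cintegral_turn1; apply: eq_complexP.
- by apply: (E (@complex.Re R)); left.
- by apply: (E (@complex.Im R)); right.
Qed.

Lemma cis_nat_turn (R : realType) (k : nat) : cis (- k%:R * (pi *+ 2)) = 1 :> R[i].
Proof.
have h : cis (k%:R * (pi *+ 2)) = 1 :> R[i].
  elim: k => [|k IH]; first by rewrite mul0r cis0.
  by rewrite -natr1 (mulrDl _ _ (pi *+ 2)) mul1r cisD IH cis_turn mulr1.
have := @cisD R (- k%:R * (pi *+ 2)) (k%:R * (pi *+ 2)).
by rewrite h mulr1 mulNr addNr cis0.
Qed.

(** Iterating fourier_coef_rec down to the mean gives the Taylor coefficients of
    (1 - z)^g. *)
Lemma fourier_coef_neg (R : realType) (r g : R) (m : nat) : 0 < r < 1 ->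
  fourier_coef r (- m%:R) g =
  (pi *+ 2 * r ^+ m * (\prod_(i < m) (i%:R - g) / m`!%:R))%:C.
Proof.
move=> r01; have r1 : `|r| < 1 by case/andP: r01 => r0 r1; rewrite gtr0_norm.
elim: m g => [|m IH] g.
  by rewrite oppr0 fourier_coef0// big_ord0 fact0 divr1 expr0 !mulr1.
have := @fourier_coef_rec _ r (- m.+1%:R) g r1 (cis_nat_turn R m.+1).
have -> : - m.+1%:R + 1 = - m%:R :> R by rewrite -natr1 opprD addrNK.
rewrite IH => h.
have m0 : (- m.+1%:R)%:C != 0 :> R[i].
  by rewrite eq_complex /= eqxx andbT oppr_eq0 pnatr_eq0.
apply: (mulfI m0); rewrite h -!rCM; apply: (congr1 (real_complex R)).
rewrite big_ord_recl /= sub0r factS natrM exprS.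
have -> : \prod_(i < m) ((bump 0 i)%:R - g) = \prod_(i < m) (i%:R - (g - 1)).
  by apply: eq_bigr => i _; rewrite /bump leq0n (natrD _ 1); ring.
have f0 : m`!%:R != 0 :> R by rewrite pnatr_eq0 -lt0n fact_gt0.
have m1 : m.+1%:R != 0 :> R by rewrite pnatr_eq0.
move: (m.+1%:R : R) (m`!%:R : R) m1 f0 => a b a0 b0.
by field; rewrite a0 b0.
Qed.

(** * The discrete Wright function *)

Lemma cpow_div (R : realType) (z : R[i]) (h g : R) : 0 < complex.Re z -> 0 < h ->
  cpow (z / h%:C) g%:C = (expR (- g * ln h))%:C * cpow z g%:C.
Proof.
case: z => x y /= x0 h0.
have E : (x +i* y) / h%:C = (x / h) +i* (y / h).
  by rewrite -rCV; apply: eq_complexP; rewrite ?ReCM ?ImCM /= mulr0 ?subr0 ?add0r.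
have hn : h != 0 by rewrite gt_eqF.
have xn : x != 0 by rewrite gt_eqF.
have N0 : 0 < x ^+ 2 + y ^+ 2 by exact: (@normsq_gt0 _ (x +i* y)).
have q0 : 0 < complex.Re ((x / h) +i* (y / h)) by rewrite /= divr_gt0.
rewrite E (cpow_right g q0) (cpow_right g (_ : 0 < complex.Re (x +i* y)))//.
rewrite [RHS]mulrA -rCM -expRD /arg_right /normsq /=.
have -> : y / h / (x / h) = y / x by rewrite invf_div mulrA mulfVK.
congr ((expR _)%:C * _).
have -> : (x / h) ^+ 2 + (y / h) ^+ 2 = (x ^+ 2 + y ^+ 2) / h ^+ 2 by field.
by rewrite ln_div ?posrE ?exprn_gt0// lnXn// mulr2n; field.
Qed.

Lemma cpow_exp (R : realType) (z : R[i]) (g : R) (k : nat) :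
  cpow z g%:C ^+ k = cpow z (g * k%:R)%:C.
Proof.
elim: k => [|k IH]; first by rewrite mulr0 cpow0.
by rewrite exprS IH -cpowD -nat1r mulrDr mulr1 (rmorphD (real_complex R)).
Qed.

Lemma cis_nat (R : realType) (k : nat) (t : R) : cis t ^+ k = cis (k%:R * t).
Proof.
elim: k => [|k IH]; first by rewrite mul0r cis0.
by rewrite exprS IH -cisD -nat1r mulrDl mul1r.
Qed.

Lemma cis_neq0 (R : realType) (t : R) : cis t != 0.
Proof.
have := @cisD R t (- t); rewrite subrr cis0 => h.
by apply/negP => /eqP e; move: h; rewrite e mul0r => /eqP; rewrite oner_eq0.
Qed.

Lemma cisNnat (R : realType) (k : nat) (t : R) : (cis t ^+ k)^-1 = cis (- k%:R * t).
Proof.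
have h : cis t ^+ k * cis (- k%:R * t) = 1.
  by rewrite cis_nat -cisD mulNr subrr cis0.
by rewrite -[LHS]mulr1 -h mulKf// expf_neq0// cis_neq0.
Qed.

(** The binomial theorem for (1 - eta (1 - z)^al)^j, where eta = h^(1-al), reduces
    the contour integral to Taylor coefficients of powers of 1 - z. *)
Lemma wright_binomial (R : realType) (rho h al : R) (m j : nat) :
  0 < rho < 1 -> 0 < h ->
  wright rho h al (1 - al) m j =
  (\sum_(k < j.+1) expR ((1 - al) * ln h) * 'C(j, k)%:R *
     (- expR ((1 - al) * ln h)) ^+ k *
     (\prod_(i < m) (i%:R - (al * k%:R + al - 1)) / m`!%:R))%:C.
Proof.
move=> r01 h0; set eta := expR _.
have [r0 r1] : 0 < rho /\ `|rho| < 1.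
  by case/andP: r01 => r0 r1; rewrite gtr0_norm.
have rm : (rho ^+ m)%:C != 0 :> R[i].
  by rewrite eq_complex /= eqxx andbT expf_neq0// gt_eqF.
pose c k : R[i] := 'i * (eta * 'C(j, k)%:R * (- eta) ^+ k / rho ^+ m)%:C.
rewrite /wright /circle_integral.
have E t : turn R t -> (rho%:C * cexp (0 +i* t)) ^- m.+1 *
    ((1 - h%:C * cpow ((1 - rho%:C * cexp (0 +i* t)) / h%:C) al%:C) ^+ j /
     cpow ((1 - rho%:C * cexp (0 +i* t)) / h%:C) (1 - al)%:C) *
    ('i * (rho%:C * cexp (0 +i* t))) =
    \sum_(k <- index_enum 'I_j.+1) c k * fourier_power rho (- m%:R) (al * k%:R + al - 1) t.
  move=> _; rewrite cexpE expR0 mul1r -/(shifted_circle rho t).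
  have W0 := shifted_circle_gt0 t r1; set W := shifted_circle rho t in W0 *.
  have hV : cpow W (1 - al)%:C * cpow W (al - 1)%:C = 1.
    by rewrite -cpowD -rmorphD /= addrA subrK subrr cpow0.
  have ie : (expR (- (1 - al) * ln h))%:C * eta%:C = 1.
    by rewrite -rCM -expRD mulNr addNr expR0.
  have he : h%:C * (expR (- al * ln h))%:C = eta%:C.
    rewrite -rCM -{1}(expR_ln h0) -expRD; congr ((expR _)%:C); ring.
  have hI : ((expR (- (1 - al) * ln h))%:C * cpow W (1 - al)%:C)^-1 =
      eta%:C * cpow W (al - 1)%:C.
    have n0 : (expR (- (1 - al) * ln h))%:C * cpow W (1 - al)%:C != 0.
      by rewrite mulf_neq0 ?cpow_neq0// eq_complex /= eqxx andbT gt_eqF// expR_gt0.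
    by apply: (mulfI n0); rewrite mulfV// mulrACA ie hV mul1r.
  rewrite !cpow_div// hI mulrA he.
  have hu : (rho%:C * cis t) ^- m.+1 * ('i * (rho%:C * cis t)) =
      'i * (rho ^+ m)%:C^-1 * cis (- m%:R * t).
    rewrite -cisNnat rCX exprMn !exprSr.
    have a1 := cis_neq0 t; have a2 : rho%:C != 0 :> R[i].
      by rewrite eq_complex /= eqxx andbT gt_eqF.
    by field; rewrite a1 a2 !expf_neq0.
  rewrite mulrAC hu exprDn mulr_suml mulr_sumr.
  apply: eq_bigr => k _; rewrite expr1n mul1r /c /fourier_power -/W.
  have -> : cpow W (al * k%:R + al - 1)%:C = cpow W al%:C ^+ k * cpow W (al - 1)%:C.
    by rewrite cpow_exp -cpowD -rmorphD /= addrA.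
  have -> : (eta * 'C(j, k)%:R * (- eta) ^+ k / rho ^+ m)%:C =
      eta%:C * 'C(j, k)%:R * (- eta%:C) ^+ k / (rho ^+ m)%:C.
    by rewrite !rCM rCV (rCX (- eta)) rCN -natC.
  by rewrite -mulNr exprMn -mulr_natr; ring.
rewrite (eq_cintegral E).
have ci (k : 'I_j.+1) : cintegrable (turn R)
    (fun t => c k * fourier_power rho (- m%:R) (al * k%:R + al - 1) t).
  by apply: cintegrableZ => //; exact: fourier_power_integrable.
have [_ ->] := cintegral_sum (index_enum 'I_j.+1) (measurable_itv _) ci.
rewrite rC_sum mulr_sumr; apply: eq_bigr => k _.
rewrite cintegralZ//; last exact: fourier_power_integrable.
rewrite -/(fourier_coef _ _ _) fourier_coef_neg// /c.
set P := \prod_(i < m) _ / _.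
have -> : ((pi *+ 2)%:C * 'i)^-1 * ('i * (eta * 'C(j, k)%:R * (- eta) ^+ k / rho ^+ m)%:C *
    (pi *+ 2 * rho ^+ m * P)%:C) =
    ((pi *+ 2)^-1 * ((eta * 'C(j, k)%:R * (- eta) ^+ k / rho ^+ m) * (pi *+ 2 * rho ^+ m * P)))%:C.
  rewrite [in RHS]rCM [in RHS]rCM rCV invfM -[LHS]mulrA; apply: (congr1 ( *%R _)).
  by rewrite -mulrA mulKf// i_neq0.
apply: (congr1 (real_complex R)); have := pi2_gt0 R => /lt0r_neq0.
have : rho ^+ m != 0 by rewrite expf_neq0// gt_eqF.
by move: (pi *+ 2) (rho ^+ m) => a b b0 a0; field; rewrite b0 a0.
Qed.

(** By induction on l, from (k + 1) C(j+1, k+1) = (j + 1) C(j, k). *)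
Lemma binomial_ffact (R : comPzRingType) (x : R) (j l : nat) :
  \sum_(k < j.+1) 'C(j, k)%:R * x ^+ k * (k ^_ l)%:R =
  (j ^_ l)%:R * x ^+ l * (1 + x) ^+ (j - l).
Proof.
elim: l j => [|l IH] j.
  rewrite ffactn0 expr0 !mul1r subn0 exprDn.
  by apply: eq_bigr => k _; rewrite ffactn0 mulr1 expr1n mul1r mulrC mulr_natr.
rewrite big_ord_recl /= ffact0n mulr0 add0r.
case: j => [|j]; first by rewrite big_ord0 ffact0n !mul0r.
rewrite ffactSS natrM exprS subSS.
transitivity (j.+1%:R * x * \sum_(k < j.+1) 'C(j, k)%:R * x ^+ k * (k ^_ l)%:R).
  rewrite mulr_sumr; apply: eq_bigr => k _; rewrite /bump leq0n add1n ffactSS exprS.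
  have h : (j.+1%:R * 'C(j, k)%:R : R) = k.+1%:R * 'C(j.+1, k.+1)%:R.
    by rewrite -!natrM mul_bin_diag.
  rewrite (natrM _ k.+1); transitivity (k.+1%:R * 'C(j.+1, k.+1)%:R * (x * x ^+ k * (k ^_ l)%:R)).
    by ring.
  by rewrite -h; ring.
by rewrite IH; ring.
Qed.

Lemma ffactC_nat (R : realType) (k l : nat) : ffactC (k%:R : R[i]) l = (k ^_ l)%:R.
Proof.
rewrite /ffactC; elim: l => [|l IH]; first by rewrite big_ord0 ffactn0.
rewrite big_ord_recr /= IH ffactnSr natrM; have [kl|kl] := leqP l k.
  by rewrite natrB.
by rewrite ffact_small// !mul0r.
Qed.

Lemma newton_expand_nat (R : realType) (a : R) (m k : nat) :
  \prod_(i < m) (i%:R - (a * k%:R + a - 1)) / m`!%:R =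
  \sum_(l < m.+1) newton a m l * (k ^_ l)%:R.
Proof.
have P : \prod_(i < m) (i.+1%:R - a%:C * (k%:R + 1)) =
    (\prod_(i < m) (i%:R - (a * k%:R + a - 1)))%:C :> R[i].
  rewrite (rmorph_prod (real_complex R)); apply: eq_bigr => i _.
  have c1 : 1%:C = 1 :> R[i] by [].
  by rewrite /= !(rCD, rCN, rCM) -!natC c1 -nat1r; ring.
have := newton_expand a m (k%:R : R[i]); rewrite P (natC R m`!) -rCV -rCM => h.
suff : (\prod_(i < m) (i%:R - (a * k%:R + a - 1)) / m`!%:R)%:C =
  (\sum_(l < m.+1) newton a m l * (k ^_ l)%:R)%:C by case.
rewrite h rC_sum; apply: eq_bigr => l _.
by rewrite ffactC_nat natC rCM.
Qed.

(** The value of the discrete Wright function of order (al, 1 - al), see wrightE;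
    here eta = h^(1-al). *)
Definition wright_real (R : realType) (eta al : R) (m j : nat) : R :=
  eta * \sum_(l < m.+1) newton al m l * (- eta) ^+ l *
    ((j ^_ l)%:R * (1 - eta) ^+ (j - l)).

Lemma wrightE (R : realType) (rho h al : R) (m j : nat) : 0 < rho < 1 -> 0 < h ->
  wright rho h al (1 - al) m j = (wright_real (expR ((1 - al) * ln h)) al m j)%:C.
Proof.
move=> r01 h0; rewrite wright_binomial//; apply: (congr1 (real_complex R)).
set eta := expR _; rewrite /wright_real.
under eq_bigr => k _ do rewrite newton_expand_nat mulr_sumr.
rewrite exchange_big /= mulr_sumr; apply: eq_bigr => l _.
transitivity (eta * newton al m l *
   (\sum_(k < j.+1) 'C(j, k)%:R * (- eta) ^+ k * (k ^_ l)%:R)).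
  by rewrite mulr_sumr; apply: eq_bigr => k _; ring.
by rewrite binomial_ffact; ring.
Qed.

(** * Exponential generating series *)

Lemma integrable_natpow_exp (R : realType) (l : nat) (d : R) : 0 < d ->
  (leb R).-integrable (Rpos R) (EFin \o (fun u => u ^+ l * expR (- (d * u)))).
Proof.
move=> d0; have h := @integrable_pow_exp R (l%:R + 1) d (ltr_wpDl (ler0n _ _) ltr01) d0.
apply: eq_integrable h => // t; rewrite inE /= in_itv /= andbT => t0.
by rewrite addrK expRD expRM_natl expR_ln.
Qed.

Lemma cvg_sumR (R : realType) (k : nat) (F : nat -> nat -> R) (L : nat -> R) :
  (forall l, F l n @[n --> \oo] --> L l) ->
  (\sum_(l < k) F l n) @[n --> \oo] --> \sum_(l < k) L l.
Proof.
move=> FL; elim: k => [|k IH].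
  by rewrite big_ord0; under eq_cvg do rewrite big_ord0; exact: cvg_cst.
rewrite big_ord_recr /=; under eq_cvg do rewrite big_ord_recr /=.
exact: (@cvgD _ R^o).
Qed.

Lemma cvg_cont (R : realType) (f : R -> R) (u_ : nat -> R) (l : R) :
  {for l, continuous f} -> u_ n @[n --> \oo] --> l -> f (u_ n) @[n --> \oo] --> f l.
Proof. by move=> cf ul; exact: (cvg_comp u_ f ul cf). Qed.

Definition fact_series (R : realType) (l : nat) (A x : R) (M : nat) : R :=
  \sum_(j < M) (j ^_ l)%:R * A ^+ (j - l) * x ^+ j / j`!%:R.

Lemma fact_seriesE (R : realType) (l : nat) (A x : R) (M : nat) :
  fact_series l A x (M + l) = x ^+ l * series (exp_coeff (A * x)) M.
Proof.
rewrite seriesEord /fact_series /=; elim: M => [|M IH].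
  rewrite add0n [X in _ * X]big_ord0 mulr0 big1// => j _.
  by rewrite ffact_small// !mul0r.
rewrite addSn big_ord_recr IH [in RHS]big_ord_recr /= mulrDr; congr (_ + _).
rewrite addnK /exp_coeff /= exprMn exprD.
have := @ffact_fact (M + l) l (leq_addl _ _); rewrite addnK => <-.
have a0 : M`!%:R != 0 :> R by rewrite pnatr_eq0 -lt0n fact_gt0.
have b0 : ((M + l) ^_ l)%:R != 0 :> R by rewrite pnatr_eq0 -lt0n ffact_gt0 leq_addl.
rewrite natrM; move: (M`!%:R : R) ((M + l) ^_ l)%:R a0 b0 => a b a0 b0.
by field; rewrite a0 b0.
Qed.

Lemma fact_series_cvg (R : realType) (l : nat) (A x : R) :
  fact_series l A x n @[n --> \oo] --> x ^+ l * expR (A * x).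
Proof.
rewrite -(cvg_shiftn l) (eq_cvg _ _ (fact_seriesE l A x)).
by apply: (@cvgM R^o); [exact: cvg_cst|exact: is_cvg_series_exp_coeff].
Qed.

Lemma exp_partial_le (R : realType) (x : R) (M : nat) : 0 <= x ->
  series (exp_coeff x) M <= expR x.
Proof.
move=> x0; apply: nondecreasing_cvgn_le; last exact: is_cvg_series_exp_coeff.
apply/nondecreasing_seqP => n; rewrite seriesSr lerDl.
by rewrite /exp_coeff /= mulr_ge0 ?exprn_ge0.
Qed.

Lemma fact_series_bound (R : realType) (l : nat) (A x : R) (M : nat) :
  `|fact_series l A x M| <= `|x| ^+ l * expR (`|A| * `|x|).
Proof.
apply: (@le_trans _ _ (fact_series l `|A| `|x| (M + l))).
  rewrite (le_trans (ler_norm_sum _ _ _))// /fact_series -(big_mkord xpredT (fun j => 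
    `|(j ^_ l)%:R * A ^+ (j - l) * x ^+ j / j`!%:R|)) -(big_mkord xpredT (fun j => 
    (j ^_ l)%:R * `|A| ^+ (j - l) * `|x| ^+ j / j`!%:R)) [leRHS](@big_cat_nat _ _ _ M)//= ?leq_addr//.
  rewrite ler_wpDr//; first by rewrite sumr_ge0// => j _; rewrite !mulr_ge0// exprn_ge0.
  by apply: ler_sum => j _; rewrite !normrM !normrX normfV !normr_nat.
rewrite fact_seriesE ler_wpM2l ?exprn_ge0//; apply: exp_partial_le.
by rewrite mulr_ge0.
Qed.

Definition poisson_weight (R : realType) (j : nat) (u : R) : R :=
  u ^+ j / j`!%:R * expR (- u).

Section PoissonSeries.
Variables (R : realType) (mu : R -> R) (K : R).
Hypothesis mu_ge0 : forall u : R, 0 < u -> 0 <= mu u.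
Hypothesis mu_le : forall u : R, 0 < u -> mu u <= K.
Hypothesis mu_cont : forall u : R, 0 < u -> {for u, continuous mu}.
Variables (eta al : R) (m : nat).
Hypothesis eta0 : 0 < eta.

(** With mu u = G_(h u)(x) this is the discrete Gaussian kernel of index j + 1. *)
Definition poisson_mean (j : nat) : R :=
  \int[leb R]_(u in `]0, +oo[) (poisson_weight j u * mu u).

(** The integrand of abel_sum r once its exponential series in r u is summed. *)
Definition abel_density (r u : R) : R :=
  eta * (\sum_(l < m.+1) newton al m l * (- eta) ^+ l *
    ((r * u) ^+ l * expR ((1 - eta) * (r * u)))) * expR (- u) * mu u.

Definition abel_sum (r : R) (M : nat) : R :=
  \sum_(j < M) r ^+ j * (wright_real eta al m j * poisson_mean j).

Let mu_measurable : measurable_fun (Rpos R) mu.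
Proof. by apply: open_cont_measurable => // x; rewrite /= in_itv/= andbT; exact: mu_cont. Qed.

Lemma mul_mu_integrable (f : R -> R) : measurable_fun (Rpos R) f ->
  (leb R).-integrable (Rpos R) (EFin \o f) ->
  (leb R).-integrable (Rpos R) (EFin \o (fun u => f u * mu u)).
Proof.
move=> mf fi; apply: (@integrable_le _ _ _ (fun u => K * `|f u|)) => //.
- exact: measurable_funM.
- move=> u; rewrite /= in_itv/= andbT => u0; rewrite normrM mulrC ler_wpM2r//.
  by rewrite ger0_norm ?mu_ge0// mu_le.
- by apply: integrable_scaled => //; exact: integrable_norm.
Qed.

Lemma poisson_weightE (j : nat) (u : R) :
  poisson_weight j u = (j`!%:R)^-1 * (u ^+ j * expR (- (1 * u))).
Proof. by rewrite /poisson_weight mul1r; ring. Qed.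

Lemma poisson_weight_measurable (j : nat) : measurable_fun setT (@poisson_weight R j).
Proof.
apply: continuous_measurable_fun => x.
apply: (@contM R (fun u => u ^+ j / j`!%:R) (fun u => expR (- u))).
  apply: (@contM R (fun u => u ^+ j) (fun=> (j`!%:R)^-1)); last exact: cvg_cst.
  exact: exprn_continuous.
by apply: cont_expR; apply: contN; exact: cvg_id.
Qed.

Lemma poisson_mean_integrable (j : nat) :
  (leb R).-integrable (Rpos R) (EFin \o (fun u => poisson_weight j u * mu u)).
Proof.
apply: mul_mu_integrable; first by apply: measurable_funTS; exact: poisson_weight_measurable.
rewrite (funext (poisson_weightE j)); apply: integrable_scaled => //.
exact: integrable_natpow_exp.
Qed.

Let summand (r : R) (M : nat) (u : R) : R :=
  \sum_(j < M) (r ^+ j * wright_real eta al m j) * (poisson_weight j u * mu u).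

Let abel_sumE (r : R) (M : nat) :
  abel_sum r M = \int[leb R]_(u in `]0, +oo[) summand r M u.
Proof.
rewrite /summand (@Rintegral_sum R (Rpos R) M (fun j u =>
    (r ^+ j * wright_real eta al m j) * (poisson_weight j u * mu u)))//.
  by apply: eq_bigr => j _; rewrite RintZ ?mulrA//; exact: poisson_mean_integrable.
by move=> j; apply: integrable_scaled => //; exact: poisson_mean_integrable.
Qed.

Let summandE (r : R) (M : nat) (u : R) :
  summand r M u = eta * (\sum_(l < m.+1) newton al m l * (- eta) ^+ l *
    fact_series l (1 - eta) (r * u) M) * expR (- u) * mu u.
Proof.
rewrite /summand /wright_real /fact_series.
under [in RHS]eq_bigr => l _ do rewrite mulr_sumr.
rewrite exchange_big /= mulr_sumr !mulr_suml; apply: eq_bigr => j _.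
rewrite [in LHS]mulr_sumr [in LHS]mulr_sumr [in LHS]mulr_suml
  [in RHS]mulr_sumr !mulr_suml.
apply: eq_bigr => l _; rewrite /poisson_weight exprMn; ring.
Qed.

Definition abel_bound (a u : R) : R :=
  \sum_(l < m.+1) (eta * `|newton al m l| * eta ^+ l * K) * (u ^+ l * expR (- ((1 - a) * u))).

Lemma abel_bound_integrable (a : R) : a < 1 ->
  (leb R).-integrable (Rpos R) (EFin \o abel_bound a).
Proof.
move=> a1; apply: (@integrable_sumR R (Rpos R) m.+1 (fun l u =>
  (eta * `|newton al m l| * eta ^+ l * K) * (u ^+ l * expR (- ((1 - a) * u))))) => // l.
by apply: integrable_scaled => //; apply: integrable_natpow_exp; rewrite subr_gt0.
Qed.

Lemma le_abel_bound (a u : R) (F : nat -> R) : 0 < u ->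
  (forall l, `|F l| <= u ^+ l * expR (a * u)) ->
  `|eta * (\sum_(l < m.+1) newton al m l * (- eta) ^+ l * F l) * expR (- u) * mu u| <=
  abel_bound a u.
Proof.
move=> u0 FB; rewrite !normrM (gtr0_norm eta0) (ger0_norm (expR_ge0 _)).
rewrite (ger0_norm (mu_ge0 u0)) /abel_bound.
apply: (@le_trans _ _ (eta * (\sum_(l < m.+1) `|newton al m l| * eta ^+ l *
    (u ^+ l * expR (a * u))) * expR (- u) * K)).
  rewrite ler_pM ?mulr_ge0 ?expR_ge0 ?(ltW eta0) ?mu_ge0 ?mu_le//.
  rewrite ler_wpM2r ?expR_ge0// ler_wpM2l ?(ltW eta0)//.
  rewrite (le_trans (ler_norm_sum _ _ _))//; apply: ler_sum => l _.
  rewrite !normrM normrX normrN (gtr0_norm eta0) ler_wpM2l ?mulr_ge0 ?exprn_ge0 ?(ltW eta0)//.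
rewrite mulr_sumr !mulr_suml; apply: ler_sum => l _.
rewrite mulrBl mul1r opprB expRD le_eqVlt; apply/orP; left; apply/eqP; ring.
Qed.

(** Termwise integration, by domination, inside the disc of convergence. *)
Lemma abel_sum_cvg (r : R) : 0 <= r <= 1 -> `|1 - eta| * r < 1 ->
  abel_sum r M @[M --> \oo] --> \int[leb R]_(u in `]0, +oo[) abel_density r u.
Proof.
move=> /andP[r0 r1] ar; rewrite (eq_cvg _ _ (abel_sumE r)).
have [] := @Rintegral_dominated R (Rpos R) (summand r) (abel_density r)
  (abel_bound (`|1 - eta| * r)) => //.
- move=> M; apply: (@measurable_fun_sumR R (Rpos R) M (fun j u =>
    (r ^+ j * wright_real eta al m j) * (poisson_weight j u * mu u))) => j.
  apply: measurable_funM => //; apply: measurable_funM => //.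
  by apply: measurable_funTS; exact: poisson_weight_measurable.
- move=> u _; rewrite (eq_cvg _ _ (fun M => summandE r M u)) /abel_density.
  apply: (@cvgM R^o); last exact: cvg_cst.
  apply: (@cvgM R^o); last exact: cvg_cst.
  apply: (@cvgM R^o); first exact: cvg_cst.
  apply: (@cvg_sumR R m.+1 (fun l n => newton al m l * (- eta) ^+ l *
      fact_series l (1 - eta) (r * u) n) (fun l => newton al m l * (- eta) ^+ l *
     ((r * u) ^+ l * expR ((1 - eta) * (r * u))))) => l.
  apply: (@cvgM R^o); first exact: cvg_cst.
  exact: fact_series_cvg.
- exact: abel_bound_integrable.
move=> M u; rewrite /= in_itv/= andbT => u0; rewrite summandE.
apply: (@le_abel_bound _ u (fun l => fact_series l (1 - eta) (r * u) M)) => // l.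
rewrite (le_trans (fact_series_bound _ _ _ _))//.
rewrite normrM (ger0_norm r0) (gtr0_norm u0) mulrA ler_wpM2r ?expR_ge0//.
by rewrite lerXn2r ?nnegrE ?mulr_ge0 ?(ltW u0)// ler_piMl// ltW.
Qed.

(** At the boundary 1 - eta <= 0 the densities stay dominated as r tends to 1. *)
Lemma abel_density_cvg (r_ : nat -> R) : 1 <= eta ->
  (forall k, 0 <= r_ k <= 1) -> r_ k @[k --> \oo] --> (1 : R) ->
  \int[leb R]_(u in `]0, +oo[) abel_density (r_ k) u @[k --> \oo] -->
  \int[leb R]_(u in `]0, +oo[) abel_density 1 u.
Proof.
move=> eta1 r01 r1.
have [] := @Rintegral_dominated R (Rpos R) (fun k => abel_density (r_ k))
  (abel_density 1) (abel_bound 0) => //.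
- move=> k; pose A (u : R) := \sum_(l < m.+1) newton al m l * (- eta) ^+ l *
     ((r_ k * u) ^+ l * expR ((1 - eta) * (r_ k * u))).
  have cA : continuous A.
    move=> x; have ck : {for x, continuous (fun u : R => r_ k * u)}.
      by apply: contM; [exact: cvg_cst|exact: cvg_id].
    apply: (@cont_sumR R x m.+1 (fun l u => newton al m l * (- eta) ^+ l *
       ((r_ k * u) ^+ l * expR ((1 - eta) * (r_ k * u))))) => l.
    apply: (@contM R (fun=> newton al m l * (- eta) ^+ l)); first exact: cvg_cst.
    apply: (@contM R (fun u => (r_ k * u) ^+ l)).
      by apply: (@cont_comp R (fun u => r_ k * u) (fun v => v ^+ l)) => //; exact: exprn_continuous.
    by apply: cont_expR; apply: (@contM R (fun=> 1 - eta)) => //; exact: cvg_cst.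
  have cE : continuous (fun u : R => expR (- u)).
    by move=> x; apply: cont_expR; apply: contN; exact: cvg_id.
  rewrite (_ : abel_density (r_ k) = (fun u => eta * A u * expR (- u) * mu u))//.
  apply: measurable_funM => //; apply: measurable_funTS; apply: measurable_funM.
    by apply: measurable_funM => //; exact: continuous_measurable_fun.
  exact: continuous_measurable_fun.
- move=> u _; rewrite /abel_density.
  apply: (@cvgM R^o); last exact: cvg_cst.
  apply: (@cvgM R^o); last exact: cvg_cst.
  apply: (@cvgM R^o); first exact: cvg_cst.
  apply: (@cvg_sumR R m.+1 (fun l n => newton al m l * (- eta) ^+ l *
     ((r_ n * u) ^+ l * expR ((1 - eta) * (r_ n * u)))) (fun l => newton al m l * (- eta) ^+ l *
     ((1 * u) ^+ l * expR ((1 - eta) * (1 * u))))) => l.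
  apply: (@cvgM R^o); first exact: cvg_cst.
  have ru : r_ k * u @[k --> \oo] --> 1 * u by apply: (@cvgMl R^o).
  apply: (@cvgM R^o).
    exact: (@cvg_cont R (fun x => x ^+ l) _ _ (@exprn_continuous R l _) ru).
  apply: (@cvg_cont R (fun x => expR ((1 - eta) * x))) ru.
  by apply: cont_expR; apply: contM; [exact: cvg_cst|exact: cvg_id].
- by apply: abel_bound_integrable.
move=> k u; rewrite /= in_itv/= andbT => u0.
have /andP[k0 k1] := r01 k.
apply: (@le_abel_bound 0 u (fun l => (r_ k * u) ^+ l * expR ((1 - eta) * (r_ k * u)))) => // l.
rewrite normrM normrX (ger0_norm (expR_ge0 _)) ger0_norm ?mulr_ge0 ?(ltW u0)//.
rewrite ler_pM ?exprn_ge0 ?expR_ge0 ?mulr_ge0 ?(ltW u0)//.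
  by rewrite lerXn2r ?nnegrE ?mulr_ge0 ?(ltW u0)// ler_piMl// ltW.
rewrite ler_expR mul0r mulr_le0_ge0 ?subr_le0// mulr_ge0// ltW//.
Qed.

End PoissonSeries.

(** * Summability of the series *)

Lemma cvg_le_eventually (R : realType) (u : nat -> R) (l b : R) (N : nat) :
  u n @[n --> \oo] --> l -> (forall n, (N <= n)%N -> u n <= b) -> l <= b.
Proof.
move=> ul ub; have <- : limn u = l by exact: (@cvg_lim _ (@Rhausdorff R)).
apply: limr_le; first by apply/cvg_ex; exists l.
by exists N => // n /= Nn; exact: ub.
Qed.

Lemma cvg_sub0 (R : realType) (u v : nat -> R) (l : R) :
  u n @[n --> \oo] --> l -> v n @[n --> \oo] --> l -> u n - v n @[n --> \oo] --> (0 : R).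
Proof.
move=> ul vl; have h : (fun n => u n - v n) @ \oo --> l - l by apply: (@cvgB _ R^o).
by rewrite subrr in h.
Qed.

Lemma abel_parts (R : realType) (d : nat -> R) (r : R) (M : nat) :
  \sum_(j < M) r ^+ j * (d j.+1 - d j) =
  (1 - r) * (\sum_(j < M) r ^+ j * d j.+1) + r ^+ M * d M - d 0%N.
Proof.
elim: M => [|M IH]; first by rewrite !big_ord0 expr0; ring.
by rewrite !big_ord_recr /= IH exprS; ring.
Qed.

(** Abel's theorem. Beyond an index J the partial sums deviate from S by at most e,
    so that the means along r k deviate by at most 2 e, up to (1 - r k) C from the
    first J terms. *)
Lemma abel_limit (R : realType) (a : nat -> R) (r Phi : nat -> R) (S V : R) :
  (\sum_(j < M) a j) @[M --> \oo] --> S ->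
  (forall k, 0 <= r k < 1) -> r k @[k --> \oo] --> (1 : R) ->
  (forall k, (\sum_(j < M) r k ^+ j * a j) @[M --> \oo] --> Phi k) ->
  Phi k @[k --> \oo] --> V -> S = V.
Proof.
move=> aS r01 r1 rPhi PhiV.
pose d j := \sum_(i < j) a i - S.
have dE j : a j = d j.+1 - d j by rewrite /d big_ord_recr /=; ring.
suff H e : 0 < e -> `|V - S| <= 2 * e.
  apply/eqP; rewrite eq_sym -subr_eq0 -normr_eq0 eq_le normr_ge0 andbT.
  apply/ler_addgt0Pl => e e0; rewrite addr0.
  by rewrite (le_trans (H (e / 2) _)) ?divr_gt0// mulrC divfK.
move=> e0; have [J _ Jd] : \forall j \near \oo, `|d j| <= e.
  have : d j @[j --> \oo] --> S - S by apply: (@cvgB _ R^o) => //; exact: cvg_cst.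
  rewrite subrr => /cvgr0Pnorm_le; exact.
have {}Jd j : (J <= j)%N -> `|d j| <= e by exact: Jd.
pose C := \sum_(j < J) `|d j.+1|.
have T q i : 0 <= q < 1 -> (1 - q) * (\sum_(j < J + i) q ^+ j * `|d j.+1|) <=
    (1 - q) * C + e * (q ^+ J - q ^+ (J + i)).
  move=> /andP[q0 q1]; have q1' : 0 <= 1 - q by rewrite subr_ge0 ltW.
  elim: i => [|i IH].
    rewrite addn0 subrr mulr0 addr0 ler_wpM2l//; apply: ler_sum => j _.
    by rewrite ler_piMl// exprn_ile1// ltW.
  rewrite addnS big_ord_recr /= mulrDr exprS.
  have p := exprn_ge0 (J + i) q0.
  have dj : `|d (J + i).+1| <= e by apply: Jd; rewrite -addnS leq_addr.
  have : (1 - q) * (q ^+ (J + i) * `|d (J + i).+1|) <= (1 - q) * (q ^+ (J + i) * e).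
    by rewrite ler_wpM2l// ler_wpM2l.
  move: IH; move: (\sum_(_ < _) _) (q ^+ (J + i)) => X Y; lra.
have B k : `|Phi k - S| <= 2 * e + (1 - r k) * C.
  have h : `|\sum_(j < M) r k ^+ j * a j - S| @[M --> \oo] --> `|Phi k - S|.
    by apply: (@cvg_norm _ R^o); apply: (@cvgB _ R^o); [exact: rPhi|exact: cvg_cst].
  apply: (cvg_le_eventually (N := J)) h _ => M JM.
  under eq_bigr => j _ do rewrite dE; rewrite abel_parts.
  have /andP[q0 q1] := r01 k; have q1' : 0 <= 1 - r k by rewrite subr_ge0 ltW.
  have d0 : d 0%N = - S by rewrite /d big_ord0 sub0r.
  rewrite d0 opprK addrK (le_trans (ler_normD _ _))// normrM (ger0_norm q1').
  have h1 : `|r k ^+ M * d M| <= e.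
    by rewrite normrM ger0_norm ?exprn_ge0// (le_trans _ (Jd M JM))// ler_piMl// exprn_ile1// ltW.
  have h2 : (1 - r k) * `|\sum_(j < M) r k ^+ j * d j.+1| <=
      (1 - r k) * (\sum_(j < M) r k ^+ j * `|d j.+1|).
    rewrite ler_wpM2l// (le_trans (ler_norm_sum _ _ _))//; apply: ler_sum => j _.
    by rewrite normrM ger0_norm ?exprn_ge0.
  have := T (r k) (M - J)%N (r01 k); rewrite subnKC// => h3.
  have h4 : e * (r k ^+ J - r k ^+ M) <= e.
    rewrite ler_piMr ?(ltW e0)// lerBlDr (le_trans (exprn_ile1 _ q0 (ltW q1)))//.
    by rewrite lerDl exprn_ge0.
  by move: h1 h2 h3 h4; lra.
have h : `|Phi k - S| - (1 - r k) * C @[k --> \oo] --> `|V - S| - (1 - 1) * C.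
  apply: (@cvgB _ R^o).
    by apply: (@cvg_norm _ R^o); apply: (@cvgB _ R^o) => //; exact: cvg_cst.
  apply: (@cvgMl R^o); apply: (@cvgB _ R^o) => //; exact: cvg_cst.
rewrite subrr mul0r subr0 in h.
by apply: (cvg_le_eventually (N := 0%N)) h _ => k _; rewrite lerBlDr.
Qed.

(** A polynomial tending to 0 along the naturals vanishes; only its leading
    coefficient in the binomial basis is tracked, by finite differences. *)
Lemma binomial_poly_cvg0 (R : realType) (m : nat) (c : nat -> R) :
  (\sum_(l < m.+1) c l * 'C(j, l)%:R) @[j --> \oo] --> (0 : R) -> c m = 0.
Proof.
elim: m c => [|m IH] c h.
  have E j : \sum_(l < 1) c l * 'C(j, l)%:R = c 0%N by rewrite big_ord1 bin0 mulr1.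
  rewrite (eq_cvg _ _ E) in h.
  have hc : (fun _ : nat => c 0%N) @ \oo --> c 0%N by exact: cvg_cst.
  exact: (@cvg_unique _ (@Rhausdorff R) _ _ _ _ hc h).
apply: (IH (fun l => c l.+1)).
have E j : \sum_(l < m.+1) c l.+1 * 'C(j, l)%:R =
    \sum_(l < m.+2) c l * 'C(j.+1, l)%:R - \sum_(l < m.+2) c l * 'C(j, l)%:R.
  rewrite -sumrB [RHS]big_ord_recl /= !bin0 subrr add0r; apply: eq_bigr => l _.
  by rewrite /bump leq0n add1n binS natrD; ring.
rewrite (eq_cvg _ _ E); apply: cvg_sub0 (h).
by move: (h); rewrite -(cvg_shiftS (fun j => \sum_(l < m.+2) c l * 'C(j, l)%:R)).
Qed.

Lemma gamma_integral_nat (R : realType) (j : nat) :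
  \int[leb R]_(t in `]0, +oo[) gamma_weight (j%:R + 1) t = j`!%:R.
Proof.
elim: j => [|j IH]; last by rewrite -natr1 Rintegral_gammaS ?IH ?natr1 ?factS ?natrM// natr1 ltr0n.
have := @poisson_half R 1 0 ltr01; rewrite expr1n expr0n/= addr0 divr1 => h.
rewrite -[RHS]h; apply: eq_Rintegral => t _.
by rewrite /gamma_weight addrK mul0r sub0r mul0r cos0 mulr1 mul1r.
Qed.

Lemma poisson_laplace (R : realType) (j : nat) (d : R) : 0 <= d ->
  \int[leb R]_(u in `]0, +oo[) (poisson_weight j u * expR (- (d * u))) =
  (1 + d)^-1 ^+ j.+1.
Proof.
move=> d0; have s0 : 0 < 1 + d by rewrite ltr_wpDr.
have f0 : j`!%:R != 0 :> R by rewrite pnatr_eq0 -lt0n fact_gt0.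
have j0 : 0 < j%:R + 1 :> R by rewrite natr1 ltr0n.
have [] := @Rintegral_scale R (gamma_weight (j%:R + 1)) (1 + d) s0
  (fun x => @gamma_weight_cont R _ x) (gamma_weight_integrable j0).
rewrite gamma_integral_nat => ii E.
have E2 u : u \in Rpos R -> poisson_weight j u * expR (- (d * u)) =
    ((1 + d)^-1 ^+ j.+1 / j`!%:R) * ((1 + d) * gamma_weight (j%:R + 1) ((1 + d) * u)).
  rewrite inE /= in_itv /= andbT => u0.
  have su : 0 < (1 + d) * u by rewrite mulr_gt0.
  rewrite /gamma_weight addrK expRD expRM_natl expR_ln//.
  have -> : expR (- ((1 + d) * u)) = expR (- u) * expR (- (d * u)).
    by rewrite -expRD; congr expR; ring.
  rewrite exprMn /poisson_weight exprVn.
  have := expf_neq0 j.+1 (lt0r_neq0 s0); rewrite exprS => n0.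
  have s1 := lt0r_neq0 s0; have n1 := expf_neq0 j (lt0r_neq0 s0).
  move: ((1 + d) ^+ j) (1 + d) (j`!%:R : R) n1 s1 f0 => a b c a0 b0 c0.
  by field; rewrite a0 b0 c0.
transitivity (\int[leb R]_(u in `]0, +oo[) (((1 + d)^-1 ^+ j.+1 / j`!%:R) *
    ((1 + d) * gamma_weight (j%:R + 1) ((1 + d) * u)))); first exact: eq_Rintegral.
by rewrite RintZ// -E divfK.
Qed.

Section Summation.
Variables (R : realType) (mu : R -> R) (K : R).
Hypothesis mu_ge0 : forall u : R, 0 < u -> 0 <= mu u.
Hypothesis mu_le : forall u : R, 0 < u -> mu u <= K.
Hypothesis mu_cont : forall u : R, 0 < u -> {for u, continuous mu}.
Hypothesis mu_lb : forall d : R, 0 < d -> exists2 C, 0 < C & forall u : R, 0 < u ->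
  C * (expR (- (d * u)) - expR d * expR (- (2 * d * u))) <= mu u.
Variables (eta al : R) (m : nat).
Hypotheses (eta0 : 0 < eta) (al0 : 0 < al).

Let W j := wright_real eta al m j.
Let U j := poisson_mean mu j.

(** The lower bound on mu integrates to a geometric one of ratio 1 / (1 + d), which
    exceeds any prescribed geometric decay of ratio below 1 for small d. *)
Lemma poisson_mean_lb (d : R) : 0 < d -> exists2 C, 0 < C & forall j,
  C * ((1 + d)^-1 ^+ j.+1 - expR d * (1 + 2 * d)^-1 ^+ j.+1) <= U j.
Proof.
move=> d0; have [C C0 hC] := mu_lb d0; exists C => // j.
have d2 : 0 < 2 * d by rewrite mulr_gt0.
have ip (e : R) : 0 < e ->
    (leb R).-integrable (Rpos R) (EFin \o (fun u => poisson_weight j u * expR (- (e * u)))).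
  move=> e0; apply: (@mul_mu_integrable R (fun u => expR (- (e * u))) 1) => //.
  - by move=> u u0; rewrite expR_le1 oppr_le0 mulr_ge0// ltW.
  - by move=> u _; apply: cont_expR; apply: contN; apply: contM; [exact: cvg_cst|exact: cvg_id].
  - by apply: measurable_funTS; exact: poisson_weight_measurable.
  rewrite (funext (@poisson_weightE R j)); apply: integrable_scaled => //.
  exact: integrable_natpow_exp.
rewrite -(poisson_laplace j (ltW d0)) -(poisson_laplace j (ltW d2)).
rewrite -RintZ//; last exact: ip.
rewrite -RintegralB//; [|exact: ip|by apply: integrable_scaled => //; exact: ip].
rewrite -RintZ//; last first.
  by apply: integrableB_EFin => //; [exact: ip|apply: (@integrable_scaled R (Rpos R)) => //; exact: ip].
apply: le_Rintegral => //.
- apply: integrable_scaled => //.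
  by apply: integrableB_EFin => //; [exact: ip|apply: (@integrable_scaled R (Rpos R)) => //; exact: ip].
- exact: (poisson_mean_integrable mu_ge0 mu_le mu_cont).
move=> u; rewrite /= in_itv /= andbT => u0.
have p0 : 0 <= poisson_weight j u.
  by rewrite /poisson_weight !mulr_ge0 ?exprn_ge0 ?expR_ge0 ?ltW.
apply: le_trans (ler_wpM2l p0 (hC u u0)); rewrite le_eqVlt; apply/orP; left; apply/eqP; ring.
Qed.

Let c l := eta * newton al m l * (- eta) ^+ l * l`!%:R / (1 - eta) ^+ l.

Let WE j : 1 - eta != 0 -> W j = (1 - eta) ^+ j * (\sum_(l < m.+1) c l * 'C(j, l)%:R).
Proof.
move=> A0; rewrite /W /wright_real !mulr_sumr; apply: eq_bigr => l _.
have [lj|lj] := leqP l j; last by rewrite ffact_small// bin_small// !(mulr0, mul0r).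
have -> : (1 - eta) ^+ j = (1 - eta) ^+ (j - l) * (1 - eta) ^+ l by rewrite -exprD subnK.
rewrite -(bin_ffact j l) natrM /c.
have n1 := expf_neq0 l A0; move: ((1 - eta) ^+ l) n1 => a a0.
by field.
Qed.

(** Beyond eta = 2 the terms grow: the means decay slower than (eta - 1)^(-j),
    while wright_real is (1 - eta)^j times a nonzero polynomial in j. *)
Lemma not_summable (S : R) : 2 < eta ->
  ~ (\sum_(j < M) W j * U j) @[M --> \oo] --> S.
Proof.
move=> eta2 h.
have t0 : W j * U j @[j --> \oo] --> (0 : R).
  have E j : W j * U j = \sum_(i < j.+1) W i * U i - \sum_(i < j) W i * U i.
    by rewrite big_ord_recr /=; ring.
  rewrite (eq_cvg _ _ E); apply: cvg_sub0 (h).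
  by move: (h); rewrite -(cvg_shiftS (fun j => \sum_(i < j) W i * U i)).
(* With this d, 1 + d < B = 1 + 2 d, so that U j * B^(j+1) stays away from 0. *)
pose B := eta - 1; pose d := (B - 1) / 2.
have d0 : 0 < d by rewrite /d /B; lra.
have B0 : 0 < B by rewrite /B; lra.
have [C C0 hU] := poisson_mean_lb d0.
have q1 : `|(1 + d) / B| < 1.
  have d1 : 0 < (1 + d) / B by rewrite divr_gt0//; lra.
  by rewrite (gtr0_norm d1) ltr_pdivrMr// mul1r /d /B; lra.
have e1 : 0 < (1 + expR d)^-1 :> R by rewrite invr_gt0 addr_gt0// expR_gt0.
have [J _ hJ] : \forall j \near \oo, `|((1 + d) / B) ^+ j| < (1 + expR d)^-1.
  by have /cvgr0Pnorm_lt := cvg_expr q1; exact.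
have key j : (J <= j)%N -> C <= U j * B ^+ j.+1.
  move=> Jj; have Bj : 0 < B ^+ j.+1 by rewrite exprn_gt0.
  have h2 : 1 + 2 * d = B by rewrite /d; field.
  have := ler_wpM2r (ltW Bj) (hU j); rewrite h2 => le1; apply: le_trans le1.
  rewrite -mulrA ler_peMr ?(ltW C0)// mulrBl -mulrA -!exprMn mulVf ?gt_eqF// expr1n mulr1.
  have pq : 0 < ((1 + d) / B) ^+ j.+1 by rewrite exprn_gt0// divr_gt0//; rewrite /d; lra.
  have := hJ j.+1 (leqW Jj) => /=; rewrite (gtr0_norm pq) => lt1.
  have -> : (1 + d)^-1 * B = ((1 + d) / B)^-1 by rewrite invf_div mulrC.
  rewrite exprVn lerBrDr -[leLHS]invrK lef_pV2 ?posrE ?invr_gt0 ?addr_gt0 ?expR_gt0//.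
  exact: ltW.
have A0 : 1 - eta != 0 by rewrite lt_eqF//; lra.
have cv : (\sum_(l < m.+1) c l * 'C(j, l)%:R) @[j --> \oo] --> (0 : R).
  have T0 : B / C * (W j * U j) @[j --> \oo] --> (0 : R).
    by have := @cvgMr R^o _ _ _ _ (B / C) _ t0; rewrite mulr0; exact.
  apply/cvgr0Pnorm_le => e e0; move/cvgr0Pnorm_le : T0 => /(_ e e0)[J' _ hJ'].
  exists (maxn J J') => // j /=; rewrite geq_max => /andP[Jj J'j].
  apply: le_trans (hJ' j J'j); rewrite WE// !normrM normrX.
  have -> : `|1 - eta| = B by rewrite ltr0_norm /B; lra.
  have k := key j Jj; have nU := ler_norm (U j).
  set P := `|\sum_(l < _) _|; have P0 : 0 <= P by exact: normr_ge0.
  rewrite (gtr0_norm B0) normfV (gtr0_norm C0).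
  rewrite -[leLHS]mul1r (_ : _ * _ * _ = (`|U j| * B ^+ j.+1 / C) * P); last first.
    by rewrite exprS; field; rewrite gt_eqF.
  rewrite ler_wpM2r// ler_pdivlMr// mul1r (le_trans k)// ler_wpM2r//.
  exact: (exprn_ge0 _ (ltW B0)).
have := binomial_poly_cvg0 cv; rewrite /c newton_lead => /eqP.
have f0 : m`!%:R != 0 :> R by rewrite pnatr_eq0 -lt0n fact_gt0.
have e0 := lt0r_neq0 eta0; have a0 := lt0r_neq0 al0.
by apply/negP; rewrite !mulf_neq0 ?invr_neq0 ?expf_neq0 ?oppr_eq0.
Qed.

Let V := \int[leb R]_(u in `]0, +oo[) abel_density mu eta al m 1 u.

Lemma poisson_series_cvg : eta < 2 -> (\sum_(j < M) W j * U j) @[M --> \oo] --> V.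
Proof.
move=> eta2.
have E M : \sum_(j < M) W j * U j = abel_sum mu eta al m 1 M.
  by apply: eq_bigr => j _; rewrite expr1n mul1r.
rewrite (eq_cvg _ _ E).
apply: (@abel_sum_cvg R mu K mu_ge0 mu_le mu_cont eta al m eta0 1).
  by rewrite ler01 lexx.
by have := eta0; rewrite mulr1 ltr_norml => e0; apply/andP; split; lra.
Qed.

(** For eta = 2 the series need not converge absolutely, and its sum is identified
    by Abel's theorem. *)
Lemma poisson_series_sum (S : R) :
  (\sum_(j < M) W j * U j) @[M --> \oo] --> S -> S = V.
Proof.
move=> hS; have [eta2|eta2|eta2] := ltgtP eta 2.
- exact: (@cvg_unique _ (@Rhausdorff R) _ _ _ _ hS (poisson_series_cvg eta2)).
- by case: (not_summable eta2 hS).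
(* Here eta = 2, so that 1 - eta = -1 lies on the circle of convergence. *)
pose r (k : nat) : R := 1 - k.+1%:R^-1.
have r01 k : 0 <= r k < 1.
  by rewrite /r subr_ge0 invf_le1// ler1n /= ltrBlDr ltrDl invr_gt0.
have r1 : r k @[k --> \oo] --> (1 : R).
  rewrite -[X in _ --> X]subr0; apply: (@cvgB _ R^o); first exact: cvg_cst.
  exact: cvg_harmonic.
have rP k : (\sum_(j < M) r k ^+ j * (W j * U j)) @[M --> \oo] -->
    \int[leb R]_(u in `]0, +oo[) abel_density mu eta al m (r k) u.
  have /andP[a b] := r01 k.
  apply: (@abel_sum_cvg R mu K mu_ge0 mu_le mu_cont eta al m eta0 (r k)); first by rewrite a ltW.
  by rewrite eta2 (_ : 1 - 2 = -1) ?normrN1 ?mul1r//; ring.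
apply: (@abel_limit R (fun j => W j * U j) r (fun k => \int[leb R]_(u in `]0, +oo[)
  abel_density mu eta al m (r k) u) S V hS r01 r1 rP).
apply: (@abel_density_cvg R mu K mu_ge0 mu_le mu_cont eta al m eta0 r) => //.
  by rewrite eta2; lra.
by move=> k; have /andP[a b] := r01 k; rewrite a ltW.
Qed.

End Summation.

(** * The heat kernel *)

(** The heat kernel in the variable t, with a = N / 2 and b = |x|^2 / 4. *)
Definition heat (R : realType) (k a b t : R) : R := expR (k - a * ln t - b / t).

Lemma heat_cont (R : realType) (k a b t : R) : 0 < t -> {for t, continuous (heat k a b)}.
Proof.
move=> t0; apply: cont_expR; apply: (@contD R (fun t => k - a * ln t) (fun t => - (b / t))).
  apply: (@contD R (fun=> k)); first exact: cvg_cst.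
  apply: contN; apply: contM; [exact: cvg_cst|exact: continuous_ln].
apply: contN; apply: contM; first exact: cvg_cst.
by apply: contV; [rewrite gt_eqF|exact: cvg_id].
Qed.

Lemma heat_bounded (R : realType) (k a b : R) : 0 < a -> 0 < b ->
  exists K, forall t, 0 < t -> heat k a b t <= K.
Proof.
move=> a0 b0; have [C hC] := ln_le_linear a0 b0; exists (expR (k + C)) => t t0.
have ti : 0 < t^-1 by rewrite invr_gt0.
have := hC t^-1 ti; rewrite lnV ?posrE// /heat ler_expR; lra.
Qed.

(** For u < 1 the left-hand side is nonpositive; for u >= 1 a power of u is compared
    with an exponential. *)
Lemma heat_lb (R : realType) (k a b d : R) : 0 < a -> 0 < b -> 0 < d ->
  exists2 C, 0 < C & forall u, 0 < u ->
  C * (expR (- (d * u)) - expR d * expR (- (2 * d * u))) <= heat k a b u.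
Proof.
move=> a0 b0 d0; have [C hC] := ln_le_linear a0 d0.
exists (expR (k - C - b)); first exact: expR_gt0.
move=> u u0; have [u1|u1] := leP 1 u.
  have h1 : b / u <= b by rewrite ler_pdivrMr// ler_peMr// ltW.
  apply: (@le_trans _ _ (expR (k - C - b) * expR (- (d * u)))).
    by rewrite ler_wpM2l ?expR_ge0// lerBlDr lerDl mulr_ge0 ?expR_ge0.
  by rewrite -expRD /heat ler_expR; have := hC u u0; lra.
rewrite (le_trans _ (expR_ge0 _))// mulr_ge0_le0 ?expR_ge0// subr_le0 -expRD ler_expR.
nra.
Qed.

Lemma heat_scale (R : realType) (k a b h u : R) : 0 < h -> 0 < u ->
  heat k a b (h * u) = heat (k - a * ln h) a (b / h) u.
Proof.
move=> h0 u0; rewrite /heat lnM ?posrE//; congr expR; field.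
by rewrite !gt_eqF.
Qed.

Lemma gauss_kernelE (R : realType) (N : nat) (x : 'rV[R]_N) (t : R) : 0 < t ->
  gauss_kernel t x =
  heat (- (N%:R / 2 * ln (4 * pi))) (N%:R / 2) (enorm x ^+ 2 / 4) t.
Proof.
move=> t0; have p0 : 0 < 4 * pi :> R by rewrite mulr_gt0// pi_gt0.
rewrite /gauss_kernel /heat /powR gt_eqF ?mulr_gt0 ?pi_gt0// -expRD; congr expR.
rewrite lnM ?posrE//; field; rewrite gt_eqF//.
Qed.

Lemma discrete_gauss_kernelE (R : realType) (N : nat) (x : 'rV[R]_N) (h : R) (j : nat) :
  0 < h -> (0 < N)%N -> 0 < enorm x ->
  discrete_gauss_kernel j.+1 h x =
  poisson_mean (heat (- (N%:R / 2 * ln (4 * pi)) - N%:R / 2 * ln h) (N%:R / 2)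
    (enorm x ^+ 2 / 4 / h)) j.
Proof.
move=> h0 N0 x0; rewrite /discrete_gauss_kernel rGamma_nat /poisson_mean.
set k := - (N%:R / 2 * ln (4 * pi)); set a := N%:R / 2; set b := enorm x ^+ 2 / 4.
have a0 : 0 < a by rewrite divr_gt0// ltr0n.
have b0 : 0 < b by rewrite divr_gt0// exprn_gt0.
pose f t := t ^+ j * expR (- (h^-1 * t)) * heat k a b t.
have fc (t : R) : 0 < t -> {for t, continuous f}.
  move=> t0; apply: contM; last exact: heat_cont.
  apply: (@contM R (fun t => t ^+ j)); first exact: exprn_continuous.
  by apply: cont_expR; apply: contN; apply: contM; [exact: cvg_cst|exact: cvg_id].
have [K hK] := heat_bounded k a0 b0.
have fi : (leb R).-integrable (Rpos R) (EFin \o f).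
  apply: (@mul_mu_integrable R (heat k a b) K) => //.
  - by move=> u u0; exact: expR_ge0.
  - by move=> u u0; exact: heat_cont.
  - apply: measurable_funTS; apply: continuous_measurable_fun => t.
    apply: (@contM R (fun t => t ^+ j)); first exact: exprn_continuous.
    by apply: cont_expR; apply: contN; apply: contM; [exact: cvg_cst|exact: cvg_id].
  - by apply: integrable_natpow_exp; rewrite invr_gt0.
have -> : \int[leb R]_(t in `]0, +oo[) (expR (- (t / h)) * t ^+ j.+1.-1 * gauss_kernel t x) =
    \int[leb R]_(t in `]0, +oo[) f t.
  apply: eq_Rintegral => t; rewrite inE /= in_itv /= andbT => t0.
  by rewrite gauss_kernelE// /f [t / h]mulrC; ring.
have [ig ->] := Rintegral_scale h0 fc fi.
rewrite -RintZ//; apply: eq_Rintegral => u; rewrite inE /= in_itv /= andbT => u0.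
rewrite /f heat_scale// /poisson_weight mulKf ?gt_eqF//.
have h1 := lt0r_neq0 h0; have f0 : j`!%:R != 0 :> R by rewrite pnatr_eq0 -lt0n fact_gt0.
rewrite exprMn exprS; have := expf_neq0 j h1; move: (h ^+ j) (j`!%:R : R) f0 => p q q0 p0.
by field; rewrite h1 p0 q0.
Qed.

Lemma fox_density_cont (R : realType) (al : R) (m : nat) (a z t : R) : 0 < t ->
  {for t, continuous (fox_density al m a z)}.
Proof.
move=> t0; apply: contM; last exact: wright_poly_cont.
have tn : t != 0 by rewrite gt_eqF.
apply: cont_expR; apply: (@contD R (fun t => a * (ln z - ln t) - t) (fun t => - (z / t))).
  apply: (@contD R (fun t => a * (ln z - ln t)) (fun t => - t)); last by apply: contN; exact: cvg_id.
  apply: (@contM R (fun=> a)); first exact: cvg_cst.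
  apply: (@contD R (fun=> ln z)); first exact: cvg_cst.
  by apply: contN; exact: continuous_ln.
apply: contN; apply: (@contM R (fun=> z)); first exact: cvg_cst.
by apply: contV; [|exact: cvg_id].
Qed.

(** Substituting t = eta u identifies the sum of the series with the Fox integral. *)
Lemma abel_density_fox (R : realType) (eta al k k' a z b : R) (m : nat) :
  0 < eta -> 0 < z -> z / eta = b -> k = k' + a * (ln z - ln eta) ->
  \int[leb R]_(u in `]0, +oo[) abel_density (heat k a b) eta al m 1 u =
  expR k' * \int[leb R]_(t in `]0, +oo[) fox_density al m a z t.
Proof.
move=> eta0 z0 zb kk.
have fi := @fox_density_integrable R al m a z z0.
have [ig ->] := Rintegral_scale eta0 (fun t => @fox_density_cont R al m a z t) fi.
rewrite -RintZ//; apply: eq_Rintegral => u; rewrite inE /= in_itv /= andbT => u0.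
rewrite /fox_density /abel_density /heat /wright_poly lnM ?posrE//.
have E l : newton al m l * (- eta) ^+ l * ((1 * u) ^+ l * expR ((1 - eta) * (1 * u))) =
    newton al m l * (- (eta * u)) ^+ l * expR ((1 - eta) * u).
  by rewrite mul1r -(mulNr eta u) [(- eta * u) ^+ l]exprMn; ring.
under eq_bigr => l _ do rewrite E.
rewrite -mulr_suml; set P := \sum_(l < m.+1) _.
have -> : expR k' * (eta * (expR (a * (ln z - (ln eta + ln u)) - eta * u - z / (eta * u)) * P)) =
    eta * P * (expR k' * expR (a * (ln z - (ln eta + ln u)) - eta * u - z / (eta * u))) by ring.
have -> : eta * (P * expR ((1 - eta) * u)) * expR (- u) * expR (k - a * ln u - b / u) =
    eta * P * (expR ((1 - eta) * u) * expR (- u) * expR (k - a * ln u - b / u)) by ring.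
rewrite -!expRD; congr (_ * expR _); rewrite kk -zb; field.
by rewrite !gt_eqF.
Qed.

(** * The fundamental solution *)

Lemma cvg_real_complex (R : realType) (s : nat -> R) (l : R) :
  s n @[n --> \oo] --> l ->
  ((s n)%:C : R[i]^o) @[n --> \oo] --> (l%:C : R[i]^o).
Proof.
move=> sl; apply/cvgrPdist_lt => -[e f]; rewrite ltcE /= => /andP[/eqP -> e0].
move/cvgrPdist_lt : sl => /(_ e e0)[N _ hN]; exists N => // n /= Nn.
rewrite -rCN -rCD normc_def /= expr0n /= addr0 sqrtr_sqr ltcR.
exact: hN.
Qed.

Lemma cvg_complex_Re (R : realType) (s : nat -> R) (L : R[i]) :
  ((s n)%:C : R[i]^o) @[n --> \oo] --> (L : R[i]^o) ->
  s n @[n --> \oo] --> complex.Re L.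
Proof.
move=> sL; apply/cvgrPdist_lt => e e0.
have e0C : 0 < e%:C by rewrite ltcR.
move/cvgrPdist_lt : sL => /(_ _ e0C)[N _ hN]; exists N => // n /= Nn.
have := hN n Nn; rewrite -ltcR; apply: le_lt_trans.
by have := normc_ge_Re (L - (s n)%:C); rewrite ReCD.
Qed.

Lemma powR_expR (R : realType) (x y : R) : 0 < x -> x `^ y = expR (y * ln x).
Proof. by move=> x0; rewrite /powR gt_eqF. Qed.

Theorem proposition5p3 (R : realType) (N : nat) (h alpha rho : R) (n : nat)
    (x : 'rV[R]_N) (HN : (1 <= N)%N) (hh : 0 < h)
    (halpha : 0 < alpha < 1) (hrho : 0 < rho < 1)
    (hn : (1 <= n)%N) (hx : x != 0) :
  exists H : R[i],
    [/\ is_foxH 3 0 [:: (1, alpha)] [:: (n%:R, alpha); (N%:R / 2, 1); (1, 1)]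
          (enorm x ^+ 2 / (4 * h `^ alpha))%:C H,
        (h `^ (1 - alpha) < 2 -> cvgn (fundamental_partial_sum rho alpha n h x)) &
        (cvgn (fundamental_partial_sum rho alpha n h x) ->
         fundamental_solution rho alpha n h x =
         (rGamma n%:R * pi `^ (N%:R / 2) * enorm x ^+ N)^-1%:C * H)].
Proof.
case: n hn => // m _.
have x0 : 0 < enorm x.
  rewrite /enorm sqrtr_gt0 lt_neqAle sumr_ge0 ?andbT; last by move=> i _; exact: sqr_ge0.
  apply: contra hx; rewrite eq_sym psumr_eq0 => [/allP h0|i _]; last exact: sqr_ge0.
  apply/eqP/rowP => i; rewrite mxE; apply/eqP.
  by have := h0 i (mem_index_enum i); rewrite sqrf_eq0.
pose a : R := N%:R / 2; pose z := enorm x ^+ 2 / (4 * h `^ alpha).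
pose eta := expR ((1 - alpha) * ln h).
pose k := - (a * ln (4 * pi)) - a * ln h; pose b := enorm x ^+ 2 / 4 / h.
pose mu := heat k a b.
pose I := \int[leb R]_(t in `]0, +oo[) fox_density alpha m a z t.
have ha0 : 0 < h `^ alpha by rewrite powR_gt0.
have a0 : 0 < a by rewrite divr_gt0// ltr0n.
have z0 : 0 < z by rewrite divr_gt0 ?mulr_gt0// exprn_gt0.
have b0 : 0 < b by rewrite !divr_gt0// exprn_gt0.
have eta0 : 0 < eta by exact: expR_gt0.
have al0 : 0 < alpha by case/andP: halpha.
have [K hK] := heat_bounded k a0 b0.
have mu0 (u : R) : 0 < u -> 0 <= mu u by move=> _; exact: expR_ge0.
have muc (u : R) : 0 < u -> {for u, continuous mu} by exact: heat_cont.
have mub (d : R) (d0 : 0 < d) := heat_lb k a0 b0 d0.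
pose s M := \sum_(j < M) wright_real eta alpha m j * poisson_mean mu j.
have sE : fundamental_partial_sum rho alpha m.+1 h x = (fun M => (s M)%:C).
  apply/funext => M; rewrite /fundamental_partial_sum big_add1 /= big_mkord /s rC_sum.
  by apply: eq_bigr => j _; rewrite wrightE// discrete_gauss_kernelE// rCM.
pose V := \int[leb R]_(u in `]0, +oo[) abel_density mu eta alpha m 1 u.
have VE : V = (pi `^ a * enorm x ^+ N)^-1 * I.
  have hE : h `^ alpha * eta = h.
    by rewrite powR_expR// -expRD -mulrDl addrC subrK mul1r expR_ln.
  have cE : (pi `^ a * enorm x ^+ N)^-1 = expR (- (a * ln pi + N%:R * ln (enorm x))).
    by rewrite expRN expRD powR_expR ?pi_gt0// expRM_natl expR_ln.
  rewrite cE; apply: abel_density_fox => //.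
    by rewrite /z /b -{2}hE; field; rewrite !gt_eqF.
  rewrite /k /z ln_div ?posrE ?exprn_gt0 ?mulr_gt0// lnXn// !lnM ?posrE ?pi_gt0//.
  by rewrite powR_expR// !expRK /a mulr2n; field.
exists (m`!%:R * I)%:C; split.
- have -> : N%:R / 2 = a%:C :> R[i] by rewrite /a rCM rCV -!natC.
  exact: is_foxH_wright.
- rewrite powR_expR// -/eta => eta2; rewrite sE.
  apply/cvg_ex; exists (V%:C : R[i]^o); apply: cvg_real_complex.
  exact: (@poisson_series_cvg R mu K mu0 hK muc eta alpha m eta0 eta2).
rewrite /fundamental_solution sE => /cvg_ex[L hL].
have hS := cvg_complex_Re hL.
have SV := @poisson_series_sum R mu K mu0 hK muc mub eta alpha m eta0 al0 _ hS.
rewrite SV in hS; have hV := cvg_real_complex hS.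
rewrite (cvg_lim _ hV)// -rCM; apply: (congr1 (real_complex R)).
rewrite -/V VE rGamma_nat; have f0 : m`!%:R != 0 :> R by rewrite pnatr_eq0 -lt0n fact_gt0.
rewrite -mulrA [in RHS]invfM mulrA; congr (_ * _).
by rewrite [in RHS]mulrAC mulVf// mul1r.
Qed.
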